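(* Let $\lambda'=\pi^2/6$. For the modified bootstrap model on $\mathbb{Z}^2$ the following hold. (A) Let $(L_n)$ be a sequence of positive integers and $(p_n)$ a sequence in $[0,1]$ with $L_n\to\infty$ and $p_n\to0$. (i) If $\liminf_{n\to\infty}p_n\log L_n>\lambda'$ then $\lim_{n\to\infty}I'(L_n,p_n)=1$. (ii) If $\limsup_{n\to\infty}p_n\log L_n<\lambda'$ then $\lim_{n\to\infty}I'(L_n,p_n)=0$. (B) (i) $\limsup_{p\to0}\ \sup_{m\ge1}\ \bigl(-p\log I'(m,p)\bigr)\le2\lambda'$, where the supremum is over positive integers $m$. (ii) $\liminf_{B\to\infty}\ \liminf_{p\to0}\ \bigl(-p\log I'(\lfloor B/p\rfloor,p)\bigr)\ge2\lambda'$. (C) Let $(t_n)$ be a sequence of positive integers and $(p_n)$ a sequence in $[0,1]$ with $t_n\to\infty$ and $p_n\to0$. (i) If $\liminf_{n\to\infty}p_n\log t_n>\lambda'$ then $\lim_{n\to\infty}J'(t_n,p_n)=1$. (ii) If $\limsup_{n\to\infty}p_n\log t_n<\lambda'$ then $\lim_{n\to\infty}J'(t_n,p_n)=0$.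
   Context: Modified bootstrap model: let $e_1=(1,0)$, $e_2=(0,1)$, and for $K\subseteq\mathbb{Z}^2$ define $\mathcal{B}'(K)=K\cup\{x\in\mathbb{Z}^2:|\{x+e_i,x-e_i\}\cap K|\ge1\text{ for each of }i=1,2\}$ and $\langle K\rangle'=\lim_{t\to\infty}(\mathcal{B}')^t(K)=\bigcup_{t\ge0}(\mathcal{B}')^t(K)$, where $(\mathcal{B}')^t$ is the $t$-th iterate. For $p\in[0,1]$, let $X\subseteq\mathbb{Z}^2$ be the random set in which each site is included independently with probability $p$, and let $P_p$ be the corresponding product probability measure. For a positive integer $L$ let $R(L,L)=\{1,\dots,L\}\times\{1,\dots,L\}$. Define $I'(L,p)=P_p\bigl(\langle X\cap R(L,L)\rangle'=R(L,L)\bigr)$ and $J'(t,p)=P_p\bigl((0,0)\in(\mathcal{B}')^t(X)\bigr)$. In (B), $p\to0$ through $p\in(0,1)$, $B$ is a positive real, and $\lfloor\cdot\rfloor$ denotes the integer part. *)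

(* Defs.v *)
(* MathComp-Analysis *)
From mathcomp Require Import all_boot all_order all_algebra.
From mathcomp Require Import all_classical all_reals all_analysis.
Export Order.TTheory GRing.Theory Num.Theory.
Export numFieldNormedType.Exports.

Set Implicit Arguments.
Unset Strict Implicit.
Unset Printing Implicit Defensive.

Local Open Scope classical_set_scope.
Local Open Scope ring_scope.

Definition site : Type := (int * int)%type.

Definition e1 : site := (1, 0).
Definition e2 : site := (0, 1).

(* A two-element set meets [K] iff its intersection with [K] has
   cardinality at least 1. *)
Definition mod_step (K : set site) : set site :=
  K `|` [set x | ([set x + e1; x - e1] `&` K !=set0) /\
                 ([set x + e2; x - e2] `&` K !=set0)].

Definition mod_closure (K : set site) : set site :=
  \bigcup_(t in [set: nat]) iter t mod_step K.

Definition square (L : nat) : set site :=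
  [set x | (1 <= x.1 <= L%:Z) /\ (1 <= x.2 <= L%:Z)].

Definition occupied (x : site) : set (set site) := [set X | X x].

(* Configurations, with the product sigma-algebra of {0,1}^(Z^2), i.e. the one
   generated by the coordinate events. *)
Definition config := g_sigma_algebraType (range occupied).

Definition independent_events d (T : measurableType d) (R : realType)
    (P : probability T R) (I : choiceType) (E : I -> set T) : Prop :=
  forall s : seq I, uniq s ->
    P (\bigcap_(i in [set` s]) E i) = (\prod_(i <- s) P (E i))%E.

(* These conditions determine [P] uniquely, since finite intersections of
   coordinate events form a pi-system generating the sigma-algebra. *)
Definition is_product_measure (R : realType) (p : R)
    (P : probability config R) : Prop :=
  (forall x, P (occupied x) = p%:E) /\ independent_events P occupied.

Section probabilities.
Variables (R : realType) (P : R -> probability config R).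

Definition I' (L : nat) (p : R) : R :=
  fine (P p [set X | mod_closure (X `&` square L) = square L]).

Definition J' (t : nat) (p : R) : R :=
  fine (P p [set X | iter t mod_step X (0, 0)]).

End probabilities.

Definition lambda' (R : realType) : R := pi ^+ 2 / 6.

(* Main.v *)
(* Lower bounds.  A single occupied site whose k-th next column and row each
   contain an occupied site opposite the k x k square already filled grows
   forever; this costs p * prod_k (1 - (1 - p)^k)^2, and
   - sum_k ln (1 - (1 - p)^k) <= zeta(2) / p = lambda' / p by expanding the
   logarithm.  Once there are many more than exp (2 lambda' / p) disjoint places
   for such a seed one of them occurs, and it fills the whole box because every
   segment of length (3 ln L) / p contains an occupied site.

   Upper bounds.  Under the modified rule two filled rectangles merge exactly
   when their sup-norm distance is at most 1, so a spanned rectangle R carries a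
   binary merging tree.  Going down this tree until the semi-perimeter has
   dropped by delta / p gives disjointly spanned R1, R2 whose hull R' fills R, and
   the inequality of van den Berg and Kesten bounds the probability by
   P(R1) P(R2) P(R' fills R).  The last factor is the exponential of minus the
   cost of a lattice path from R' to R, for the step cost
   g(k) = - ln (1 - (1 - p)^k).  The least path cost is subadditive under merging,
   because g is decreasing: paths for R1 and R2 can be added.  Hence P(R) is at
   most exp (- least path cost from the origin to R), up to a polynomial factor;
   by convexity of g the diagonal path is optimal, with cost about 2 lambda' / p.
   A configuration that fills a large box has a spanned rectangle at every
   intermediate scale, and the union bound gives the critical exponent.

   The value zeta(2) = pi^2 / 6 comes from iterating
   1 / sin^2 x = (1 / sin^2 (x/2) + 1 / cos^2 (x/2)) / 4. *)
Require Import Defs.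
From mathcomp Require Import all_boot all_order all_algebra.
From mathcomp Require Import all_classical all_reals all_analysis.
From mathcomp Require Import zify ring lra.
Import Order.TTheory GRing.Theory Num.Theory.
Import numFieldNormedType.Exports.
Set Implicit Arguments.
Unset Strict Implicit.
Unset Printing Implicit Defensive.
Local Open Scope classical_set_scope.
Local Open Scope ring_scope.

(** * Finite product measures *)

(** All events depend on finitely many sites, so the estimates are carried out on the finite
    averages [Ex], where independence means that no site is read by both of two functions. The
    obstacle in the upper bound is that the columns and rows between two nested rectangles cross: an
    occupied site at a crossing serves two lines, so the probability of filling is not a plain
    product over lines. The correction has one factor [1 + p / (a * b)] for each crossing. It is
    harmless only if columns and rows number at most [delta / p] with [delta] small, if [a] and [b]
    stay away from 0, and if the cost of a line stays away from 0. Hence three devices: the descent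
    in slices of [delta / p], a shift of the cost by about [e / p], and the restriction to sides of
    at most [B / p]. The constants are chosen in the order [eps], then [eta] and [e], then [B], then
    [delta], and [p] last. The number of levels of the descent depends on [B / delta] alone, which
    keeps the counting factor polynomial in [1 / p]. *)

Section finite_product.
Variable R : realType.
Implicit Types (p : R) (s l : seq site) (x y : site) (A B K : set site).
Implicit Types (f g : set site -> R).

(* The expectation of [f X] when [X] is the random subset of [s] that contains
   each of its sites independently with probability [p]. *)
Fixpoint Ex p s f : R :=
  if s is x :: s' then (1 - p) * Ex p s' f + p * Ex p s' (fun A => f (x |` A))
  else f set0.

Definition ind (Q : Prop) : R := (`[< Q >])%:R.

Lemma ind_true (Q : Prop) : Q -> ind Q = 1.
Proof. by move=> q; rewrite /ind asboolT. Qed.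

Lemma ind_false (Q : Prop) : ~ Q -> ind Q = 0.
Proof. by move=> q; rewrite /ind asboolF. Qed.

Lemma ind_ge0 (Q : Prop) : 0 <= ind Q.
Proof. exact: ler0n. Qed.

Lemma ind_le1 (Q : Prop) : ind Q <= 1.
Proof. by rewrite /ind; case: asboolP => _ //; exact: ler01. Qed.

Lemma ind_le (Q Q' : Prop) : (Q -> Q') -> ind Q <= ind Q'.
Proof.
move=> QQ'; have [q|q] := pselect Q; first by rewrite !ind_true //; exact: QQ'.
by rewrite (ind_false q) ind_ge0.
Qed.

Lemma ind_not (Q : Prop) : ind (~ Q) = 1 - ind Q.
Proof.
have [q|q] := pselect Q; first by rewrite ind_false ?ind_true ?subrr //; exact.
by rewrite ind_true // ind_false // subr0.
Qed.

Lemma ind_and (Q Q' : Prop) : ind (Q /\ Q') = ind Q * ind Q'.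
Proof.
have [q|q] := pselect Q; last by rewrite (ind_false q) mul0r ind_false // => -[].
have [q'|q'] := pselect Q'; first by rewrite !ind_true // mulr1.
by rewrite (ind_false q') mulr0 ind_false // => -[].
Qed.

Lemma ind_ex (I : eqType) (r : seq I) (F : I -> Prop) :
  ind (exists2 i, i \in r & F i) <= \sum_(i <- r) ind (F i).
Proof.
have [[i ir Fi]|nE] := pselect (exists2 i, i \in r & F i); last first.
  by rewrite ind_false // sumr_ge0 // => i _; exact: ind_ge0.
rewrite (big_rem i) //= (ind_true Fi) (le_trans (ind_le1 _)) // lerDl.
by rewrite sumr_ge0 // => j _; exact: ind_ge0.
Qed.

Lemma ind_forall (I : eqType) (r : seq I) (F : I -> Prop) :
  ind (forall i, i \in r -> F i) = \prod_(i <- r) ind (F i).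
Proof.
have [aF|naF] := pselect (forall i, i \in r -> F i).
  by rewrite ind_true // big_seq big1 // => i /aF; exact: ind_true.
rewrite ind_false //; apply/esym/eqP; rewrite prodf_seq_eq0.
apply: contrapT => nh; apply: naF => i ir; apply: contrapT => nFi.
by apply: nh; apply/hasP; exists i => //=; rewrite ind_false.
Qed.

Lemma Ex_le p s f g : 0 <= p <= 1 ->
  (forall A, A `<=` [set` s] -> f A <= g A) -> Ex p s f <= Ex p s g.
Proof.
move=> /andP[p0 p1]; elim: s f g => [|x s IH] f g fg /=; first exact: fg.
rewrite lerD // ler_wpM2l ?subr_ge0 //; apply: IH => A As; apply: fg.
  by move=> y /As /= ys; rewrite inE ys orbT.
by move=> y [->|/As /= ys] /=; rewrite inE ?eqxx // ys orbT.
Qed.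

Lemma Ex_eq p s f g :
  (forall A, A `<=` [set` s] -> f A = g A) -> Ex p s f = Ex p s g.
Proof.
elim: s f g => [|x s IH] f g fg /=; first exact: fg.
congr (_ * _ + _ * _); apply: IH => A As; apply: fg.
  by move=> y /As /= ys; rewrite inE ys orbT.
by move=> y [->|/As /= ys] /=; rewrite inE ?eqxx // ys orbT.
Qed.

Lemma ExD p s f g : Ex p s (fun A => f A + g A) = Ex p s f + Ex p s g.
Proof. by elim: s f g => [//|x s IH] f g /=; rewrite !IH; ring. Qed.

Lemma ExZ p s c f : Ex p s (fun A => c * f A) = c * Ex p s f.
Proof. by elim: s f => [//|x s IH] f /=; rewrite !IH; ring. Qed.

Lemma ExB p s f g : Ex p s (fun A => f A - g A) = Ex p s f - Ex p s g.
Proof. by elim: s f g => [//|x s IH] f g /=; rewrite !IH; ring. Qed.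

Lemma Ex_cst p s c : Ex p s (fun=> c) = c.
Proof. by elim: s => [//|x s IH] /=; rewrite !IH; ring. Qed.

Lemma Ex_sum p s (I : Type) (r : seq I) (F : I -> set site -> R) :
  Ex p s (fun A => \sum_(i <- r) F i A) = \sum_(i <- r) Ex p s (F i).
Proof.
elim: r => [|i r IH].
  by rewrite big_nil -[RHS](Ex_cst p s); apply: Ex_eq => A _; rewrite big_nil.
by rewrite big_cons -IH -ExD; apply: Ex_eq => A _; rewrite big_cons.
Qed.

Lemma Ex_ge0 p s f : 0 <= p <= 1 -> (forall A, 0 <= f A) -> 0 <= Ex p s f.
Proof. by move=> p01 f0; rewrite -(Ex_cst p s 0); apply: Ex_le. Qed.

Lemma Ex_le1 p s f : 0 <= p <= 1 -> (forall A, f A <= 1) -> Ex p s f <= 1.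
Proof. by move=> p01 f1; rewrite -(Ex_cst p s 1); apply: Ex_le. Qed.

Definition blind x f := forall A, f (x |` A) = f A.

Lemma blind_setU1 x y f : blind x f -> blind x (fun A => f (y |` A)).
Proof. by move=> bf A; rewrite setUCA bf. Qed.

Lemma blindM x f g : blind x f -> blind x g -> blind x (fun A => f A * g A).
Proof. by move=> bf bg A; rewrite bf bg. Qed.

Lemma blind_prod x (I : eqType) (r : seq I) (F : I -> set site -> R) :
  (forall i, i \in r -> blind x (F i)) ->
  blind x (fun A => \prod_(i <- r) F i A).
Proof.
by move=> bF A; rewrite big_seq [RHS]big_seq; apply: eq_bigr => i /bF ->.
Qed.

(** Blindness stands for independence: when one site is revealed, at most one factor notices it, so
    the two branches recombine into a product. *)
Lemma Ex_mul p s f g : (forall x, x \in s -> blind x f \/ blind x g) ->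
  Ex p s (fun A => f A * g A) = Ex p s f * Ex p s g.
Proof.
elim: s f g => [//|x s IH] f g H /=.
have Hs y : y \in s -> blind y f \/ blind y g.
  by move=> ys; apply: H; rewrite inE ys orbT.
rewrite !IH //; last first.
  by move=> y /Hs[] h; [left|right]; exact: blind_setU1.
have [|bf|bg] := H x _; first by rewrite inE eqxx.
- have -> : Ex p s (fun A => f (x |` A)) = Ex p s f by apply: Ex_eq => A _; exact: bf.
  by ring.
- have -> : Ex p s (fun A => g (x |` A)) = Ex p s g by apply: Ex_eq => A _; exact: bg.
  by ring.
Qed.

Lemma Ex_prod p s (I : eqType) (r : seq I) (F : I -> set site -> R) :
  uniq r ->
  (forall x i j, x \in s -> i \in r -> j \in r -> i != j ->
     blind x (F i) \/ blind x (F j)) ->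
  Ex p s (fun A => \prod_(i <- r) F i A) = \prod_(i <- r) Ex p s (F i).
Proof.
elim: r => [_ _|i r IH /= /andP[ir ur] H].
  by rewrite big_nil -[RHS](Ex_cst p s); apply: Ex_eq => A _; rewrite big_nil.
rewrite big_cons -IH //; last first.
  by move=> x j k xs jr kr; apply: H => //; rewrite inE (jr, kr) orbT.
rewrite -Ex_mul; first by apply: Ex_eq => A _; rewrite big_cons.
move=> x xs; have [?|nb] := pselect (blind x (F i)); first by left.
right; apply: blind_prod => j jr.
have ij : i != j by apply: contraNneq ir => ->.
by case: (H x i j xs _ _ ij) => //; rewrite inE ?eqxx ?jr ?orbT.
Qed.

Definition hit l A := exists2 x, x \in l & A x.

Lemma hit_setU1 x l A : x \notin l -> hit l (x |` A) = hit l A.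
Proof.
move=> xl; apply/propext; split=> -[y yl]; last by exists y => //; right.
by case=> [yx|]; [move: xl; rewrite -yx yl|exists y].
Qed.

Lemma blind_ind_hit x l : x \notin l -> blind x (fun A => ind (hit l A)).
Proof. by move=> xl A; rewrite hit_setU1. Qed.

Lemma blind_site x y (c d : R) : x != y ->
  blind x (fun A => if `[< A y >] then d else c).
Proof.
move=> xy A; suff -> : (x |` A) y = A y by [].
by apply/propext; split=> [[yx|//]|]; [rewrite yx eqxx in xy|right].
Qed.

Lemma Ex_site p s y (c d : R) : uniq s -> y \in s ->
  Ex p s (fun A => if `[< A y >] then d else c) = (1 - p) * c + p * d.
Proof.
elim: s => [//|x s IH] /= /andP[xs us]; rewrite inE.
have [-> _|yx /= ys] := eqVneq y x.
  rewrite -[c in RHS](Ex_cst p s) -[d in RHS](Ex_cst p s).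
  congr (_ * _ + _ * _); apply: Ex_eq => A As; last by rewrite asboolT //; left.
  by rewrite asboolF // => /As /=; exact/negP.
rewrite IH // (@Ex_eq p s _ (fun A => if `[< A y >] then d else c)); last first.
  by move=> A _; apply: blind_site; rewrite eq_sym.
by rewrite IH //; ring.
Qed.

Lemma Ex_miss p s l : uniq s -> uniq l -> {subset l <= s} ->
  Ex p s (fun A => ind (~ hit l A)) = (1 - p) ^+ size l.
Proof.
move=> us ul ls.
rewrite (@Ex_eq p s _ (fun A => \prod_(y <- l) if `[< A y >] then 0 else 1)); last first.
  move=> A _; transitivity (\prod_(y <- l) ind (~ A y)).
    rewrite -ind_forall; congr ind; apply/propext; split.
      by move=> nh y yl Ay; apply: nh; exists y.
    by move=> h [y yl]; exact: h.
  by apply: eq_bigr => y _; rewrite /ind asbool_neg; case: asboolP.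
rewrite Ex_prod //; last first.
  move=> x i j _ _ _ ij; have [xi|xi] := eqVneq x i; [right|left]; last exact: blind_site.
  by apply: blind_site; rewrite xi.
rewrite big_seq (eq_bigr (fun=> 1 - p)).
  by rewrite -big_seq big_const_seq count_predT iter_mulr mulr1.
by move=> y yl; rewrite Ex_site ?ls // mulr0 addr0 mulr1.
Qed.

Lemma Ex_hit p s l : uniq s -> uniq l -> {subset l <= s} ->
  Ex p s (fun A => ind (hit l A)) = 1 - (1 - p) ^+ size l.
Proof.
move=> us ul ls; rewrite -(Ex_miss p us ul ls).
rewrite (@Ex_eq p s (fun A => ind (~ _)) (fun A => 1 - ind (hit l A))).
  by rewrite ExB Ex_cst; ring.
by move=> A _; rewrite ind_not.
Qed.

Lemma Ex_hits p s (I : eqType) (r : seq I) (l : I -> seq site) :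
  uniq s -> uniq r -> (forall i, i \in r -> uniq (l i) /\ {subset l i <= s}) ->
  (forall i j x, i \in r -> j \in r -> i != j -> x \in l i -> x \notin l j) ->
  Ex p s (fun A => ind (forall i, i \in r -> hit (l i) A)) =
  \prod_(i <- r) (1 - (1 - p) ^+ size (l i)).
Proof.
move=> us ur lP dis.
under [LHS]Ex_eq => A _ do rewrite ind_forall.
rewrite Ex_prod //; last first.
  move=> x i j _ ir jr ij; have [xi|xi] := boolP (x \in l i); [right|left].
    by apply: blind_ind_hit; apply: dis xi.
  exact: blind_ind_hit.
by rewrite big_seq [RHS]big_seq; apply: eq_bigr => i /lP[? ?]; exact: Ex_hit.
Qed.

Definition increasing (F : set site -> Prop) := forall A B, A `<=` B -> F A -> F B.

Definition disj_occ (F G : set site -> Prop) A :=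
  exists K1 K2, [/\ K1 `<=` A, K2 `<=` A, K1 `&` K2 = set0, F K1 & G K2].

Lemma disj_occS (F F' G G' : set site -> Prop) A B : A `<=` B ->
  (forall K, F K -> F' K) -> (forall K, G K -> G' K) ->
  disj_occ F G A -> disj_occ F' G' B.
Proof.
move=> AB FF' GG' [K1 [K2 [K1A K2A d FK GK]]].
by exists K1, K2; split=> //; [exact: subset_trans AB|exact: subset_trans AB|exact: FF'|exact: GG'].
Qed.

(* The van den Berg-Kesten inequality. The induction on the coordinates only
   closes for [p <= 1/2], where the coefficient [1 - 2 p] is nonnegative. *)
Lemma Ex_disj_occ p s (F G : set site -> Prop) : 0 <= p <= 1/2 -> uniq s ->
  increasing F -> increasing G ->
  Ex p s (fun A => ind (disj_occ F G A)) <=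
  Ex p s (fun A => ind (F A)) * Ex p s (fun A => ind (G A)).
Proof.
move=> p12; have p01 : 0 <= p <= 1 by lra.
elim: s F G => [|x s IH] F G /=; [move=> _ iF iG|move=> /andP[xs us] iF iG].
  rewrite -ind_and; apply: ind_le => -[K1 [K2 [K1A K2A _ FK GK]]].
  by split; [exact: iF FK|exact: iG GK].
pose F1 A := F (x |` A); pose G1 A := G (x |` A).
have iF1 : increasing F1 by move=> A B AB; apply: iF; exact: setUS.
have iG1 : increasing G1 by move=> A B AB; apply: iG; exact: setUS.
have FF1 K : F K -> F1 K by apply: iF; exact: subsetUr.
have GG1 K : G K -> G1 K by apply: iG; exact: subsetUr.
(* Two disjoint witnesses cannot both use [x], so removing it leaves [disj_occ F1 G] or
   [disj_occ F G1]. If [disj_occ F G] holds already, both do, and the subtracted indicator is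
   compensated. *)
have le1 : Ex p s (fun A => ind (disj_occ F G (x |` A))) <=
    Ex p s (fun A => ind (disj_occ F1 G A)) + Ex p s (fun A => ind (disj_occ F G1 A))
    - Ex p s (fun A => ind (disj_occ F G A)).
  rewrite -ExD -ExB; apply: Ex_le => // A As.
  have h1 : disj_occ F G A -> disj_occ F1 G A by apply: disj_occS.
  have h2 : disj_occ F G A -> disj_occ F G1 A by apply: disj_occS.
  have h3 : disj_occ F G (x |` A) -> disj_occ F1 G A \/ disj_occ F G1 A.
    move=> [K1 [K2 [K1A K2A d FK GK]]].
    have sub K : K `<=` x |` A -> K `\ x `<=` A by move=> h z [Kz zx]; case: (h z Kz).
    have nsub K : K `<=` x |` A -> ~ K x -> K `<=` A.
      by move=> h nx z Kz; have [zx|//] := h z Kz; rewrite zx in Kz.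
    have [K1x|K1x] := pselect (K1 x); [left|right].
      exists (K1 `\ x), K2; split=> //; [exact: sub| | |].
      - apply: nsub => // K2x.
        by have : (K1 `&` K2) x by []; rewrite d.
      - by apply/seteqP; split=> // z [[K1z _] K2z]; rewrite -d.
      - apply: iF FK => z Kz; have [->|zx] := pselect (z = x); [by left|by right].
    exists K1, (K2 `\ x); split=> //; [exact: nsub|exact: sub| |].
      by apply/seteqP; split=> // z [K1z [K2z _]]; rewrite -d.
    by apply: iG GK => z Kz; have [->|zx] := pselect (z = x); [left|right].
  have [w|w] := pselect (disj_occ F G A).
    by rewrite (ind_true w) (ind_true (h1 w)) (ind_true (h2 w)); have := ind_le1 (disj_occ F G (x |` A)); lra.
  rewrite (ind_false w) subr0.
  have [v|v] := pselect (disj_occ F G (x |` A)); last first.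
    by rewrite (ind_false v) addr_ge0 // ind_ge0.
  rewrite (ind_true v); have [u|u] := h3 v; rewrite (ind_true u) ?lerDl ?lerDr ?ind_ge0 //.
have b00 := IH F G us iF iG; have b10 := IH F1 G us iF1 iG.
have b01 := IH F G1 us iF iG1.
have a01 : Ex p s (fun A => ind (F A)) <= Ex p s (fun A => ind (F1 A)).
  by apply: Ex_le => // A _; apply: ind_le; exact: FF1.
have c01 : Ex p s (fun A => ind (G A)) <= Ex p s (fun A => ind (G1 A)).
  by apply: Ex_le => // A _; apply: ind_le; exact: GG1.
rewrite -/(F1 _) -/(G1 _) in le1 b00 b10 b01 a01 c01 *.
set a0 := Ex p s (fun A => ind (F A)) in a01 b00 b10 b01 *.
set a1 := Ex p s (fun A => ind (F1 A)) in a01 b00 b10 b01 *.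
set c0 := Ex p s (fun A => ind (G A)) in c01 b00 b10 b01 *.
set c1 := Ex p s (fun A => ind (G1 A)) in c01 b00 b10 b01 *.
set w := Ex p s (fun A => ind (disj_occ F G A)) in le1 b00 *.
set u := Ex p s (fun A => ind (disj_occ F1 G A)) in le1 b10 *.
set v := Ex p s (fun A => ind (disj_occ F G1 A)) in le1 b01 *.
set z := Ex p s (fun A => ind (disj_occ F G (x |` A))) in le1 *.
have p0 : 0 <= p by lra.
have pp : 0 <= 1 - p - p by lra.
apply: (@le_trans _ _ ((1 - p - p) * (a0 * c0) + p * (a1 * c0 + a0 * c1))).
  rewrite -subr_ge0.
  have -> : (1 - p - p) * (a0 * c0) + p * (a1 * c0 + a0 * c1) - ((1 - p) * w + p * z) =
    (1 - p - p) * (a0 * c0 - w) + p * (u + v - w - z) + p * (a1 * c0 - u) + p * (a0 * c1 - v)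
    by ring.
  by rewrite !addr_ge0 // mulr_ge0 // subr_ge0.
rewrite -subr_ge0.
have -> : ((1 - p) * a0 + p * a1) * ((1 - p) * c0 + p * c1) -
  ((1 - p - p) * (a0 * c0) + p * (a1 * c0 + a0 * c1)) =
  p ^+ 2 * ((a1 - a0) * (c1 - c0)) by ring.
by rewrite mulr_ge0 ?sqr_ge0 // mulr_ge0 // subr_ge0.
Qed.

End finite_product.

(** * The infinite product measure *)

Lemma set_consE (T : eqType) (x : T) (s : seq T) : [set` x :: s] = x |` [set` s].
Proof.
apply/seteqP; split=> y /=; rewrite inE; first by case/orP=> [/eqP|]; [left|right].
by case=> [->|->]; rewrite ?eqxx ?orbT.
Qed.

Definition determined (s : seq site) (F : set (set site)) :=
  forall X, F X <-> F (X `&` [set` s]).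

Lemma determined_split x s (F : set (set site)) : x \notin s ->
  determined (x :: s) F ->
  let F1 := [set X | F (x |` (X `&` [set` s]))] in
  let F0 := [set X | F (X `&` [set` s])] in
  [/\ determined s F1, determined s F0 &
      F = (occupied x `&` F1) `|` (F0 `\` occupied x)].
Proof.
move=> xs dF F1 F0; split.
- by move=> X; rewrite /F1 /= -setIA setIid.
- by move=> X; rewrite /F0 /= -setIA setIid.
have e X : X x -> X `&` [set` x :: s] = x |` (X `&` [set` s]).
  move=> Xx; rewrite set_consE setIUr; congr (_ `|` _).
  by apply/seteqP; split=> [z [_]//|z ->].
have e' X : ~ X x -> X `&` [set` x :: s] = X `&` [set` s].
  move=> nXx; rewrite set_consE setIUr (_ : X `&` [set x] = set0) ?set0U //.
  by apply/seteqP; split=> [z [Xz zx]|z //]; rewrite zx in Xz.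
apply/seteqP; split=> X.
  move=> /dF FX; have [Xx|nXx] := pselect (X x); [left|right]; split=> //.
    by rewrite /F1 /= -e.
  by rewrite /F0 /= -e'.
case=> -[h1 h2]; apply/dF; first by rewrite e.
by rewrite e'.
Qed.

Lemma determined_measurable s (F : set config) : uniq s -> determined s F ->
  measurable F.
Proof.
elim: s F => [|x s IH] F /=.
  move=> _ dF; have [F0|F0] := pselect (F set0).
    rewrite (_ : F = setT); first exact: measurableT.
    apply/seteqP; split=> // X _; apply/dF.
    by rewrite set_nil setI0.
  suff -> : F = set0 by exact: measurable0.
  apply/seteqP; split=> // X /dF; rewrite set_nil setI0; exact: F0.
move=> /andP[xs us] dF; have [d1 d0 ->] := determined_split xs dF.
have mx : measurable (occupied x : set config).
  by apply: sub_sigma_algebra; exists x.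
apply: measurableU; first by apply: measurableI => //; exact: IH.
by apply: measurableD => //; exact: IH.
Qed.

Section link.
Variables (R : realType) (p : R) (P : probability config R).
Hypothesis hP : is_product_measure p P.

(** Independence is given for occupied sites only. Carrying a list [u] of sites already forced to be
    occupied lets the case of a vacant [x] be obtained by subtraction, with both terms supplied by
    the induction hypothesis. *)
Lemma prob_determined_occupied u s (F : set config) : uniq (u ++ s) ->
  determined s F ->
  P (\bigcap_(i in [set` u]) occupied i `&` F) =
  (p ^+ size u * Ex p s (fun A => ind R (F A)))%:E.
Proof.
have mocc x : measurable (occupied x : set config).
  by apply: sub_sigma_algebra; exists x.
have mcap (v : seq site) : measurable (\bigcap_(i in [set` v]) occupied i : set config).
  by apply: fin_bigcap_measurable => [|x _]; [exact: finite_seq|exact: mocc].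
have pcap (v : seq site) : uniq v -> P (\bigcap_(i in [set` v]) occupied i) = (p ^+ size v)%:E.
  move=> uv; rewrite (hP.2 _ uv); under eq_bigr do rewrite hP.1.
  rewrite prodEFin; congr (_%:E).
  by rewrite big_const_seq count_predT iter_mulr mulr1.
elim: s u F => [|x s IH] u F.
  rewrite cats0 => uu dF /=; have [F0|F0] := pselect (F set0).
    have -> : F = setT.
      by apply/seteqP; split=> // X _; apply/dF; rewrite set_nil setI0.
    by rewrite setIT pcap // ind_true // mulr1.
  have -> : F = set0.
    by apply/seteqP; split=> // X /dF; rewrite set_nil setI0; exact: F0.
  by rewrite setI0 measure0 ind_false ?mulr0.
move=> uxs dF.
have [xu xs uu us] : [/\ x \notin u, x \notin s, uniq (u ++ s) & uniq (x :: u ++ s)].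
  move: uxs; rewrite -(perm_uniq (permEl (perm_catCA [:: x] u s))) /=.
  by case/andP; rewrite mem_cat negb_or => /andP[-> ->] ->.
have [d1 d0 FE] := determined_split xs dF; move: d1 d0 FE.
set F1 := [set X | F (x |` _)]; set F0 := [set X | F (X `&` _)] => d1 d0 FE.
have us' : uniq s by move: uu; rewrite cat_uniq => /and3P[].
have m1 : measurable (F1 : set config) by exact: determined_measurable d1.
have m0 : measurable (F0 : set config) by exact: determined_measurable d0.
set U := \bigcap_(i in [set` u]) occupied i.
have Ux : \bigcap_(i in [set` x :: u]) occupied i = occupied x `&` U.
  by rewrite set_consE bigcap_setU1.
have -> : U `&` F = ((occupied x `&` U) `&` F1) `|` ((U `&` F0) `\` occupied x).
  by rewrite {1}FE setIUr !setIDA setIA (setIC U (occupied x)).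
have mU : measurable (U : set config) by exact: mcap.
set V1 : set config := occupied x `&` U `&` F1; set V0 : set config := _ `\` _.
have -> : P (V1 `|` V0) = (P V1 + P V0)%E.
  apply: measureU; [by apply: measurableI => //; apply: measurableI| |].
    by apply: measurableD => //; apply: measurableI.
  by apply/seteqP; split=> // X [[[oX _] _] [_ noX]].
have IH1 := IH (x :: u) F1 us d1; rewrite Ux /= in IH1.
have IH0 := IH (x :: u) F0 us d0; rewrite Ux /= in IH0.
have IH00 := IH u F0 uu d0.
have D : P (U `&` F0) = (P V0 + P (occupied x `&` U `&` F0))%E.
  rewrite (_ : occupied x `&` U `&` F0 = U `&` F0 `&` occupied x); last first.
    by rewrite -setIA setIC.
  by apply: measureDI => //; apply: measurableI.
rewrite -/U in IH00; rewrite IH00 IH0 in D; rewrite IH1.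
have fD : P V0 \is a fin_num.
  by apply: fin_num_measure; apply: measurableD => //; apply: measurableI.
rewrite -(fineK fD) in D *; move: D; rewrite -EFinD => -[D].
rewrite -EFinD; congr (_%:E).
rewrite (_ : fine _ = p ^+ size u * (Ex p s (fun A => ind R (F0 A)) - p * Ex p s (fun A => ind R (F0 A)))); last first.
  by move: D; rewrite exprS => D; rewrite mulrBr; lra.
rewrite (@Ex_eq _ p s _ (fun A => ind R (F (x |` A)))); last first.
  by move=> A As; rewrite /F1 /= setIidl.
rewrite (@Ex_eq _ p s (fun A => ind R (F0 A)) (fun A => ind R (F A))); last first.
  by move=> A As; rewrite /F0 /= setIidl.
by rewrite exprS /=; ring.
Qed.

Lemma prob_determined s (F : set config) : uniq s -> determined s F ->
  fine (P F) = Ex p s (fun A => ind R (F A)).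
Proof.
move=> us dF; have := @prob_determined_occupied [::] s F us dF.
by rewrite set_nil bigcap_set0 setTI expr0 mul1r => ->.
Qed.

End link.

(** * Merging of rectangles *)

Lemma mod_stepS (K K' : set site) : K `<=` K' -> mod_step K `<=` mod_step K'.
Proof.
move=> KK' x [/KK'|[[y [xy Ky]] [z [xz Kz]]]]; first by left.
by right; split; [exists y; split=> //; exact: KK'|exists z; split=> //; exact: KK'].
Qed.

Lemma iter_mod_stepS t (K K' : set site) : K `<=` K' ->
  iter t mod_step K `<=` iter t mod_step K'.
Proof. by move=> KK'; elim: t => //= t IH; exact: mod_stepS. Qed.

Lemma iter_mod_step_le t t' (K : set site) : (t <= t')%N ->
  iter t mod_step K `<=` iter t' mod_step K.
Proof.
move=> /subnK <-; elim: (t' - t)%N => // n IH x /IH; rewrite addSn /=; by left.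
Qed.

Lemma mod_closure_sub (K S : set site) : K `<=` S -> mod_step S `<=` S ->
  mod_closure K `<=` S.
Proof.
move=> KS Scl x [t _]; elim: t x => [|t IH] x; first exact: KS.
by move=> /= h; apply: Scl; apply: mod_stepS h.
Qed.

Lemma mod_stepP (K : set site) (x : site) : mod_step K x <->
  K x \/ ((K (x.1 + 1, x.2) \/ K (x.1 - 1, x.2)) /\
          (K (x.1, x.2 + 1) \/ K (x.1, x.2 - 1))).
Proof.
case: x => a b /=.
have E1 : ((a, b) : site) + e1 = (a + 1, b) by rewrite -[LHS]/(a + 1, b + 0) addr0.
have E2 : ((a, b) : site) - e1 = (a - 1, b) by rewrite -[LHS]/(a - 1, b - 0) subr0.
have E3 : ((a, b) : site) + e2 = (a, b + 1) by rewrite -[LHS]/(a + 0, b + 1) addr0.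
have E4 : ((a, b) : site) - e2 = (a, b - 1) by rewrite -[LHS]/(a - 0, b - 1) subr0.
rewrite /mod_step /setU /mkset E1 E2 E3 E4; split=> [[Kx|[[y [xy Ky]] [z [xz Kz]]]]|[Kx|[h v]]].
- by left.
- right; split.
    by case: xy Ky => -> ?; [left|right].
  by case: xz Kz => -> ?; [left|right].
- by left.
- right; split.
    by case: h => h; [exists (a + 1, b)|exists (a - 1, b)]; split=> //; [left|right].
  by case: v => v; [exists (a, b + 1)|exists (a, b - 1)]; split=> //; [left|right].
Qed.

Definition rect : Type := ((int * int) * (int * int))%type.

Definition between (i : int * int) (z : int) : bool := (i.1 <= z) && (z <= i.2).
Definition touch1 (i j : int * int) : bool := (i.1 <= j.2 + 1) && (j.1 <= i.2 + 1).
Definition hull1 (i j : int * int) : int * int :=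
  (Num.min i.1 j.1, Num.max i.2 j.2).
Definition len (i : int * int) : nat := absz (i.2 - i.1 + 1).
Definition sub1 (i j : int * int) : bool := (j.1 <= i.1) && (i.2 <= j.2).

Definition rset (r : rect) : set site := [set x | between r.1 x.1 && between r.2 x.2].
Definition touch (r r' : rect) := touch1 r.1 r'.1 && touch1 r.2 r'.2.
Definition hull (r r' : rect) : rect := (hull1 r.1 r'.1, hull1 r.2 r'.2).
Definition subr (r r' : rect) := sub1 r.1 r'.1 && sub1 r.2 r'.2.
Definition valid (r : rect) := (r.1.1 <= r.1.2) && (r.2.1 <= r.2.2).
Definition semiper (r : rect) : nat := (len r.1 + len r.2)%N.
Definition longside (r : rect) : nat := maxn (len r.1) (len r.2).

(** The list holds the sites at the leaves of the merging tree. Keeping the two lists of a merger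
    disjoint is what later provides the disjoint witnesses of [disj_occ]. *)
Inductive spans : seq site -> rect -> Prop :=
| Spans1 x : spans [:: x] ((x.1, x.1), (x.2, x.2))
| SpansM K1 K2 r1 r2 : spans K1 r1 -> spans K2 r2 -> touch r1 r2 ->
    ~~ has (mem K1) K2 -> spans (K1 ++ K2) (hull r1 r2).

Ltac rect_lia := rewrite /rset /touch /hull /subr /valid /semiper /longside
  /between /touch1 /hull1 /len /sub1 /=; lia.

Section merging.
Implicit Types (r : rect) (K s : seq site).

Lemma spans_valid K r : spans K r -> valid r.
Proof.
elim=> [x|K1 K2 r1 r2 _ v1 _ v2 t _]; first by rewrite /valid /= !lexx.
by move: v1 v2 t; rect_lia.
Qed.

(** Touching intervals leave no gap in their hull, so no column of a spanned rectangle is free of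
    leaves. This is the origin of the factors [1 - (1 - p) ^+ k]. *)
Lemma spans_cols K r : spans K r -> forall z, between r.1 z ->
  exists2 x, x \in K & x.1 = z.
Proof.
elim=> [x z /= xz|K1 K2 r1 r2 _ h1 _ h2 t _ z zr].
  by exists x; rewrite ?inE //; move: xz; rewrite /between /=; lia.
have [/h1|/h2] : between r1.1 z \/ between r2.1 z by move: zr t; rect_lia.
  by case=> x xK xz; exists x => //; rewrite mem_cat xK.
by case=> x xK xz; exists x => //; rewrite mem_cat xK orbT.
Qed.

Lemma spans_rows K r : spans K r -> forall z, between r.2 z ->
  exists2 x, x \in K & x.2 = z.
Proof.
elim=> [x z /= xz|K1 K2 r1 r2 _ h1 _ h2 t _ z zr].
  by exists x; rewrite ?inE //; move: xz; rewrite /between /=; lia.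
have [/h1|/h2] : between r1.2 z \/ between r2.2 z by move: zr t; rect_lia.
  by case=> x xK xz; exists x => //; rewrite mem_cat xK.
by case=> x xK xz; exists x => //; rewrite mem_cat xK orbT.
Qed.

Lemma spans_sub K r : spans K r -> forall x, x \in K -> rset r x.
Proof.
elim=> [x y /=|K1 K2 r1 r2 _ h1 _ h2 t _ z]; first by rewrite inE => /eqP ->; rect_lia.
by rewrite mem_cat => /orP[/h1|/h2]; rect_lia.
Qed.

Lemma spans_subr K r S : spans K r -> (forall x, x \in K -> rset S x) -> subr r S.
Proof.
elim=> [x h|K1 K2 r1 r2 _ h1 _ h2 t _ h].
  by have := h x (mem_head _ _); rect_lia.
have {}h1 : subr r1 S by apply: h1 => x xK; apply: h; rewrite mem_cat xK.
have {}h2 : subr r2 S by apply: h2 => x xK; apply: h; rewrite mem_cat xK orbT.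
by move: h1 h2; rect_lia.
Qed.

Lemma pairwise_rem (T : eqType) (e : rel T) (u : T) (s : seq T) : symmetric e ->
  u \in s -> pairwise e s -> all (e u) (rem u s) /\ pairwise e (rem u s).
Proof.
move=> se; elim: s => //= v s IH; rewrite inE; have [<- _|uv /= us] := eqVneq v u.
  by case/andP.
case/andP=> /allP av /(IH us)[a1 a2]; rewrite a1 a2 se av //; split=> //.
by rewrite andbT; apply/allP => w /mem_rem; exact: av.
Qed.

Definition apart (u v : seq site * rect) := ~~ touch u.2 v.2 && ~~ has (mem u.1) v.1.

Lemma apart_sym : symmetric apart.
Proof.
move=> u v; rewrite /apart has_sym; congr (_ && _).
by rect_lia.
Qed.

Definition apart_family (rs : seq (seq site * rect)) :=
  (forall u, u \in rs -> spans u.1 u.2) /\ pairwise apart rs.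

(** The new rectangle swallows a member that it touches, and the hull is inserted into the shorter
    family, until nothing touches it any more. *)
Lemma apart_family_insert (rs : seq (seq site * rect)) K r : apart_family rs ->
  spans K r -> (forall u, u \in rs -> ~~ has (mem K) u.1) ->
  exists rs', [/\ apart_family rs',
    forall u x, u \in rs' -> x \in u.1 ->
      x \in K \/ exists2 v, v \in rs & x \in v.1 &
    forall x, (rset r x \/ exists2 v, v \in rs & rset v.2 x) ->
      exists2 u, u \in rs' & rset u.2 x].
Proof.
have [n] := ubnP (size rs); elim: n rs K r => // n IH rs K r srs [sp pw] sK dK.
have [/hasP[u urs tu]|nt] := boolP (has (fun u => touch r u.2) rs); last first.
  exists ((K, r) :: rs); split.
  - split; first by move=> u; rewrite inE => /orP[/eqP ->//|]; exact: sp.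
    rewrite /= pw andbT; apply/allP => u urs; rewrite /apart /= dK // andbT.
    by apply: contraNN nt => t; apply/hasP; exists u.
  - move=> u x; rewrite inE => /orP[/eqP ->|urs] xu; first by left.
    by right; exists u.
  - move=> x [rx|[v vrs vx]]; first by exists (K, r); rewrite ?mem_head.
    by exists v; rewrite // inE vrs orbT.
have srem : subseq (rem u rs) rs by exact: rem_subseq.
have pwu := pairwise_rem apart_sym urs pw.
have [||||rs' [f' sub' cov']] := IH (rem u rs) (K ++ u.1) (hull r u.2).
- by rewrite size_rem // prednK //; case: (rs) urs srs.
- split; last exact: pwu.2.
  by move=> v vrs; apply: sp; exact: (mem_subseq srem).
- apply: SpansM => //; [exact: sp|exact: dK].
- move=> v vrs; rewrite has_sym has_cat negb_or !(has_sym v.1) dK ?(mem_subseq srem) //=.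
  by have := allP pwu.1 _ vrs; rewrite /apart => /andP[_].
exists rs'; split=> //.
- move=> v x vrs xv; have [|[w wrs xw]] := sub' v x vrs xv.
    by rewrite mem_cat => /orP[xK|xu]; [left|right; exists u].
  by right; exists w => //; exact: (mem_subseq srem).
- move=> x h; apply: cov'; case: h => [rx|[v vrs vx]].
    by left; move: rx; rect_lia.
  have [vu|vu] := eqVneq v u; first by left; move: vx; rewrite vu; rect_lia.
  right; exists v => //.
  have : v \in u :: rem u rs by rewrite -(perm_mem (perm_to_rem urs)).
  by rewrite inE (negbTE vu).
Qed.

Lemma span_cover s : uniq s -> exists rs,
  [/\ apart_family rs, forall u x, u \in rs -> x \in u.1 -> x \in s &
      forall x, x \in s -> exists2 u, u \in rs & rset u.2 x].
Proof.
elim: s => [_|x s IH /= /andP[xs /IH[rs [f sub cov]]]]; first by exists [::].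
have [|rs' [f' sub' cov']] := apart_family_insert f (Spans1 x).
  by move=> u urs; rewrite has_sym /= orbF; apply: contra xs => xu; exact: (sub u).
exists rs'; split=> // [u y urs yu|y].
  have [|[v vrs yv]] := sub' u y urs yu; first by rewrite !inE => ->.
  by rewrite inE (sub v) ?orbT.
rewrite inE => /orP[/eqP ->|/cov h]; apply: cov'; last by right.
by left; rect_lia.
Qed.

Lemma apart_family_touch (rs : seq (seq site * rect)) u v : apart_family rs ->
  u \in rs -> v \in rs -> touch u.2 v.2 -> u = v.
Proof.
move=> [_]; elim: rs => //= w rs IH /andP[/allP aw pw].
rewrite !inE => /orP[/eqP ->|urs] /orP[/eqP ->|vrs] // t; last exact: IH.
  by have := aw _ vrs; rewrite /apart t.
by have := aw _ urs; rewrite apart_sym /apart t.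
Qed.

(** A horizontal and a vertical neighbour of [x] are at sup-norm distance 1, so the members
    containing them touch and hence coincide; that rectangle meets both the row and the column of
    [x]. *)
Lemma apart_family_closed (rs : seq (seq site * rect)) : apart_family rs ->
  let U := [set x | exists2 u, u \in rs & rset u.2 x] in mod_step U `<=` U.
Proof.
move=> f U x /mod_stepP[//|[h v]].
have [u urs hu] : exists2 u, u \in rs & rset u.2 (x.1 + 1, x.2) \/ rset u.2 (x.1 - 1, x.2).
  by case: h => -[u urs h]; exists u => //; [left|right].
have [w wrs hw] : exists2 w, w \in rs & rset w.2 (x.1, x.2 + 1) \/ rset w.2 (x.1, x.2 - 1).
  by case: v => -[u' urs' h']; exists u' => //; [left|right].
exists u => //; have uw : u = w.
  apply: (apart_family_touch f) => //.
  by move: hu hw; rect_lia.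
by move: hu hw; rewrite -uw; rect_lia.
Qed.

Lemma mod_closure_cover s : uniq s -> exists rs,
  [/\ apart_family rs, forall u x, u \in rs -> x \in u.1 -> x \in s &
      forall x, mod_closure [set` s] x -> exists2 u, u \in rs & rset u.2 x].
Proof.
move=> us; have [rs [f sub cov]] := span_cover us; exists rs; split=> // x.
exact: (@mod_closure_sub [set` s] _ cov (apart_family_closed f)).
Qed.

(** Adjacent sites of [S] lie in members that touch, hence in the same member; a walk along the
    bottom row and then up a column reaches every site of [S]. *)
Lemma apart_family_rset (rs : seq (seq site * rect)) S : apart_family rs ->
  valid S ->
  (forall x, rset S x -> exists2 u, u \in rs & rset u.2 x) ->
  exists2 u, u \in rs & forall x, rset S x -> rset u.2 x.
Proof.
move=> f vS cov.
have [|u urs u0] := cov (S.1.1, S.2.1); first by move: vS; rect_lia.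
exists u => //.
have step x y : rset S x -> rset S y -> rset u.2 x ->
    (`|x.1 - y.1| <= 1) && (`|x.2 - y.2| <= 1) -> rset u.2 y.
  move=> Sx Sy ux d; have [v vrs vy] := cov y Sy.
  suff -> : u = v by [].
  by apply: (apart_family_touch f) => //; move: ux vy d; rect_lia.
have row (n : nat) : rset S (S.1.1 + n%:Z, S.2.1) -> rset u.2 (S.1.1 + n%:Z, S.2.1).
  elim: n => [_|n IH Sn]; first by rewrite addr0.
  have Sn' : rset S (S.1.1 + n%:Z, S.2.1) by move: Sn; rect_lia.
  by apply: (step _ _ Sn' Sn (IH Sn')) => /=; lia.
have col (n m : nat) : rset S (S.1.1 + n%:Z, S.2.1 + m%:Z) ->
    rset u.2 (S.1.1 + n%:Z, S.2.1 + m%:Z).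
  elim: m => [|m IH Sn]; first by rewrite addr0; exact: row.
  have Sn' : rset S (S.1.1 + n%:Z, S.2.1 + m%:Z) by move: Sn; rect_lia.
  by apply: (step _ _ Sn' Sn (IH Sn')) => /=; lia.
move=> [a b] Sab; have := col (absz (a - S.1.1)) (absz (b - S.2.1)).
rewrite !gez0_abs; [|by move: Sab; rect_lia|by move: Sab; rect_lia].
by rewrite !(addrC S.1.1) !(addrC S.2.1) !subrK; exact.
Qed.

Lemma spans_mod_closure (X : set site) s S : uniq s -> X `<=` [set` s] ->
  valid S -> X `<=` rset S -> rset S `<=` mod_closure X ->
  exists2 K, spans K S & [set` K] `<=` X.
Proof.
move=> us Xs vS XS SX.
pose s' := [seq x <- s | `[< X x >]].
have s'X : [set` s'] = X.
  apply/seteqP; split=> x /=; rewrite mem_filter; first by case/andP => /asboolP.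
  by move=> Xx; rewrite Xs // andbT; apply/asboolP.
have [rs [f sub cov]] := mod_closure_cover (filter_uniq (fun x => `[< X x >]) us).
have [|u urs uS] := apart_family_rset f vS.
  by move=> x /SX; rewrite -s'X; exact: cov.
have uX : [set` u.1] `<=` X by rewrite -s'X => x /= xu; exact: sub xu.
exists u.1 => //; have su := f.1 u urs.
have us' : subr u.2 S by apply: spans_subr su _ => x /uX; exact: XS.
suff <- : u.2 = S by [].
have h1 := uS (S.1.1, S.2.1); have h2 := uS (S.1.2, S.2.2).
have {}h1 : rset u.2 (S.1.1, S.2.1) by apply: h1; move: vS; rect_lia.
have {}h2 : rset u.2 (S.1.2, S.2.2) by apply: h2; move: vS; rect_lia.
move: us' h1 h2 vS {XS SX uS su}; case: (u.2) S => [[a b] [c d]] [[a' b'] [c' d']].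
rewrite /subr /sub1 /rset /between /valid /= => us' h1 h2 vS.
by congr (_, _, (_, _)); lia.
Qed.

Lemma spans_mod_closure_point (X : set site) s x : uniq s -> X `<=` [set` s] ->
  mod_closure X x -> exists K r, [/\ spans K r, [set` K] `<=` X & rset r x].
Proof.
move=> us Xs Xx.
have s'X : [set` [seq x <- s | `[< X x >]]] = X.
  apply/seteqP; split=> y /=; rewrite mem_filter; first by case/andP => /asboolP.
  by move=> Xy; rewrite Xs // andbT; apply/asboolP.
have [rs [f sub cov]] := mod_closure_cover (filter_uniq (fun x => `[< X x >]) us).
have [|u urs ux] := cov x; first by rewrite s'X.
exists u.1, u.2; split=> //; first exact: f.1.
by rewrite -s'X => y /= yu; exact: sub yu.
Qed.

Lemma spans_split K r n : spans K r -> (2 <= n < semiper r)%N ->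
  exists K1 K2 r1 r2, [/\ spans K1 r1 /\ spans K2 r2, touch r1 r2,
    [/\ {subset K1 <= K}, {subset K2 <= K} & ~~ has (mem K1) K2],
    subr (hull r1 r2) r &
    [/\ (n < semiper (hull r1 r2))%N, (semiper r1 <= n)%N & (semiper r2 <= n)%N]].
Proof.
elim=> [x|K1 K2 r1 r2 s1 IH1 s2 IH2 t d nr]; first by rect_lia.
have [n1|n1] := ltnP n (semiper r1).
  have [|L1 [L2 [p1 [p2 [s12 t' [i1 i2 dL] sb [h1 h2 h3]]]]]] := IH1.
    by case/andP: nr => -> _; rewrite n1.
  exists L1, L2, p1, p2; split=> //; last by move: sb; rect_lia.
  by split=> // x; [move=> /i1 xL|move=> /i2 xL]; rewrite mem_cat xL.
have [n2|n2] := ltnP n (semiper r2).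
  have [|L1 [L2 [p1 [p2 [s12 t' [i1 i2 dL] sb [h1 h2 h3]]]]]] := IH2.
    by case/andP: nr => -> _; rewrite n2.
  exists L1, L2, p1, p2; split=> //; last by move: sb; rect_lia.
  by split=> // x; [move=> /i1 xL|move=> /i2 xL]; rewrite mem_cat xL orbT.
exists K1, K2, r1, r2; split=> //; last by split=> //; move: nr => /andP[].
- by split=> // x xK; rewrite mem_cat xK ?orbT.
- by move: (spans_valid s1) (spans_valid s2); rect_lia.
Qed.

(** The long side of a hull is at most the sum of the long sides of its children, so a value above
    [2 n] leaves one child above [n]: the descent cannot jump over the window. *)
Lemma spans_intermediate K r n : spans K r -> (0 < n < longside r)%N ->
  exists K' r', [/\ spans K' r', {subset K' <= K}, subr r' r,
    (n < longside r')%N & (longside r' <= n.*2)%N].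
Proof.
elim=> [x|K1 K2 r1 r2 s1 IH1 s2 IH2 t d nr]; first by rect_lia.
have v1 := spans_valid s1; have v2 := spans_valid s2.
have [l2|l2] := leqP (longside (hull r1 r2)) n.*2.
  exists (K1 ++ K2), (hull r1 r2); split=> //; [exact: SpansM|by rect_lia|].
  by move: nr => /andP[].
have [n1|n1] := ltnP n (longside r1).
  have [|K' [r' [s' i' sb h1 h2]]] := IH1; first by case/andP: nr => -> _; rewrite n1.
  exists K', r'; split=> //; last by move: sb; rect_lia.
  by move=> x xK; rewrite mem_cat i'.
have [|K' [r' [s' i' sb h1 h2]]] := IH2.
  by move: l2 n1 v1 v2 t nr; rect_lia.
exists K', r'; split=> //; last by move: sb; rect_lia.
by move=> x xK; rewrite mem_cat i' // orbT.
Qed.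

End merging.

(** * Growth of rectangles *)

Section growth.
Implicit Types (K : set site) (T k m n : nat).

(** The filled column [x'] provides the horizontal neighbour, and the infection runs up and down
    from [y0], one site per step. *)
Lemma column_fill K T (x x' c d y0 : int) : `|x - x'| = 1 ->
  (forall y, c <= y <= d -> iter T mod_step K (x', y)) ->
  K (x, y0) -> c <= y0 <= d ->
  forall k y, c <= y <= d -> `|y - y0| <= k%:Z -> iter (T + k) mod_step K (x, y).
Proof.
move=> xx' full Kx y0cd; elim=> [|k IH] y ycd yk.
  by apply: (iter_mod_step_le (leq0n (T + 0))); have -> : y = y0 by lia.
rewrite addnS; have [le|lt] := leP `|y - y0| k%:Z; first by left; exact: IH.
apply/mod_stepP; right => /=; split.
  have h := iter_mod_step_le (leq_addr k T) (full y ycd).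
  have [<-|<-] : x' = x + 1 \/ x' = x - 1 by lia.
    by left.
  by right.
have [yy0|yy0] : y < y0 \/ y0 < y by lia.
  by left; apply: IH; lia.
by right; apply: IH; lia.
Qed.

Lemma row_fill K T (y y' a b x0 : int) : `|y - y'| = 1 ->
  (forall x, a <= x <= b -> iter T mod_step K (x, y')) ->
  K (x0, y) -> a <= x0 <= b ->
  forall k x, a <= x <= b -> `|x - x0| <= k%:Z -> iter (T + k) mod_step K (x, y).
Proof.
move=> yy' full Kx x0ab; elim=> [|k IH] x xab xk.
  by apply: (iter_mod_step_le (leq0n (T + 0))); have -> : x = x0 by lia.
rewrite addnS; have [le|lt] := leP `|x - x0| k%:Z; first by left; exact: IH.
apply/mod_stepP; right => /=; split; last first.
  have h := iter_mod_step_le (leq_addr k T) (full x xab).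
  have [<-|<-] : y' = y + 1 \/ y' = y - 1 by lia.
    by left.
  by right.
have [xx0|xx0] : x < x0 \/ x0 < x by lia.
  by left; apply: IH; lia.
by right; apply: IH; lia.
Qed.

Definition column_segments K (S : rect) m :=
  forall x y : int, between S.1 x -> S.2.1 <= y -> y + m%:Z <= S.2.2 + 1 ->
  exists2 y0, y <= y0 < y + m%:Z & K (x, y0).

Definition row_segments K (S : rect) m :=
  forall x y : int, between S.2 y -> S.1.1 <= x -> x + m%:Z <= S.1.2 + 1 ->
  exists2 x0, x <= x0 < x + m%:Z & K (x0, y).

Lemma segments_grow K S m T r : (0 < m)%N -> column_segments K S m ->
  row_segments K S m -> subr r S -> (m <= len r.1)%N -> (m <= len r.2)%N ->
  valid r -> rset r `<=` iter T mod_step K -> r <> S ->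
  exists r', [/\ subr r' S, valid r', (m <= len r'.1)%N /\ (m <= len r'.2)%N,
     (semiper r < semiper r')%N & rset r' `<=` iter (T + m) mod_step K].
Proof.
move=> m0 hc hr; case: r => [[a b] [c d]] rS mr1 mr2 vr full nrS.
have addcol (x x' : int) : between S.1 x -> `|x - x'| = 1 -> a <= x' <= b ->
    forall y, c <= y <= d -> iter (T + m) mod_step K (x, y).
  move=> Sx xx' x'ab y ycd.
  (* The segment of [m] sites that begins here lies in [[c, d]] and contains [y], so its occupied
     site is at distance less than [m] from [y]. *)
  have [||y0 y0s Ky0] := hc x (Num.min y (d + 1 - m%:Z)) Sx.
  - by move: rS mr2 vr; rect_lia.
  - by move: rS mr2 vr; rect_lia.
  apply: (column_fill xx' _ Ky0 _ ycd).
  - by move=> z zcd; apply: full; move: x'ab zcd; rect_lia.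
  - by move: y0s ycd mr2 vr; rect_lia.
  - by move: y0s ycd mr2 vr; rect_lia.
have addrow (y y' : int) : between S.2 y -> `|y - y'| = 1 -> c <= y' <= d ->
    forall x, a <= x <= b -> iter (T + m) mod_step K (x, y).
  move=> Sy yy' y'cd x xab.
  have [||x0 x0s Kx0] := hr (Num.min x (b + 1 - m%:Z)) y Sy.
  - by move: rS mr1 vr; rect_lia.
  - by move: rS mr1 vr; rect_lia.
  apply: (row_fill yy' _ Kx0 _ xab).
  - by move=> z zab; apply: full; move: y'cd zab; rect_lia.
  - by move: x0s xab mr1 vr; rect_lia.
  - by move: x0s xab mr1 vr; rect_lia.
have full' (x : site) : rset ((a, b), (c, d)) x -> iter (T + m) mod_step K x.
  by move=> /full; exact/iter_mod_step_le/leq_addr.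
have [h|[h|[h|h]]] : S.1.1 < a \/ b < S.1.2 \/ S.2.1 < c \/ d < S.2.2.
- apply: contrapT => h; apply: nrS; move: rS h; case: (S) => [[a' b'] [c' d']].
  by rewrite /subr /sub1 /= => h1 h2; congr (_, _, (_, _)); lia.
- exists ((a - 1, b), (c, d)); split; try by move: rS mr1 mr2 vr h; rect_lia.
  move=> [x y] xy; have [xa|xa] := ltP x a.
    by apply: (addcol x a); move: rS xa xy vr; rect_lia.
  by apply: full'; move: xa xy; rect_lia.
- exists ((a, b + 1), (c, d)); split; try by move: rS mr1 mr2 vr h; rect_lia.
  move=> [x y] xy; have [xa|xa] := ltP b x.
    by apply: (addcol x b); move: rS xa xy vr; rect_lia.
  by apply: full'; move: xa xy; rect_lia.
- exists ((a, b), (c - 1, d)); split; try by move: rS mr1 mr2 vr h; rect_lia.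
  move=> [x y] xy; have [xa|xa] := ltP y c.
    by apply: (addrow y c); move: rS xa xy vr; rect_lia.
  by apply: full'; move: xa xy; rect_lia.
- exists ((a, b), (c, d + 1)); split; try by move: rS mr1 mr2 vr h; rect_lia.
  move=> [x y] xy; have [xa|xa] := ltP d y.
    by apply: (addrow y d); move: rS xa xy vr; rect_lia.
  by apply: full'; move: xa xy; rect_lia.
Qed.

Lemma segments_fill K S m n T r : (0 < m)%N -> column_segments K S m ->
  row_segments K S m -> subr r S -> (m <= len r.1)%N -> (m <= len r.2)%N ->
  valid r -> rset r `<=` iter T mod_step K -> (semiper S <= semiper r + n)%N ->
  rset S `<=` iter (T + n * m) mod_step K.
Proof.
move=> m0 hc hr; elim: n T r => [|n IH] T r rS m1 m2 vr full sn.
  have -> : S = r; last by move=> x /full; rewrite addn0.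
  apply: contrapT => nrS.
  have [|r' [rS' vr' _ lt _]] := segments_grow m0 hc hr rS m1 m2 vr full.
    by move=> rSe; apply: nrS.
  by move: rS' vr' sn lt; rect_lia.
have [<-|nrS] := pselect (r = S).
  by move=> x /full; exact/iter_mod_step_le/leq_addr.
have [r' [rS' vr' [m1' m2'] lt full']] := segments_grow m0 hc hr rS m1 m2 vr full nrS.
by rewrite mulSn addnA; apply: (IH (T + m)%N r') => //; lia.
Qed.

Definition seed K m (a c : int) := K (a, c) /\
  forall k, (0 < k < m)%N ->
    (exists2 y, c <= y < c + k%:Z & K (a + k%:Z, y)) /\
    (exists2 x, a <= x < a + k%:Z & K (x, c + k%:Z)).

Definition rsquare m (a c : int) : rect := ((a, a + m%:Z - 1), (c, c + m%:Z - 1)).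

Lemma seed_fill K m (a c : int) k : seed K m a c -> (0 < k <= m)%N ->
  rset (rsquare k a c) `<=` iter (k * k) mod_step K.
Proof.
move=> [K0 sK]; elim: k => // k IH km.
have [->|k0] := eqVneq k 0%N.
  move=> [x y] xy; apply: (iter_mod_step_le (leq0n (1 * 1))).
  have -> : x = a by move: xy; rewrite /rsquare; rect_lia.
  by have -> : y = c by move: xy; rewrite /rsquare; rect_lia.
have {}IH : rset (rsquare k a c) `<=` iter (k * k) mod_step K by apply: IH; lia.
have [|[y0 yk Ky] [x0 xk Kx]] := sK k; first by lia.
have col (y : int) : c <= y < c + k%:Z -> iter (k * k + k) mod_step K (a + k%:Z, y).
  move=> yc; apply: (@column_fill K (k * k) _ (a + k%:Z - 1) c (c + k%:Z - 1) y0) => //; try by lia.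
  by move=> z zc; apply: IH; rewrite /rsquare; move: zc; rect_lia.
have row (x : int) : a <= x < a + k%:Z -> iter (k * k + k) mod_step K (x, c + k%:Z).
  move=> yc; apply: (@row_fill K (k * k) _ (c + k%:Z - 1) a (a + k%:Z - 1) x0) => //; try by lia.
  by move=> z zc; apply: IH; rewrite /rsquare; move: zc; rect_lia.
(* [k] steps fill the new column and the new row, and one more step fills the corner where they
   meet. *)
have le : ((k * k + k).+1 <= k.+1 * k.+1)%N by lia.
move=> [x y] xy; apply: (iter_mod_step_le le).
have [xk1|xk1] := ltP x (a + k%:Z); have [yk1|yk1] := ltP y (c + k%:Z).
- left; apply: (iter_mod_step_le (leq_addr k (k * k))); apply: IH.
  by rewrite /rsquare; move: xy xk1 yk1; rewrite /rsquare; rect_lia.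
- have -> : y = c + k%:Z by move: xy yk1; rewrite /rsquare; rect_lia.
  by left; apply: row; move: xy xk1; rewrite /rsquare; rect_lia.
- have -> : x = a + k%:Z by move: xy xk1; rewrite /rsquare; rect_lia.
  by left; apply: col; move: xy yk1; rewrite /rsquare; rect_lia.
- have -> : y = c + k%:Z by move: xy yk1; rewrite /rsquare; rect_lia.
  have -> : x = a + k%:Z by move: xy xk1; rewrite /rsquare; rect_lia.
  by apply/mod_stepP; right; split; right => /=; [apply: row|apply: col]; lia.
Qed.

Lemma seed_segments_fill K m (a c : int) S : (0 < m)%N -> subr (rsquare m a c) S ->
  seed K m a c -> column_segments K S m -> row_segments K S m ->
  rset S `<=` iter (m * m + semiper S * m) mod_step K.
Proof.
move=> m0 rS sK hc hr; apply: (@segments_fill K S m _ _ (rsquare m a c)) => //;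
  try by rewrite /rsquare; rect_lia.
by apply: seed_fill sK _; lia.
Qed.

End growth.

(** * The Basel sum and the logarithm series *)

Section analysis.
Variable R : realType.
Implicit Types (x u p q : R) (J n m : nat).

Definition basel J : R := \sum_(0 <= j < J) j.+1%:R ^- 2.

Lemma sin_le_id x : 0 <= x -> sin x <= x.
Proof.
rewrite le_eqVlt => /orP[/eqP <-|x0]; first by rewrite sin0.
have [c _] := @MVT R sin cos 0 x x0 (fun y _ => is_derive_sin y)
  (continuous_subspaceT (@continuous_sin R)).
rewrite sin0 !subr0 => ->.
by rewrite ger_pMl // cos_le1.
Qed.

Lemma cos_mul_le_sin x : 0 < x < pi -> x * cos x <= sin x.
Proof.
move=> /andP[x0 xpi].
have [c /[!in_itv]/= /andP[c0 cx]] := @MVT R sin cos 0 x x0 (fun y _ => is_derive_sin y)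
  (continuous_subspaceT (@continuous_sin R)).
rewrite sin0 !subr0 => ->.
rewrite mulrC ler_pM2r //; apply/ltW.
rewrite ltr_cos // in_itv /=; lra.
Qed.

(** The reflection [y -> pi / 2 - y] pairs the second half of the angles with the first and turns
    sines into cosines; then [1 / sin^2 y + 1 / cos^2 y = 4 / sin^2 (2 y)] leads back to the sum one
    level below. *)
Lemma sum_sin_inv n :
  \sum_(0 <= k < 2 ^ n) (sin ((k.*2.+1)%:R * pi / (2 ^ n.+2)%:R) : R) ^- 2 =
  2 * 4 ^+ n.
Proof.
elim: n => [|n IH].
  rewrite big_nat1 expr0 mulr1 mul1r (_ : (2 ^ 2)%:R = 4) //.
  have e : (pi / 4 : R) *+ 2 = pi / 2 by rewrite mulr2n; field.
  have := cos_mulr2n (pi / 4 : R); rewrite e cos_pihalf => h.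
  have := cos2Dsin2 (pi / 4 : R) => h2.
  have -> : sin (pi / 4 : R) ^+ 2 = 1 / 2 by move: h h2; rewrite mulr2n; lra.
  by field.
set M := (2 ^ n)%N in IH *.
have M0 : (0 < M)%N by rewrite expn_gt0.
have MR : (M%:R : R) != 0 by rewrite pnatr_eq0 -lt0n.
have -> : (2 ^ n.+1 = M + M)%N by rewrite expnS -/M; lia.
rewrite (big_cat_nat (n := M)) //=; last by lia.
rewrite -[X in \sum_(X <= _ < _) _ + _]/(0%N) -{2}[M]add0n big_addn addnK.
rewrite [X in _ + X]big_nat_rev /= -big_split /=.
rewrite exprS mulrCA -IH big_distrr /= big_nat [RHS]big_nat.
apply: eq_bigr => k /andP[_ kM].
set y : R := (k.*2.+1)%:R * pi / (2 ^ n.+3)%:R.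
have E3 : (2 ^ n.+3)%:R = 8 * M%:R :> R by rewrite !expnS -/M !natrM; ring.
have E2 : (2 ^ n.+2)%:R = 4 * M%:R :> R by rewrite !expnS -/M !natrM; ring.
have -> : ((0 + M - k.+1 + M).*2.+1)%:R * pi / (2 ^ n.+3)%:R = pi / 2 - y :> R.
  rewrite /y E3.
  have -> : ((0 + M - k.+1 + M).*2.+1 = 4 * M - k.*2.+1)%N by lia.
  rewrite natrB; last by lia.
  by rewrite natrM; field.
have -> : (k.*2.+1)%:R * pi / (2 ^ n.+2)%:R = y *+ 2 :> R.
  by rewrite /y E2 E3 mulr2n; field.
rewrite sinB sin_pihalf cos_pihalf mul1r mul0r subr0 sin_mulr2n.
have pi0 := pi_gt0 R.
have y0 : 0 < y by rewrite /y !mulr_gt0 // ?ltr0n // invr_gt0 ltr0n expn_gt0.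
have M0R : 0 < M%:R :> R by rewrite ltr0n.
have ypi : y < pi / 2.
  rewrite /y E3 ltr_pdivrMr ?mulr_gt0 //.
  rewrite (_ : pi / 2 * (8 * M%:R) = (4 * M)%:R * pi); last by rewrite natrM; field.
  by rewrite ltr_pM2r // ltr_nat; lia.
have s0 : sin y != 0 by rewrite gt_eqF // sin_gt0_pihalf // y0.
have c0 : cos y != 0 by rewrite gt_eqF // cos_gt0_pihalf //; lra.
have sc := cos2Dsin2 y.
have -> : sin y ^- 2 + cos y ^- 2 = (cos y ^+ 2 + sin y ^+ 2) / (sin y * cos y) ^+ 2.
  by field; rewrite s0 c0.
by rewrite sc mulr2n; field; rewrite s0 c0 -mulr2n mulrn_eq0 /= mulf_neq0.
Qed.

(** On [(0, pi / 2)] one has [y^-2 <= (sin y)^-2 <= y^-2 + 1], the upper bound because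
    [y cos y <= sin y]. After division by [c ^+ 2], the [2 ^ n] errors of at most 1 in [sum_sin_inv]
    add up to at most [pi^2 / (16 * 2 ^ n)]. *)
Lemma sum_odd_inv_bounds n :
  (pi : R) ^+ 2 / 8 - pi ^+ 2 / (16 * 2 ^+ n) <=
  \sum_(0 <= k < 2 ^ n) (k.*2.+1)%:R ^- 2 <= (pi : R) ^+ 2 / 8.
Proof.
set O : R := \sum_(_ <= _ < _) _.
pose c : R := (2 ^ n.+2)%:R / pi.
have pi0 := pi_gt0 R.
have c0 : 0 < c by rewrite divr_gt0 // ltr0n expn_gt0.
have cE : c ^+ 2 = 16 * 4 ^+ n / pi ^+ 2.
  rewrite /c expr_div_n; congr (_ / _).
  have -> : (2 ^ n.+2)%:R = 4 * 2 ^+ n :> R by rewrite natrX !exprS; ring.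
  by rewrite exprMn -exprM mulnC exprM; congr (_ * _ ^+ _); ring.
have key k : (k < 2 ^ n)%N ->
    c ^+ 2 * (k.*2.+1)%:R ^- 2 <=
    (sin ((k.*2.+1)%:R * pi / (2 ^ n.+2)%:R) : R) ^- 2 <=
    c ^+ 2 * (k.*2.+1)%:R ^- 2 + 1.
  move=> kn; set y : R := (k.*2.+1)%:R * pi / (2 ^ n.+2)%:R.
  have y0 : 0 < y by rewrite /y !mulr_gt0 // ?ltr0n // invr_gt0 ltr0n expn_gt0.
  have ypi : y < pi / 2.
    rewrite /y ltr_pdivrMr ?ltr0n ?expn_gt0 //.
    rewrite (_ : pi / 2 * _ = (2 * 2 ^ n)%:R * pi); last first.
      by rewrite !expnS !natrM; field.
    by rewrite ltr_pM2r // ltr_nat; lia.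
  have -> : c ^+ 2 * (k.*2.+1)%:R ^- 2 = y ^- 2.
    have : (k.*2.+1)%:R != 0 :> R by rewrite pnatr_eq0.
    have : (2 ^ n.+2)%:R != 0 :> R by rewrite pnatr_eq0 expn_eq0.
    have : (pi : R) != 0 by rewrite gt_eqF.
    rewrite /c /y; move: (k.*2.+1)%:R (2 ^ n.+2)%:R (pi : R) => a b d d0 b0 a0.
    by field; rewrite a0 b0 d0.
  have s0 : 0 < sin y by rewrite sin_gt0_pihalf // y0.
  have s1 : sin y <= y by apply: sin_le_id; lra.
  have s2 : y * cos y <= sin y by apply: cos_mul_le_sin; lra.
  have cy : 0 < cos y by apply: cos_gt0_pihalf; lra.
  apply/andP; split.
    by rewrite lef_pV2 ?posrE ?exprn_gt0 //; apply: lerXn2r; rewrite ?nnegrE //; lra.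
  have -> : y ^- 2 + 1 = (1 + y ^+ 2) / y ^+ 2 by field; rewrite gt_eqF.
  rewrite -[X in X <= _]mul1r ler_pdivrMr ?exprn_gt0 // mulrAC ler_pdivlMr ?exprn_gt0 // mul1r.
  have : (y * cos y) ^+ 2 <= sin y ^+ 2.
    by rewrite ler_pXn2r ?nnegrE ?(ltW s0) // mulr_ge0 ?ltW.
  rewrite exprMn cos2sin2; nra.
have lo : c ^+ 2 * O <= 2 * 4 ^+ n.
  rewrite -sum_sin_inv /O big_distrr /= big_nat [X in _ <= X]big_nat.
  by apply: ler_sum => k /andP[_ kn]; have /andP[] := key k kn.
have hi : 2 * 4 ^+ n <= c ^+ 2 * O + 2 ^+ n.
  rewrite -sum_sin_inv.
  have -> : 2 ^+ n = \sum_(0 <= k < 2 ^ n) 1 :> R.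
    by rewrite big_const_nat subn0 iter_addr addr0 natrX.
  rewrite /O big_distrr /= -big_split /= big_nat [X in _ <= X]big_nat.
  by apply: ler_sum => k /andP[_ kn]; have /andP[] := key k kn.
have t0 : 0 < 4 ^+ n :> R by rewrite exprn_gt0.
have tt : 0 < 2 ^+ n :> R by rewrite exprn_gt0.
have e4 : 4 ^+ n = 2 ^+ n * 2 ^+ n :> R by rewrite -exprMn; congr (_ ^+ _); ring.
have pp : 0 < pi ^+ 2 :> R by rewrite exprn_gt0.
have OE : O = c ^+ 2 * O * (pi ^+ 2 / (16 * 4 ^+ n)).
  have : (pi : R) != 0 by rewrite gt_eqF.
  by rewrite cE; move: (pi : R) => d dn; field; rewrite dn gt_eqF.
apply/andP; split.
  rewrite OE -[X in X <= _](_ : (2 * 4 ^+ n - 2 ^+ n) * (pi ^+ 2 / (16 * 4 ^+ n)) = _).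
    by rewrite ler_pM2r ?divr_gt0 ?mulr_gt0 //; lra.
  by rewrite e4; field; rewrite !gt_eqF.
rewrite OE -[X in _ <= X](_ : (2 * 4 ^+ n) * (pi ^+ 2 / (16 * 4 ^+ n)) = _).
  by rewrite ler_pM2r ?divr_gt0 ?mulr_gt0.
by field; rewrite !gt_eqF.
Qed.

Lemma basel_double n :
  basel (2 ^ n.+1) = \sum_(0 <= k < 2 ^ n) (k.*2.+1)%:R ^- 2 + basel (2 ^ n) / 4.
Proof.
rewrite /basel expnS; elim: (2 ^ n)%N => [|M IH]; first by rewrite muln0 !big_nil mul0r addr0.
rewrite mulnS !addSn add0n !big_nat_recr //= IH mulrDl.
have -> : ((2 * M).+2)%:R = 2 * M.+1%:R :> R by rewrite -natrM; congr _%:R; lia.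
have -> : ((2 * M).+1)%:R = (M.*2.+1)%:R :> R by congr _%:R; lia.
have : M.+1%:R != 0 :> R by rewrite pnatr_eq0.
have : (M.*2.+1)%:R != 0 :> R by rewrite pnatr_eq0.
by move: (M.+1%:R : R) (M.*2.+1%:R : R) => a b b0 a0; field; rewrite a0 b0.
Qed.

Lemma basel_le J J' : (J <= J')%N -> basel J <= basel J'.
Proof.
move=> JJ'; rewrite /basel [X in _ <= X](big_cat_nat (n := J)) //= lerDl sumr_ge0 //.
Qed.

(** By monotonicity and the splitting into odd and even terms, [b = basel (2 ^ J)] satisfies
    [b <= pi^2 / 8 + b / 4], that is, [b <= pi^2 / 6]. *)
Lemma basel_le_lambda' J : basel J <= lambda' R.
Proof.
apply: (@le_trans _ _ (basel (2 ^ J))); first by apply: basel_le; rewrite ltnW // ltn_expl.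
have := basel_double J; have /andP[_ h] := sum_odd_inv_bounds J.
have : basel (2 ^ J) <= basel (2 ^ J.+1) by apply: basel_le; rewrite leq_exp2l.
by rewrite /lambda'; lra.
Qed.

(** [lambda'] is the fixed point of [b -> pi^2 / 8 + b / 4], and the error term reproduces itself: a
    quarter of it plus the error of the odd sum is its value at [n + 1]. *)
Lemma basel_ge n : lambda' R - pi ^+ 2 / (4 * 2 ^+ n) <= basel (2 ^ n).
Proof.
have pp : 0 < pi ^+ 2 :> R by rewrite exprn_gt0 // pi_gt0.
elim: n => [|n IH].
  have : 0 <= basel (2 ^ 0) by rewrite -(_ : basel 0 = 0) ?basel_le // /basel big_nil.
  by rewrite /lambda' expr0; lra.
rewrite basel_double; have /andP[h _] := sum_odd_inv_bounds n.
have tt : 0 < 2 ^+ n :> R by rewrite exprn_gt0.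
have e : pi ^+ 2 / (4 * 2 ^+ n.+1) = pi ^+ 2 / 2 ^+ n / 8 :> R.
  by rewrite (exprS 2 n); field; rewrite gt_eqF.
have e1 : pi ^+ 2 / (4 * 2 ^+ n) = pi ^+ 2 / 2 ^+ n / 4 :> R.
  by field; rewrite gt_eqF.
have e2 : pi ^+ 2 / (16 * 2 ^+ n) = pi ^+ 2 / 2 ^+ n / 16 :> R.
  by field; rewrite gt_eqF.
by move: h IH; rewrite /lambda' e e1 e2; lra.
Qed.

Lemma basel_approx (eps : R) : 0 < eps -> exists J, lambda' R - eps <= basel J.
Proof.
move=> e0; pose c : R := pi ^+ 2 / (4 * eps).
have [n cn] : exists n, c <= n%:R.
  exists (Num.truncn c).+1; apply/ltW; exact: truncnS_gt.
exists (2 ^ n)%N; apply: le_trans (basel_ge n); rewrite lerD2l lerN2.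
have tt : 0 < 2 ^+ n :> R by rewrite exprn_gt0.
rewrite ler_pdivrMr ?mulr_gt0 //.
have : c <= 2 ^+ n by apply: le_trans cn _; rewrite -natrX ler_nat ltnW // ltn_expl.
by rewrite /c ler_pdivrMr ?mulr_gt0 //; lra.
Qed.

(** The difference of [- ln u] and the partial sum at [1 - u] has derivative [- (1 - u) ^ J / u], by
    the geometric sum; the mean value theorem on [[1 - x, 1]] then encloses the tail of the
    series. *)
Lemma ln_series_bounds J x : 0 <= x < 1 ->
  \sum_(0 <= j < J) x ^+ j.+1 / j.+1%:R <= - ln (1 - x) <=
  \sum_(0 <= j < J) x ^+ j.+1 / j.+1%:R + x ^+ J.+1 / (1 - x).
Proof.
move=> /andP[]; rewrite le_eqVlt => /orP[/eqP <- _|x0 x1].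
  rewrite subr0 ln1 oppr0 expr0n mul0r addr0 big1 ?lexx // => j _.
  by rewrite expr0n mul0r.
pose S J u := \sum_(0 <= j < J) (1 - u) ^+ j.+1 / j.+1%:R.
pose F u := - ln u - S J u.
have dS u : is_derive u 1 (S J) (- \sum_(0 <= j < J) (1 - u) ^+ j).
  rewrite /S; elim: (J) => [|n IH].
    rewrite big_nil oppr0 (_ : (fun u => _) = cst 0); first exact: is_derive_cst.
    by apply/funext => v; rewrite big_nil.
  rewrite (_ : (fun u => _) = (fun u => \sum_(0 <= j < n) (1 - u) ^+ j.+1 / j.+1%:R)
     + (n.+1%:R^-1 \*: ((cst 1 - id) ^+ n.+1 : R -> R^o))); last first.
    apply/funext => v; rewrite big_nat_recr //= mulrC.
    by rewrite !fctE.
  rewrite big_nat_recr //= opprD; apply: is_deriveD.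
  apply: is_derive_eq.
  rewrite /= sub0r /GRing.scale /=.
  by rewrite mulrN1 mulrN -mulr_natl mulrA mulVf ?mul1r // pnatr_eq0.
have geo u : u != 0 -> \sum_(0 <= j < J) (1 - u) ^+ j = (1 - (1 - u) ^+ J) / u.
  move=> u0; elim: (J) => [|n IH]; first by rewrite big_nil subrr mul0r.
  by rewrite big_nat_recr //= IH exprS; field.
have dF u : 0 < u -> is_derive u 1 F (- ((1 - u) ^+ J / u)).
  move=> u0; have := is_derive1_ln u0 => dl.
  rewrite /F (_ : (fun u => _) = - (@ln R) - S J) //.
  apply: is_derive_eq.
  by rewrite geo ?gt_eqF //; field; rewrite gt_eqF.
have [|||c /[!in_itv]/= /andP[c0 c1]] := @MVT R F (fun u => - ((1 - u) ^+ J / u)) (1 - x) 1.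
- by lra.
- by move=> u /[!in_itv]/= /andP[u1 _]; apply: dF; lra.
- apply: derivable_within_continuous => u /[!in_itv]/= /andP[u1 _].
  by have [|] := dF u; [lra|].
have -> : F 1 = 0.
  rewrite /F /S ln1 oppr0 sub0r big1 ?oppr0 // => j _.
  by rewrite subrr expr0n mul0r.
rewrite /F.
have -> : S J (1 - x) = \sum_(0 <= j < J) x ^+ j.+1 / j.+1%:R.
  by apply: eq_bigr => j _; congr (_ ^+ _ / _); ring.
set s := \sum_(_ <= _ < _) _.
rewrite (_ : 1 - (1 - x) = x) => [h|]; last by ring.
have xc : 0 <= 1 - c by lra.
have cp : 0 < c by lra.
have a0 : 0 <= (1 - c) ^+ J / c by rewrite divr_ge0 // ?exprn_ge0 // ltW.
have a1 : (1 - c) ^+ J / c <= x ^+ J / (1 - x).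
  apply: ler_pM.
  - by rewrite exprn_ge0.
  - by rewrite invr_ge0 ltW.
  - by apply: lerXn2r; rewrite ?nnegrE; lra.
  - by rewrite lef_pV2 ?posrE; lra.
have a0x : 0 <= (1 - c) ^+ J / c * x by rewrite mulr_ge0 // ltW.
have a1x : (1 - c) ^+ J / c * x <= x ^+ J / (1 - x) * x by rewrite ler_pM2r.
have -> : x ^+ J.+1 / (1 - x) = x ^+ J / (1 - x) * x by rewrite exprSr mulrAC.
by apply/andP; split; lra.
Qed.

End analysis.

(** * Path costs *)

Section log_sums.
Variable R : realType.
Implicit Types (p x : R) (J K n m k : nat).

Definition cost p k : R := - ln (1 - (1 - p) ^+ k).

Lemma bernoulli_ge n x : -1 <= x -> 1 + n%:R * x <= (1 + x) ^+ n.
Proof.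
move=> x1; elim: n => [|n IH]; first by rewrite mul0r addr0 expr0.
rewrite exprS; apply: (@le_trans _ _ ((1 + x) * (1 + n%:R * x))); last first.
  by rewrite ler_wpM2l //; lra.
have : 0 <= n%:R * x ^+ 2 by rewrite mulr_ge0 // sqr_ge0.
by rewrite -natr1; nra.
Qed.

Lemma pow_ge_linear n p : 0 <= p <= 1 -> 1 - n%:R * p <= (1 - p) ^+ n.
Proof. by move=> p01; rewrite -mulrN; apply: bernoulli_ge; lra. Qed.

Lemma pow_le_linear n p : 0 <= p <= 1 -> (1 - p) ^+ n * (1 + n%:R * p) <= 1.
Proof.
move=> p01; apply: (@le_trans _ _ ((1 - p) ^+ n * (1 + p) ^+ n)).
  by rewrite ler_wpM2l ?exprn_ge0 ?bernoulli_ge //; lra.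
by rewrite -exprMn exprn_ile1 //; nra.
Qed.

Lemma pow_itv p n : 0 < p < 1 -> (0 < n)%N -> 0 < (1 - p) ^+ n < 1.
Proof.
move=> p01 n0; rewrite exprn_gt0 /=; last by lra.
by rewrite exprn_ilt1 -?lt0n //; lra.
Qed.

Lemma geometric_sum n x : (1 - x) * \sum_(0 <= k < n) x ^+ k = 1 - x ^+ n.
Proof.
elim: n => [|n IH]; first by rewrite big_nil mulr0 subrr.
by rewrite big_nat_recr //= mulrDr IH exprS; ring.
Qed.

(** Once every logarithm is expanded and the sums are exchanged, the sum over [k] is geometric with
    ratio [(1 - p) ^+ j.+1], so of order [1 / (j.+1 p)]. With the coefficient [1 / j.+1] this yields
    the terms of [basel]. *)
Lemma double_sum p n k0 J :
  \sum_(0 <= k < n) \sum_(0 <= j < J) ((1 - p) ^+ (k + k0).+1) ^+ j.+1 / j.+1%:R =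
  \sum_(0 <= j < J) (((1 - p) ^+ j.+1) ^+ k0.+1 / j.+1%:R) *
     \sum_(0 <= k < n) ((1 - p) ^+ j.+1) ^+ k.
Proof.
rewrite exchange_big_nat /=; apply: eq_bigr => j _; rewrite big_distrr /=.
apply: eq_bigr => k _; rewrite -!exprM mulrAC -exprD.
by congr (_ ^+ _ / _); lia.
Qed.

Lemma sum_cost_le p m : 0 < p < 1 -> \sum_(0 <= k < m) cost p k.+1 <= lambda' R / p.
Proof.
move=> p01; have p0 : 0 < p by lra.
apply/ler_addgt0Pr => e e0.
(* Each of the [m] truncation errors is at most [(1 - p) ^+ J.+1 / p], hence at most
   [1 / (J.+1 p^2)] by [pow_le_linear]; this [J] makes their sum at most [e]. *)
have [J hJ] : exists J, m%:R / (p * p * e) <= J.+1%:R.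
  by exists (Num.truncn (m%:R / (p * p * e))); apply/ltW; exact: truncnS_gt.
have bd k : (0 <= k < m)%N -> cost p k.+1 <=
   \sum_(0 <= j < J) ((1 - p) ^+ (k + 0).+1) ^+ j.+1 / j.+1%:R + (1 - p) ^+ J.+1 / p.
  move=> _; rewrite addn0; set x := (1 - p) ^+ k.+1.
  have x01 : 0 < x < 1 by exact: pow_itv.
  have [|_ h] := andP (@ln_series_bounds _ J x _); first by lra.
  apply: le_trans h _; rewrite lerD2l.
  have xp : x <= 1 - p by rewrite /x exprSr ler_piMl ?exprn_ile1 //; lra.
  apply: ler_pM; rewrite ?exprn_ge0 ?invr_ge0 //; try lra.
    by apply: lerXn2r; rewrite ?nnegrE; lra.
  by rewrite lef_pV2 ?posrE; lra.
rewrite big_nat; apply: (le_trans (ler_sum _ bd)); rewrite -big_nat big_split /=.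
apply: lerD.
  rewrite double_sum; apply: (@le_trans _ _ (basel R J / p)); last first.
    by rewrite ler_pM2r ?invr_gt0 //; exact: basel_le_lambda'.
  rewrite /basel big_distrl /=; apply: ler_sum => j _.
  set y := (1 - p) ^+ j.+1; rewrite expr1.
  have y01 : 0 < y < 1 by exact: pow_itv.
  have g := geometric_sum m y; have yl : y * (1 + j.+1%:R * p) <= 1 by apply: pow_le_linear; lra.
  have j0 : 0 < j.+1%:R :> R by rewrite ltr0n.
  set s := \sum_(_ <= _ < _) _ in g *.
  have s1 : (1 - y) * s <= 1 by rewrite g gerBl exprn_ge0 //; lra.
  have jp : 0 < j.+1%:R * p by rewrite mulr_gt0.
  have ys : y * (j.+1%:R * p) * s <= 1.
    apply: le_trans s1; rewrite ler_wpM2r //; last by lra.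
    by rewrite sumr_ge0 // => k _; rewrite exprn_ge0 //; lra.
  have -> : j.+1%:R ^- 2 / p = 1 / (j.+1%:R ^+ 2 * p) by field; rewrite ?gt_eqF //=; split; lra.
  rewrite ler_pdivlMr ?mulr_gt0 ?exprn_gt0 //.
  apply: le_trans ys; rewrite le_eqVlt; apply/orP; left; apply/eqP.
  move: (j.+1%:R : R) j0 {jp yl} => a a0; field; lra.
rewrite big_const_nat subn0 iter_addr addr0 -mulr_natr.
have J0 : 0 < J.+1%:R :> R by rewrite ltr0n.
have h : (1 - p) ^+ J.+1 * (1 + J.+1%:R * p) <= 1 by apply: pow_le_linear; lra.
have qJ : 0 <= (1 - p) ^+ J.+1 by rewrite exprn_ge0; lra.
move: hJ; rewrite ler_pdivrMr ?mulr_gt0 // => hJ.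
rewrite mulrAC ler_pdivrMr //.
move: qJ h hJ; move: ((1 - p) ^+ J.+1) (J.+1%:R : R) J0 => u a a0 u0 h hJ.
have h2 : u * a * p <= 1 by nra.
apply: (@le_trans _ _ (u * (a * (p * p * e)))); first by rewrite ler_wpM2l.
have -> : u * (a * (p * p * e)) = u * a * p * (e * p) by ring.
by rewrite ler_piMl // mulr_ge0 ?ltW.
Qed.

(** Cutting the logarithm series after [J] terms only lowers the sum. The two correction factors pay
    for the shift by [k0] and for stopping at [K] summands. *)
Lemma sum_cost_ge p J K k0 : 0 < p < 1 -> J%:R * k0.+1%:R * p <= 1 ->
  basel R J / p * (1 - J%:R * k0.+1%:R * p) * (1 - (1 - p) ^+ K) <=
  \sum_(0 <= k < K) cost p (k + k0).+1.
Proof.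
move=> p01 Jk; have p0 : 0 < p by lra.
have qK0 : 0 <= (1 - p) ^+ K by rewrite exprn_ge0; lra.
have qK1 : (1 - p) ^+ K <= 1 by rewrite exprn_ile1; lra.
apply: (@le_trans _ _ (\sum_(0 <= k < K) \sum_(0 <= j < J)
   ((1 - p) ^+ (k + k0).+1) ^+ j.+1 / j.+1%:R)); last first.
  apply: ler_sum => k _; set x := (1 - p) ^+ _.
  have x01 : 0 < x < 1 by exact: pow_itv.
  by have [|h _] := andP (@ln_series_bounds _ J x _); first by lra.
rewrite double_sum /basel !mulr_suml big_nat [X in _ <= X]big_nat.
apply: ler_sum => j /andP[_ jJ].
set y := (1 - p) ^+ j.+1.
have y01 : 0 < y < 1 by exact: pow_itv.
have j0 : 0 < j.+1%:R :> R by rewrite ltr0n.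
have g := geometric_sum K y.
set s := \sum_(_ <= _ < _) _ in g *.
have yl : 1 - j.+1%:R * p <= y by apply: pow_ge_linear; lra.
have yK : y ^+ K <= (1 - p) ^+ K.
  apply: lerXn2r; rewrite ?nnegrE; try lra.
  by rewrite /y exprSr ler_piMl ?exprn_ile1 //; lra.
have s0 : 0 <= s by rewrite sumr_ge0 // => k _; rewrite exprn_ge0 //; lra.
have s1 : 1 - (1 - p) ^+ K <= j.+1%:R * p * s.
  apply: (@le_trans _ _ ((1 - y) * s)); first by rewrite g; lra.
  by rewrite ler_wpM2r //; lra.
have yk : 1 - J%:R * k0.+1%:R * p <= y ^+ k0.+1.
  rewrite /y -exprM; apply: (le_trans _ (pow_ge_linear _ _)); last by lra.
  rewrite lerD2l lerN2 natrM ler_pM2r // ler_pM2r ?ltr0n // ler_nat //.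
have -> : j.+1%:R ^- 2 / p * (1 - J%:R * k0.+1%:R * p) * (1 - (1 - p) ^+ K) =
   ((1 - J%:R * k0.+1%:R * p) / j.+1%:R) * ((1 - (1 - p) ^+ K) / (j.+1%:R * p)).
  by move: (j.+1%:R : R) j0 {yl s1} => a a0; field; apply/andP; split; lra.
apply: ler_pM.
- by apply: divr_ge0; [lra|exact: ltW].
- by apply: divr_ge0; [lra|rewrite mulr_ge0 ?ltW].
- by rewrite ler_pM2r // invr_gt0.
- by rewrite ler_pdivrMr ?mulr_gt0 // mulrC.
Qed.

Lemma pow_le_expR p n : 0 <= p <= 1 -> (1 - p) ^+ n <= expR (- (n%:R * p)).
Proof.
move=> p01; rewrite -mulrN expRM_natl; apply: lerXn2r; rewrite ?nnegrE ?expR_ge0 //; try lra.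
by apply: le_trans (expR_ge1Dx _); lra.
Qed.

Lemma pow_ge_expR p n : 0 <= p <= 1 / 2 -> expR (- (2 * n%:R * p)) <= (1 - p) ^+ n.
Proof.
move=> p01; rewrite (_ : - (2 * n%:R * p) = n%:R * - (2 * p)); last by ring.
rewrite expRM_natl; apply: lerXn2r; rewrite ?nnegrE ?expR_ge0 //; first by lra.
rewrite expRN; have h := expR_ge1Dx (2 * p).
rewrite -[X in X <= _]mul1r ler_pdivrMr ?expR_gt0 //.
by apply: (@le_trans _ _ ((1 - p) * (1 + 2 * p))); [nra|rewrite ler_wpM2l //; lra].
Qed.

Lemma expR_cost p k : 0 < p < 1 -> (0 < k)%N -> expR (- cost p k) = 1 - (1 - p) ^+ k.
Proof.
by move=> p01 k0; rewrite /cost opprK lnK // posrE subr_gt0; case/andP: (pow_itv p01 k0).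
Qed.

Lemma cost_ge0 p k : 0 < p < 1 -> (0 < k)%N -> 0 <= cost p k.
Proof.
move=> p01 k0; rewrite /cost oppr_ge0 ln_le0 // gerBl.
by case/andP: (pow_itv p01 k0) => /ltW.
Qed.

Lemma cost_le p k k' : 0 < p < 1 -> (0 < k <= k')%N -> cost p k' <= cost p k.
Proof.
move=> p01 /andP[k0 kk']; have h1 := pow_itv p01 k0.
have h2 := pow_itv p01 (leq_trans k0 kk').
rewrite /cost lerN2 ler_ln ?posrE; [|lra|lra].
rewrite lerD2l lerN2; apply: ler_wiXn2l => //; lra.
Qed.

(** This is log-concavity of [k -> 1 - (1 - p) ^+ k]: with [u = (1 - p) ^+ k], the middle term
    squared exceeds the product of its neighbours by exactly [u p^2]. *)
Lemma cost_convex p k : 0 < p < 1 -> (0 < k)%N ->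
  cost p k.+1 - cost p k.+2 <= cost p k - cost p k.+1.
Proof.
move=> p01 k0; have h1 := pow_itv p01 k0; have h2 := pow_itv p01 (ltn0Sn k).
have h3 := pow_itv p01 (ltn0Sn k.+1).
suff : ln ((1 - (1 - p) ^+ k) * (1 - (1 - p) ^+ k.+2)) <= ln ((1 - (1 - p) ^+ k.+1) ^+ 2).
  rewrite lnM ?posrE ?lnXn; [|lra|lra|lra].
  by rewrite /cost mulr2n; lra.
have a1 : 0 < 1 - (1 - p) ^+ k by lra.
have a2 : 0 < 1 - (1 - p) ^+ k.+1 by lra.
have a3 : 0 < 1 - (1 - p) ^+ k.+2 by lra.
rewrite ler_ln ?posrE ?mulr_gt0 ?exprn_gt0 // !exprS.
set u := (1 - p) ^+ k in h1 *; rewrite -subr_ge0.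
set z := _ - _; have -> : z = u * p ^+ 2 by rewrite /z expr0; ring.
by rewrite mulr_ge0 ?sqr_ge0 //; lra.
Qed.

Lemma cost_ge_pow p k : 0 < p < 1 -> (0 < k)%N -> (1 - p) ^+ k <= cost p k.
Proof.
move=> p01 k0; have h1 := pow_itv p01 k0.
by rewrite /cost lerNr; apply: le_ln1Dx; lra.
Qed.

End log_sums.

Section path_cost.
Variables (R : realType) (h : nat -> R).
Hypothesis h_ge0 : forall k, 0 <= h k.
Hypothesis h_noninc : forall k k', (k <= k')%N -> h k' <= h k.
Hypothesis h_convex : forall k, h k.+1 - h k.+2 <= h k - h k.+1.

(* The least cost of a monotone lattice path from the origin to [(m, n)], when
   a horizontal step at height [j] and a vertical step at abscissa [j] cost [h j]. *)
Fixpoint path_cost (m n : nat) {struct m} : R :=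
  match m with
  | 0 => n%:R * h 0
  | m'.+1 =>
    (fix path_cost_m (n : nat) : R :=
       match n with
       | 0 => m'.+1%:R * h 0
       | n'.+1 => Num.min (path_cost m' n'.+1 + h n'.+1) (path_cost_m n' + h m'.+1)
       end) n
  end.

Lemma path_costSS m n : path_cost m.+1 n.+1 =
  Num.min (path_cost m n.+1 + h n.+1) (path_cost m.+1 n + h m.+1).
Proof. by []. Qed.

Lemma path_cost0n n : path_cost 0 n = n%:R * h 0.
Proof. by []. Qed.

Lemma path_costn0 n : path_cost n 0 = n%:R * h 0.
Proof. by case: n. Qed.

Lemma path_costSl m n : path_cost m.+1 n <= path_cost m n + h n.
Proof.
case: n => [|n]; last by rewrite path_costSS ge_min lexx.
by rewrite !path_costn0 -natr1; lra.
Qed.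

Lemma path_costSr m n : path_cost m n.+1 <= path_cost m n + h m.
Proof.
case: m => [|m]; last by rewrite path_costSS ge_min lexx orbT.
by rewrite !path_cost0n -natr1; lra.
Qed.

(** One path suffices: [x] horizontal steps at height [n], then [y] vertical steps at abscissa
    [m + x], where [h] is at most [h m]. *)
Lemma path_cost_grow m n x y :
  path_cost (m + x) (n + y) <= path_cost m n + x%:R * h n + y%:R * h m.
Proof.
elim: y => [|y IH].
  rewrite addn0 mul0r addr0; elim: x => [|x IH]; first by rewrite addn0 mul0r addr0.
  by rewrite addnS; apply: (le_trans (path_costSl _ _)); rewrite -natr1; lra.
rewrite addnS; apply: (le_trans (path_costSr _ _)).
have := h_noninc (leq_addr x m).
by rewrite -[y.+1%:R]natr1; lra.
Qed.

Lemma path_cost_le m n : path_cost m n <= (m + n)%:R * h 0.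
Proof.
have := path_cost_grow 0 0 m n; rewrite !add0n path_cost0n natrD; lra.
Qed.

(** Remove the last step of an optimal path to [(m1, n1)]. If the smaller rectangle still reaches
    the target together with the second one, the step is dropped, as costs are nonnegative;
    otherwise the target shrinks as well, and the same step made there lies farther out and costs no
    more. *)
Lemma path_cost_merge m1 n1 m2 n2 m n :
  (m1 <= m <= m1 + m2)%N -> (n1 <= n <= n1 + n2)%N -> (m2 <= m)%N -> (n2 <= n)%N ->
  path_cost m n <= path_cost m1 n1 + path_cost m2 n2.
Proof.
have [s] := ubnP (m1 + n1); elim: s m1 n1 m n => // s IH m1 n1 m n ss hm hn hm2 hn2.
have stepl m1' : m1 = m1'.+1 -> path_cost m n <= path_cost m1' n1 + h n1 + path_cost m2 n2.
  move=> m1E; have [le|lt] := leqP m (m1' + m2).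
    have := IH m1' n1 m n _ _ hn hm2 hn2 => /(_ ltac:(lia) ltac:(lia)).
    by have := h_ge0 n1; lra.
  have [m' mE] : exists m', m = m'.+1 by exists m.-1; lia.
  have := IH m1' n1 m' n _ _ hn _ hn2 => /(_ ltac:(lia) ltac:(lia) ltac:(lia)).
  have := path_costSl m' n; rewrite -mE.
  have : h n <= h n1 by apply: h_noninc; lia.
  lra.
have stepr n1' : n1 = n1'.+1 -> path_cost m n <= path_cost m1 n1' + h m1 + path_cost m2 n2.
  move=> n1E; have [le|lt] := leqP n (n1' + n2).
    have := IH m1 n1' m n _ hm _ hm2 hn2 => /(_ ltac:(lia) ltac:(lia)).
    by have := h_ge0 m1; lra.
  have [n' nE] : exists n', n = n'.+1 by exists n.-1; lia.
  have := IH m1 n1' m n' _ hm _ hm2 => /(_ ltac:(lia) ltac:(lia) ltac:(lia)).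
  have := path_costSr m n'; rewrite -nE.
  have : h m <= h m1 by apply: h_noninc; lia.
  lra.
case: m1 n1 ss hm hn stepl stepr => [|m1] [|n1] ss hm hn stepl stepr.
- have -> : m = m2 by lia.
  have -> : n = n2 by lia.
  by rewrite path_cost0n mul0r add0r.
- have := stepr n1 erefl; rewrite !path_cost0n -natr1; lra.
- have := stepl m1 erefl; rewrite !path_costn0 -natr1; lra.
- have := stepl m1 erefl; have := stepr n1 erefl; rewrite path_costSS => h1 h2.
  by rewrite -lerBlDr le_min !lerBlDr h1 h2.
Qed.

Lemma h_tangent a d : h a.+1 - h (a.+1 + d) <= d%:R * (h a - h a.+1).
Proof.
have mono b c : h (b + c) - h (b + c).+1 <= h b - h b.+1.
  by elim: c => [|c IH]; rewrite ?addn0 // addnS; apply: le_trans IH; exact: h_convex.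
elim: d => [|d IH]; first by rewrite addn0 subrr mul0r.
rewrite addnS -natr1; have := mono a d.+1; rewrite addnS addSn; lra.
Qed.

(** The cost of the staircase along the diagonal from the origin to [(a, a)], followed by [b - a]
    straight steps. *)
Definition diag_cost (a b : nat) : R :=
  \sum_(0 <= k < a) (h k + h k.+1) + (b - a)%:R * h a.

(** It is enough that no single lattice step raises [diag_cost] by more than its own cost. For a
    step that widens the shorter side this is [h_tangent], hence convexity; for a step along the
    longer side there is equality. *)
Lemma diag_cost_le m n : diag_cost (minn m n) (maxn m n) <= path_cost m n.
Proof.
have step a b : diag_cost (minn a.+1 b) (maxn a.+1 b) <= diag_cost (minn a b) (maxn a b) + h b.
  have [ab|ba] := ltnP a b.
    have e1 : minn a.+1 b = a.+1 by lia.
    have e2 : maxn a.+1 b = b by lia.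
    rewrite e1 e2.
    rewrite /diag_cost big_nat_recr //=.
    have [d bE] : exists d, b = (a.+1 + d)%N by exists (b - a.+1)%N; lia.
    have := h_tangent a d; rewrite -bE.
    have -> : (b - a.+1 = d)%N by lia.
    have -> : (b - a = d.+1)%N by lia.
    by rewrite -natr1; lra.
  have e1 : minn a.+1 b = b by lia.
  have e2 : maxn a.+1 b = a.+1 by lia.
  rewrite e1 e2.
  rewrite /diag_cost subSn // -natr1; lra.
elim: m n => [|m IHm] n.
  by rewrite min0n max0n /diag_cost big_nil subn0 add0r path_cost0n.
elim: n => [|n IHn].
  by rewrite minn0 maxn0 /diag_cost big_nil subn0 add0r path_costn0.
rewrite path_costSS le_min; apply/andP; split.
  by apply: le_trans (step m n.+1) _; rewrite lerD2r.
by rewrite minnC maxnC; apply: le_trans (step n m.+1) _; rewrite lerD2r minnC maxnC.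
Qed.

End path_cost.

(** * Probability of spanning *)

(** The test makes reversed intervals empty: [len] is an absolute value and can be positive on
    them. *)
Definition irange (i : int * int) : seq int :=
  if i.1 <= i.2 then [seq i.1 + k%:Z | k <- iota 0 (len i)] else [::].

Lemma mem_irange i z : (z \in irange i) = between i z.
Proof.
rewrite /irange; case: ifPn => [i12|i12]; last by rewrite in_nil; rect_lia.
apply/mapP/idP => [[k /[!mem_iota] kl ->]|zi]; first by move: kl; rect_lia.
by exists (absz (z - i.1)); rewrite ?mem_iota; move: zi; rect_lia.
Qed.

Lemma irange_uniq i : uniq (irange i).
Proof.
rewrite /irange; case: ifP => // _; rewrite map_inj_uniq ?iota_uniq //.
by move=> a b /addrI[].
Qed.

Lemma size_irange i : i.1 <= i.2 -> size (irange i) = len i.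
Proof. by move=> i12; rewrite /irange i12 size_map size_iota. Qed.

Definition rsites (r : rect) : seq site :=
  [seq (x, y) | x <- irange r.1, y <- irange r.2].

Lemma mem_rsites r x : (x \in rsites r) = between r.1 x.1 && between r.2 x.2.
Proof.
case: x => x y; apply/allpairsP/idP => [[[a b] /= [ha hb [-> ->]]]|/=].
  by rewrite -!mem_irange ha hb.
by rewrite -!mem_irange => /andP[hx hy]; exists (x, y).
Qed.

Lemma rsitesE r : [set` rsites r] = rset r.
Proof. by apply/seteqP; split=> x /=; rewrite mem_rsites. Qed.

Lemma rsites_uniq r : uniq (rsites r).
Proof.
by apply: allpairs_uniq; rewrite ?irange_uniq // => -[a b] [c d].
Qed.

Definition subintervals (i : int * int) : seq (int * int) :=
  [seq (x, y) | x <- irange i, y <- irange i].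

Definition subrects (r : rect) : seq rect :=
  [seq (i, j) | i <- subintervals r.1, j <- subintervals r.2].

Lemma mem_subrects r r' : valid r' -> subr r' r -> r' \in subrects r.
Proof.
move=> v sb; apply/allpairsP; exists r'; split; last by case: (r').
  by apply/allpairsP; exists r'.1; split; rewrite ?mem_irange; [move: v sb; rect_lia|move: v sb; rect_lia|case: (r'.1)].
by apply/allpairsP; exists r'.2; split; rewrite ?mem_irange; [move: v sb; rect_lia|move: v sb; rect_lia|case: (r'.2)].
Qed.

Lemma size_subrects r : valid r ->
  size (subrects r) = (len r.1 * len r.1 * (len r.2 * len r.2))%N.
Proof.
by case/andP=> v1 v2; rewrite !size_allpairs !size_irange.
Qed.

Definition ispan (r : rect) (A : set site) := exists2 K, spans K r & [set` K] `<=` A.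

Lemma ispan_inc r : increasing (ispan r).
Proof. by move=> A B AB [K sK KA]; exists K => //; exact: subset_trans AB. Qed.

Lemma subr_hull r1 r2 S : subr (hull r1 r2) S -> subr r1 S /\ subr r2 S.
Proof. by rect_lia. Qed.

Lemma rset_hull r1 r2 x : rset r1 x \/ rset r2 x -> rset (hull r1 r2) x.
Proof. by rect_lia. Qed.


Definition outside (i i' : int * int) := [seq z <- irange i | ~~ between i' z].

Lemma between_sub1 i j z : sub1 i j -> between i z -> between j z.
Proof. rect_lia. Qed.

Lemma size_outside i i' : sub1 i' i -> i'.1 <= i'.2 ->
  size (outside i i') = (len i - len i')%N.
Proof.
move=> sb v; have := count_predC (between i') (irange i).
rewrite size_irange; last by move: sb v; rect_lia.
have -> : count (between i') (irange i) = len i'.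
  rewrite -(size_irange v) -size_filter; apply: perm_size; apply: uniq_perm.
  - exact/filter_uniq/irange_uniq.
  - exact: irange_uniq.
  - by move=> z; rewrite mem_filter !mem_irange; move: sb v; rect_lia.
by rewrite /outside size_filter => <-; rewrite addKn; apply: eq_count.
Qed.

(* [(true, z)] stands for the column [x = z] and [(false, z)] for the row [y = z].
   The corner part of a line consists of its sites that lie both in a column and
   in a row avoiding [r]; its private part faces [r]. *)
Definition lines (S r : rect) : seq (bool * int) :=
  [seq (true, z) | z <- outside S.1 r.1] ++ [seq (false, z) | z <- outside S.2 r.2].

Definition line_priv (r : rect) (i : bool * int) : seq site :=
  if i.1 then [seq (i.2, y) | y <- irange r.2] else [seq (x, i.2) | x <- irange r.1].

Definition line_corn (S r : rect) (i : bool * int) : seq site :=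
  if i.1 then [seq (i.2, y) | y <- outside S.2 r.2]
  else [seq (x, i.2) | x <- outside S.1 r.1].

Definition fillable (S r : rect) (A : set site) :=
  forall i, i \in lines S r -> hit (line_priv r i ++ line_corn S r i) A.

Lemma mem_linesT S r z : ((true, z) \in lines S r) = (z \in outside S.1 r.1).
Proof.
rewrite mem_cat mem_map; last by move=> a b [].
by rewrite orbC; case: mapP => // -[y _ []].
Qed.

Lemma mem_linesF S r z : ((false, z) \in lines S r) = (z \in outside S.2 r.2).
Proof.
rewrite mem_cat [X in _ || X]mem_map; last by move=> a b [].
by case: mapP => // -[y _ []].
Qed.

Lemma mem_line_privT r z x :
  (x \in line_priv r (true, z)) = (x.1 == z) && between r.2 x.2.
Proof.
case: x => x y; rewrite /line_priv /= -mem_irange; apply/mapP/andP.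
  by case=> w wr [-> ->].
by case=> /eqP -> yr; exists y.
Qed.

Lemma mem_line_privF r z x :
  (x \in line_priv r (false, z)) = (x.2 == z) && between r.1 x.1.
Proof.
case: x => x y; rewrite /line_priv /= -mem_irange; apply/mapP/andP.
  by case=> w wr [-> ->].
by case=> /eqP -> yr; exists x.
Qed.

Lemma mem_line_cornT S r z x :
  (x \in line_corn S r (true, z)) = (x.1 == z) && (x.2 \in outside S.2 r.2).
Proof.
case: x => x y; rewrite /line_corn /=; apply/mapP/andP.
  by case=> w wr [-> ->].
by case=> /eqP -> yr; exists y.
Qed.

Lemma mem_line_cornF S r z x :
  (x \in line_corn S r (false, z)) = (x.2 == z) && (x.1 \in outside S.1 r.1).
Proof.
case: x => x y; rewrite /line_corn /=; apply/mapP/andP.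
  by case=> w wr [-> ->].
by case=> /eqP -> yr; exists x.
Qed.

Definition mem_line := (mem_linesT, mem_linesF, mem_line_privT, mem_line_privF,
  mem_line_cornT, mem_line_cornF).

Lemma mem_outside i i' z : (z \in outside i i') = between i z && ~~ between i' z.
Proof. by rewrite mem_filter mem_irange andbC. Qed.

Lemma ispan_fillable S r A : ispan S A -> fillable S r A.
Proof.
case=> K sK KA -[[] z]; rewrite mem_line mem_outside => /andP[zS zr].
  have [x xK xz] := spans_cols sK zS; exists x; last exact: KA.
  rewrite mem_cat !mem_line mem_outside xz eqxx /=.
  by have /andP[_ ->] := spans_sub sK xK; rewrite orbN.
have [x xK xz] := spans_rows sK zS; exists x; last exact: KA.
rewrite mem_cat !mem_line mem_outside xz eqxx /=.
by have /andP[-> _] := spans_sub sK xK; rewrite orbN.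
Qed.

Lemma fillable_outside S r i x : i \in lines S r ->
  x \in line_priv r i ++ line_corn S r i -> ~ rset r x.
Proof.
case: i => -[] z; rewrite mem_line mem_outside mem_cat !mem_line !mem_outside;
  move=> /andP[_ zr] h rx; move: h zr rx; rewrite /rset /=.
  by case/orP=> /andP[/eqP -> _] /negbTE ->.
by case/orP=> /andP[/eqP -> _] /negbTE ->; rewrite andbF.
Qed.

Section spanning_bounds.
Variables (R : realType) (p : R).
Hypothesis p12 : 0 < p <= 1 / 2.
Implicit Types (s l : seq site) (r : rect).

Let p01 : 0 <= p <= 1. Proof. by move: p12; lra. Qed.

Lemma blind_disj_ispan r1 r2 x : ~ rset r1 x -> ~ rset r2 x ->
  blind x (fun A => ind R (disj_occ (ispan r1) (ispan r2) A)).
Proof.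
move=> n1 n2 A; congr (ind R _); apply/propext; split; last first.
  by apply: disj_occS => // z; right.
case=> K1 [K2 [K1A K2A d [L1 s1 LK1] [L2 s2 LK2]]].
have sub r K L : ~ rset r x -> K `<=` x |` A -> spans L r -> [set` L] `<=` K ->
    [set` L] `<=` A.
  move=> nx KA sL LK z /= zL; have [zx|//] := KA z (LK z zL).
  by case: nx; rewrite -zx; exact: spans_sub zL.
exists [set` L1], [set` L2]; split; [exact: (sub _ _ _ n1 K1A s1 LK1)|exact: (sub _ _ _ n2 K2A s2 LK2)| |by exists L1|by exists L2].
by apply/seteqP; split=> // z [/LK1 z1 /LK2 z2]; rewrite -d.
Qed.

(* Private parts are pairwise disjoint, so their emptiness can be averaged out one
   line at a time, which leaves a function of the shared corner sites. *)
Lemma Ex_private_lines s (I : eqType) (r : seq I) (priv corn : I -> seq site)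
    (F : set site -> R) :
  uniq s -> uniq r ->
  (forall i, i \in r -> uniq (priv i) /\ {subset priv i <= s}) ->
  (forall i j x, i \in r -> j \in r -> i != j -> x \in priv i -> x \notin priv j) ->
  (forall i j x, i \in r -> j \in r -> x \in priv i -> x \notin corn j) ->
  (forall i x, i \in r -> x \in priv i -> blind x F) ->
  Ex p s (fun A => F A * \prod_(i <- r) ind R (hit (priv i ++ corn i) A)) =
  Ex p s (fun A => F A * \prod_(i <- r)
     (1 - (1 - p) ^+ size (priv i) * ind R (~ hit (corn i) A))).
Proof.
move=> us; elim: r F => [|i r IH] F; first by move=> *; apply: Ex_eq => A _; rewrite !big_nil.
move=> /= /andP[ir ur] hp hpp hpc hF.
have ini : i \in i :: r by rewrite mem_head.
have inr j : j \in r -> j \in i :: r by move=> jr; rewrite inE jr orbT.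
pose G A : R := \prod_(j <- r) ind R (hit (priv j ++ corn j) A).
pose z A : R := ind R (~ hit (corn i) A).
pose a A : R := ind R (~ hit (priv i) A).
have bz j x : j \in i :: r -> x \in priv j -> blind x z.
  by move=> jr xj A; rewrite /z hit_setU1 //; exact: hpc jr ini xj.
have bG x : x \in priv i -> blind x G.
  move=> xi; apply: blind_prod => j jr; apply: blind_ind_hit.
  rewrite mem_cat negb_or; apply/andP; split; last exact: hpc ini (inr _ jr) xi.
  apply: (hpp _ _ _ ini (inr _ jr)) => //.
  by apply: contraNneq ir => ->.
transitivity (Ex p s (fun A => F A * G A) - Ex p s (fun A => a A * (F A * z A * G A))).
  rewrite -ExB; apply: Ex_eq => A _; rewrite big_cons -/(G A).
  have -> : ind R (hit (priv i ++ corn i) A) = 1 - a A * z A.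
    rewrite /a /z -ind_and -ind_not; congr ind; apply/propext; split.
      move=> [x]; rewrite mem_cat => /orP[xp|xc] Ax [n1 n2]; first by apply: n1; exists x.
      by apply: n2; exists x.
    move=> nn; apply: contrapT => nh; apply: nn; split=> -[x xp Ax]; apply: nh;
      by exists x; rewrite // mem_cat xp ?orbT.
  ring.
rewrite (@Ex_mul _ p s a (fun A => F A * z A * G A)); last first.
  move=> x xs; have [xi|xi] := boolP (x \in priv i); last first.
    by left=> A; rewrite /a hit_setU1.
  right; apply: blindM; last exact: bG.
  by apply: blindM; [exact: hF xi|exact: bz xi].
have [ui si] := hp i ini.
rewrite (Ex_miss p us ui si) -ExZ -ExB.
set b := (1 - p) ^+ size (priv i).
transitivity (Ex p s (fun A => F A * (1 - b * z A) * G A)).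
  by apply: Ex_eq => A _; ring.
rewrite IH //; first by apply: Ex_eq => A _; rewrite big_cons mulrA.
- by move=> j jr; apply: hp; exact: inr.
- by move=> j k x jr kr; apply: hpp; exact: inr.
- by move=> j k x jr kr; apply: hpc; exact: inr.
- move=> j x jr xj A; rewrite (hF j) ?inr //; congr (_ * (1 - _ * _)).
  exact: (bz j x (inr _ jr) xj A).
Qed.

Lemma blind_fillable S r x : rset r x -> blind x (fun A => ind R (fillable S r A)).
Proof.
move=> rx A; congr (ind R _); apply/propext; rewrite /fillable.
by split=> h i il; have := h i il; rewrite hit_setU1 //; apply/negP => /(fillable_outside il).
Qed.

(* An occupied corner site serves one column and one row at once and thus gains at
   most a factor [1 / (a * b)] over private sites. *)
Lemma Ex_fillable s S r (a b : R) : uniq s -> {subset rsites S <= s} ->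
  valid r -> subr r S ->
  1 - (1 - p) ^+ len r.2 <= a -> 1 - (1 - p) ^+ len r.1 <= b ->
  0 < a <= 1 -> 0 < b <= 1 ->
  Ex p s (fun A => ind R (fillable S r A)) <=
  a ^+ (len S.1 - len r.1) * b ^+ (len S.2 - len r.2) *
  (1 + p / (a * b)) ^+ ((len S.1 - len r.1) * (len S.2 - len r.2)).
Proof.
have pp := p12; move=> us Ss vr rS ha hb a01 b01.
have a0 : 0 < a by lra.
have b0 : 0 < b by lra.
have [v1 v2] := andP vr; have [s1 s2] := andP rS.
have -> : Ex p s (fun A => ind R (fillable S r A)) =
   Ex p s (fun A => 1 * \prod_(i <- lines S r) ind R (hit (line_priv r i ++ line_corn S r i) A)).
  by apply: Ex_eq => A _; rewrite mul1r -ind_forall.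
rewrite Ex_private_lines //; first last.
- move=> [[] z] [[] w] x; rewrite !mem_line !mem_outside => /andP[zS zr] /andP[wS wr];
    move=> /andP[/eqP xz xr]; apply/negP => /andP[/eqP xw].
  + by rewrite xr andbF.
  + by move: wr; rewrite -xw xr.
  + by move: wr; rewrite -xw xr.
  + by rewrite xr andbF.
- move=> [[] z] [[] w] x; rewrite !mem_line !mem_outside => /andP[zS zr] /andP[wS wr] nzw;
    move=> /andP[/eqP xz xr]; apply/negP => /andP[/eqP xw h].
  + by move: nzw; rewrite -xz -xw eqxx.
  + by move: zr; rewrite -xz h.
  + by move: zr; rewrite -xz h.
  + by move: nzw; rewrite -xz -xw eqxx.
- move=> [[] z]; rewrite mem_line mem_outside => /andP[zS zr]; split.
  + by rewrite /line_priv map_inj_uniq ?irange_uniq // => ? ? [].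
  + move=> x; rewrite mem_line => /andP[/eqP xz xr]; apply: Ss; rewrite mem_rsites xz zS.
    by rewrite (between_sub1 s2 xr).
  + by rewrite /line_priv map_inj_uniq ?irange_uniq // => ? ? [].
  + move=> x; rewrite mem_line => /andP[/eqP xz xr]; apply: Ss; rewrite mem_rsites xz zS.
    by rewrite (between_sub1 s1 xr).
- rewrite cat_uniq !map_inj_uniq ?filter_uniq ?irange_uniq ?andbT //=;
    try by move=> ? ? [].
  by apply/hasPn => -[[] z] /mapP[y _ [//]] _; apply/negP => /mapP[w _ []].
pose C := outside S.1 r.1; pose W := outside S.2 r.2.
pose w (c : R) (A : set site) (x : site) : R := if `[< A x >] then c^-1 else 1.
(* Every occupied corner site carries a weight [c^-1 >= 1]. If the corner part is hit, one weight
   cancels the factor [c] and the others are at least 1; if not, all weights are 1. A site shared by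
   a column and a row then has weight [(a * b)^-1]. *)
have fac (l : seq site) (c : R) (k : nat) (A : set site) : 1 - (1 - p) ^+ k <= c -> 0 < c <= 1 ->
    0 <= 1 - (1 - p) ^+ k * ind R (~ hit l A) <= c * \prod_(x <- l) w c A x.
  move=> hc c01; have q0 : 0 <= (1 - p) ^+ k by apply: exprn_ge0; lra.
  have q1 : (1 - p) ^+ k <= 1 by apply: exprn_ile1; lra.
  have ci : 1 <= c^-1 by rewrite invf_ge1 //; lra.
  have [h|h] := pselect (hit l A); last first.
    rewrite (@ind_true _ (~ hit l A)) // mulr1 big_seq big1; first by rewrite mulr1; lra.
    by move=> x xl; rewrite /w asboolF // => Ax; apply: h; exists x.
  have nn : ~ ~ hit l A by move=> /(_ h).
  rewrite (@ind_false _ _ nn) mulr0 subr0 ler01 /=.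
  case: h => x xl Ax; rewrite (big_rem x) //= {1}/w asboolT // mulrA mulfV ?mul1r; last by rewrite gt_eqF //; lra.
  elim/big_ind: _ => [//|u v|y _]; first exact: mulr_ege1.
  by rewrite /w; case: asboolP.
apply: (@le_trans _ _ (Ex p s (fun A => a ^+ size C * b ^+ size W *
   \prod_(x <- [seq (x, y) | x <- C, y <- W]) w (a * b) A x))).
  apply: Ex_le => // A _; rewrite mul1r /lines big_cat !big_map /=.
  apply: (@le_trans _ _ ((\prod_(z <- C) (a * \prod_(x <- line_corn S r (true, z)) w a A x)) *
      (\prod_(z <- W) (b * \prod_(x <- line_corn S r (false, z)) w b A x)))).
    apply: ler_pM.
    - rewrite prodr_ge0 // => z _; have /andP[] := fac (line_corn S r (true, z)) a (len r.2) A ha a01.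
      by rewrite /line_priv /= size_map size_irange.
    - rewrite prodr_ge0 // => z _; have /andP[] := fac (line_corn S r (false, z)) b (len r.1) A hb b01.
      by rewrite /line_priv /= size_map size_irange.
    - apply: ler_prod => z _; have := fac (line_corn S r (true, z)) a (len r.2) A ha a01.
      by rewrite /line_priv /= size_map size_irange.
    - apply: ler_prod => z _; have := fac (line_corn S r (false, z)) b (len r.1) A hb b01.
      by rewrite /line_priv /= size_map size_irange.
  rewrite !big_split /= !big_const_seq !count_predT !iter_mulr !mulr1.
  rewrite mulrACA le_eqVlt; apply/orP; left; apply/eqP; congr (_ * _).
  rewrite big_allpairs /=.
  rewrite [X in _ * X](eq_bigr (fun z => \prod_(x <- C) w b A (x, z))); last first.
    by move=> z _; rewrite /line_corn /= big_map.
  rewrite exchange_big /= -big_split /=; apply: eq_bigr => x _.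
  rewrite /line_corn /= big_map -big_split /=; apply: eq_bigr => y _.
  by rewrite /w; case: asboolP => _; rewrite ?mulr1 // invfM.
rewrite ExZ Ex_prod; first last.
- move=> x y z _ _ _ yz; have [xy|xy] := eqVneq x y; [right|left]; last exact: blind_site.
  by apply: blind_site; rewrite xy.
- by apply: allpairs_uniq; rewrite ?filter_uniq ?irange_uniq // => -[? ?] [].
rewrite -/C -/W -(size_outside s1 v1) -(size_outside s2 v2) -/C -/W.
apply: ler_wpM2l; first by rewrite mulr_ge0 ?exprn_ge0 ?ltW.
rewrite big_seq (eq_bigr (fun=> (1 - p) * 1 + p * (a * b)^-1)); last first.
  move=> [x y] /allpairsP[[x' y'] /= [xC yW [-> ->]]]; apply: Ex_site => //.
  apply: Ss; rewrite mem_rsites /=.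
  by move: xC yW; rewrite !mem_outside => /andP[-> _] /andP[-> _].
rewrite -big_seq big_const_seq count_predT iter_mulr !mulr1 size_allpairs.
have ab : 0 < (a * b)^-1 by rewrite invr_gt0 mulr_gt0.
have pab : 0 < p * (a * b)^-1 by rewrite mulr_gt0 //; lra.
by apply: lerXn2r; rewrite ?nnegrE; lra.
Qed.

Lemma Ex_ispan_step s S n : uniq s -> {subset rsites S <= s} -> valid S ->
  (2 <= n < semiper S)%N ->
  Ex p s (fun A => ind R (ispan S A)) <=
  \sum_(r1 <- subrects S) \sum_(r2 <- subrects S |
     [&& touch r1 r2, valid r1, valid r2, subr (hull r1 r2) S,
       (n < semiper (hull r1 r2))%N, (semiper r1 <= n)%N & (semiper r2 <= n)%N])
    Ex p s (fun A => ind R (ispan r1 A)) * Ex p s (fun A => ind R (ispan r2 A)) *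
    Ex p s (fun A => ind R (fillable S (hull r1 r2) A)).
Proof.
have pp := p12; move=> us Ss vS nS.
pose good r1 r2 := [&& touch r1 r2, valid r1, valid r2, subr (hull r1 r2) S,
   (n < semiper (hull r1 r2))%N, (semiper r1 <= n)%N & (semiper r2 <= n)%N].
apply: (@le_trans _ _ (Ex p s (fun A => \sum_(r1 <- subrects S)
   \sum_(r2 <- [seq r2 <- subrects S | good r1 r2])
     ind R (disj_occ (ispan r1) (ispan r2) A) * ind R (fillable S (hull r1 r2) A)))).
  apply: Ex_le => // A _.
  have [sp|nsp] := pselect (ispan S A); last first.
    rewrite ind_false // sumr_ge0 // => r1 _; rewrite sumr_ge0 // => r2 _.
    by rewrite mulr_ge0 ?ind_ge0.
  rewrite ind_true //; case: (sp) => K sK KA.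
  have [K1 [K2 [r1 [r2 [[k1 k2] t [i1 i2 d] sb [g1 g2 g3]]]]]] := spans_split sK nS.
  have v1 := spans_valid k1; have v2 := spans_valid k2.
  have [sb1 sb2] := subr_hull sb.
  have m1 : r1 \in subrects S by exact: mem_subrects.
  have m2 : r2 \in [seq r2 <- subrects S | good r1 r2].
    by rewrite mem_filter mem_subrects // andbT /good t v1 v2 sb g1 g2 g3.
  rewrite (big_rem r1) //= (big_rem r2) //=.
  rewrite !ind_true ?mul1r; [|exact: ispan_fillable|].
    rewrite -addrA lerDl addr_ge0 // sumr_ge0 // => *; rewrite ?sumr_ge0 // => *;
      by rewrite ?mulr_ge0 ?ind_ge0.
  exists [set` K1], [set` K2]; split; [by move=> x /i1; exact: KA|by move=> x /i2; exact: KA| |by exists K1|by exists K2].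
  apply/seteqP; split=> // x /= [x1 x2].
  by move: d => /negP; apply; apply/hasP; exists x.
rewrite Ex_sum; apply: ler_sum => r1 _; rewrite Ex_sum big_filter.
apply: ler_sum => r2 /and5P[t v1 v2 sb _].
(* Spanning [r1] and [r2] reads only sites inside their hull, and [fillable] only sites outside
   it. *)
rewrite Ex_mul; last first.
  move=> x _; have [hx|hx] := pselect (rset (hull r1 r2) x); first by right; exact: blind_fillable.
  by left; apply: blind_disj_ispan => rx; apply: hx; apply: rset_hull; [left|right].
apply: ler_wpM2r; first by apply: Ex_ge0 => // A; exact: ind_ge0.
by apply: Ex_disj_occ; [lra|exact: us|exact: ispan_inc|exact: ispan_inc].
Qed.

(** A spanned rectangle has no empty column, and distinct columns share no site; likewise for
    rows. *)
Lemma Ex_ispan_crossing s S : uniq s -> {subset rsites S <= s} -> valid S ->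
  Ex p s (fun A => ind R (ispan S A)) <= (1 - (1 - p) ^+ len S.2) ^+ len S.1 /\
  Ex p s (fun A => ind R (ispan S A)) <= (1 - (1 - p) ^+ len S.1) ^+ len S.2.
Proof.
move=> us Ss vS; have [v1 v2] := andP vS; split.
- rewrite -(size_irange v1) -(size_irange v2).
  rewrite -[X in _ ^+ X](count_predT) -[X in _ <= X]mulr1 -iter_mulr -big_const_seq.
  pose l (x : int) : seq site := [seq (x, y) | y <- irange S.2].
  rewrite (eq_bigr (fun x => 1 - (1 - p) ^+ size (l x))); last by move=> *; rewrite size_map.
  rewrite -(Ex_hits (l := l) p us (irange_uniq S.1)); first last.
  + move=> x x' z _ _ xx' /mapP[y _ ->]; apply/negP => /mapP[y' _ [xE _]].
    by rewrite xE eqxx in xx'.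
  + move=> x xS; split; first by rewrite map_inj_uniq ?irange_uniq // => ? ? [].
    by move=> z /mapP[y yS ->]; apply: Ss; rewrite mem_rsites -!mem_irange xS.
  apply: Ex_le => // A _; apply: ind_le => -[K sK KA] x; rewrite mem_irange => xS.
  have [z zK zx] := spans_cols sK xS; exists z; last exact: KA.
  apply/mapP; exists z.2; last by rewrite -zx; case: (z).
  by rewrite mem_irange; case/andP: (spans_sub sK zK).
- rewrite -(size_irange v1) -(size_irange v2).
  rewrite -[X in _ ^+ X](count_predT) -[X in _ <= X]mulr1 -iter_mulr -big_const_seq.
  pose l (y : int) : seq site := [seq (x, y) | x <- irange S.1].
  rewrite (eq_bigr (fun x => 1 - (1 - p) ^+ size (l x))); last by move=> *; rewrite size_map.
  rewrite -(Ex_hits (l := l) p us (irange_uniq S.2)); first last.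
  + move=> x x' z _ _ xx' /mapP[y _ ->]; apply/negP => /mapP[y' _ [_ xE]].
    by rewrite xE eqxx in xx'.
  + move=> x xS; split; first by rewrite map_inj_uniq ?irange_uniq // => ? ? [].
    by move=> z /mapP[y yS ->]; apply: Ss; rewrite mem_rsites -!mem_irange xS yS.
  apply: Ex_le => // A _; apply: ind_le => -[K sK KA] x; rewrite mem_irange => xS.
  have [z zK zx] := spans_rows sK xS; exists z; last exact: KA.
  apply/mapP; exists z.1; last by rewrite -zx; case: (z).
  by rewrite mem_irange; case/andP: (spans_sub sK zK).
Qed.

End spanning_bounds.

Lemma len_gt0 r : valid r -> (0 < len r.1)%N /\ (0 < len r.2)%N.
Proof. by rect_lia. Qed.

Lemma len_subr r S : valid r -> subr r S -> (len r.1 <= len S.1)%N /\ (len r.2 <= len S.2)%N.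
Proof. by rect_lia. Qed.

Lemma len_hull1 i j : i.1 <= i.2 -> j.1 <= j.2 -> touch1 i j ->
  (len i <= len (hull1 i j) <= len i + len j)%N && (len j <= len (hull1 i j))%N.
Proof. by rect_lia. Qed.

Lemma valid_hull r1 r2 : valid r1 -> valid r2 -> valid (hull r1 r2).
Proof. by rect_lia. Qed.

Lemma subset_rsites r S (s : seq site) : subr r S -> {subset rsites S <= s} -> {subset rsites r <= s}.
Proof.
move=> /andP[s1 s2] Ss x; rewrite mem_rsites => /andP[x1 x2]; apply: Ss.
by rewrite mem_rsites (between_sub1 s1 x1) (between_sub1 s2 x2).
Qed.

(* Rectangles of semi-perimeter at most [2 * d] satisfy the bound by the crossing
   estimate; above that, each level of the induction replaces [S] by one of at most
   [M ^ 8] pairs of rectangles whose semi-perimeters are smaller by [d]. *)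
Lemma Ex_ispan_le (R : realType) (p : R) (h : nat -> R) (M d : nat) (s : seq site) l S :
  0 < p <= 1 / 2 -> (forall k, 0 <= h k) ->
  (forall k k', (k <= k')%N -> h k' <= h k) -> (0 < d)%N ->
  (forall m n, (0 < m)%N -> (0 < n)%N -> (m + n <= 2 * d)%N ->
     (1 - (1 - p) ^+ n) ^+ m <= expR (- ((m + n)%:R * h 0%N)) \/
     (1 - (1 - p) ^+ m) ^+ n <= expR (- ((m + n)%:R * h 0%N))) ->
  (forall m n c e, (0 < m <= M)%N -> (0 < n <= M)%N -> (c <= d)%N -> (e <= d)%N ->
     exists a b : R, [/\ 1 - (1 - p) ^+ n <= a, 1 - (1 - p) ^+ m <= b,
       0 < a <= 1, 0 < b <= 1 &
       a ^+ c * b ^+ e * (1 + p / (a * b)) ^+ (c * e) <=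
       expR (- (c%:R * h n + e%:R * h m))]) ->
  uniq s -> {subset rsites S <= s} -> valid S ->
  (longside S <= M)%N -> (semiper S <= l.+2 * d)%N ->
  Ex p s (fun A => ind R (ispan S A)) <=
  (M ^ 8)%:R ^+ (2 ^ l - 1) * expR (- path_cost h (len S.1) (len S.2)).
Proof.
move=> p12 h0 hle d0 base grow us; elim: l S => [|l IH] S Ss vS SM Sd.
  have [l1 l2] := len_gt0 vS.
  rewrite expn0 subnn expr0 mul1r.
  apply: (@le_trans _ _ (expR (- ((len S.1 + len S.2)%:R * h 0%N)))).
    have [e1 e2] := Ex_ispan_crossing p12 us Ss vS.
    by have [|/(le_trans e1)|/(le_trans e2)] := base (len S.1) (len S.2) l1 l2.
  by rewrite ler_expR lerN2; exact: path_cost_le.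
have [l1 l2] := len_gt0 vS.
have [M1 M2] : (len S.1 <= M)%N /\ (len S.2 <= M)%N.
  by move: SM; rewrite /longside geq_max => /andP[].
have M0 : (0 < M)%N by exact: leq_trans l1 M1.
have p01 : 0 <= p <= 1 by lra.
have M81 : 1 <= (M ^ 8)%:R :> R by rewrite ler1n expn_gt0 M0.
have M80 : 0 <= (M ^ 8)%:R :> R by rewrite ler0n.
have [small|big] := leqP (semiper S) (2 * d).
  have [e1 e2] := Ex_ispan_crossing p12 us Ss vS.
  apply: (@le_trans _ _ (expR (- ((len S.1 + len S.2)%:R * h 0%N)))).
    by have [|/(le_trans e1)|/(le_trans e2)] := base (len S.1) (len S.2) l1 l2.
  rewrite -[X in X <= _]mul1r; apply: ler_pM => //; rewrite ?expR_ge0 ?exprn_ege1 //.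
  by rewrite ler_expR lerN2; exact: path_cost_le.
(* Both children then have semi-perimeter at least [d] below that of [S], whereas their hull exceeds
   [n], so that fewer than [d] lines separate it from [S]. *)
pose n := (semiper S - d)%N.
have nS : (2 <= n < semiper S)%N by rewrite /n; move: big d0; clear; lia.
have nl : (n <= l.+2 * d)%N by rewrite /n; move: Sd; rewrite !mulSn; clear; lia.
apply: (le_trans (Ex_ispan_step p12 us Ss vS nS)).
set k := (2 ^ l - 1)%N in IH *.
pose c := expR (- path_cost h (len S.1) (len S.2)).
pose t := ((M ^ 8)%:R ^+ k) ^+ 2 * c : R.
have t0 : 0 <= t by rewrite mulr_ge0 ?exprn_ge0 ?expR_ge0.
apply: (@le_trans _ _ (\sum_(r1 <- subrects S) \sum_(r2 <- subrects S) t)).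
  apply: ler_sum => r1 _; rewrite big_mkcond /=; apply: ler_sum => r2 _.
  case: ifP => // /and5P[tt v1 v2 sb /and3P[g1 g2 g3]].
  have [sb1 sb2] := subr_hull sb.
  have vh := valid_hull v1 v2.
  have [w1 w2] := andP v1; have [w1' w2'] := andP v2; have [t1 t2] := andP tt.
  have /andP[a1 a2] := len_hull1 w1 w1' t1.
  have /andP[b1 b2] := len_hull1 w2 w2' t2.
  have [hm hn] := len_subr vh sb.
  have [hm0 hn0] := len_gt0 vh.
  set m' := len (hull r1 r2).1 in hm hm0 a1 a2 *.
  set n' := len (hull r1 r2).2 in hn hn0 b1 b2 *.
  have IHr r : valid r -> subr r S -> (semiper r <= n)%N ->
      Ex p s (fun A => ind R (ispan r A)) <=
      (M ^ 8)%:R ^+ k * expR (- path_cost h (len r.1) (len r.2)).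
    move=> vr rS rn; apply: IH => //; first exact: subset_rsites Ss.
      have [rl1 rl2] := len_subr vr rS.
      by rewrite /longside geq_max (leq_trans rl1) // (leq_trans rl2).
    exact: leq_trans rn nl.
  have e1 := IHr r1 v1 sb1 g2; have e2 := IHr r2 v2 sb2 g3.
  have g1' : (semiper S - d < m' + n')%N by [].
  have S' : semiper S = (len S.1 + len S.2)%N by [].
  have [||||a [b [ha hb a01 b01 fin]]] := grow m' n' (len S.1 - m')%N (len S.2 - n')%N.
  - by rewrite hm0 (leq_trans hm).
  - by rewrite hn0 (leq_trans hn).
  - by move: g1' big hm hn; rewrite S'; clear; lia.
  - by move: g1' big hm hn; rewrite S'; clear; lia.
  have e3 := le_trans (Ex_fillable p12 us Ss vh sb ha hb a01 b01) fin.
  have iE r : 0 <= Ex p s (fun A => ind R (ispan r A)).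
    by apply: Ex_ge0 => // A; exact: ind_ge0.
  have iF : 0 <= Ex p s (fun A => ind R (fillable S (hull r1 r2) A)).
    by apply: Ex_ge0 => // A; exact: ind_ge0.
  apply: (le_trans (ler_pM (mulr_ge0 (iE r1) (iE r2)) iF (ler_pM (iE r1) (iE r2) e1 e2) e3)).
  rewrite mulrACA -expr2 -mulrA /t ler_wpM2l ?exprn_ge0 // -!expRD ler_expR.
  have := path_cost_merge h0 hle a1 b1 a2 b2; rewrite -/m' -/n' => e4.
  have := path_cost_grow hle m' n' (len S.1 - m') (len S.2 - n').
  rewrite !subnKC // => e5; move: e4 e5; clear; lra.
rewrite !big_const_seq !count_predT !iter_addr !addr0 size_subrects //.
rewrite -mulrnA -(mulr_natl t) /t.
(* One factor [M ^ 8] counts the pairs [r1], [r2], with at most [M ^ 4] choices for each, and each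
   child contributes [k] more factors. *)
have -> : (2 ^ l.+1 - 1 = k.+1 + k)%N.
  have : (0 < 2 ^ l)%N by rewrite expn_gt0.
  by rewrite expnS /k; clear; lia.
have -> : (M ^ 8)%:R ^+ (k.+1 + k) = (M ^ 8)%:R * ((M ^ 8)%:R ^+ k) ^+ 2 :> R.
  by rewrite exprD (exprS _ k) expr2 mulrA.
rewrite -[X in _ <= X]mulrA -/c -/t; apply: ler_wpM2r => //.
by rewrite ler_nat (_ : 8 = 4 + 4)%N // expnD leq_mul // !expnS expn0 muln1 !mulnA !leq_mul.
Qed.

(** * Exponentials against powers, and the choice of constants *)

Section parameters.
Variable R : realType.
Implicit Types (p eps B : R).

(** The term of degree [N.+1] of the exponential series leaves one spare factor [1 / p], which
    absorbs the constants. *)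
Lemma poly_le_expR (C c : R) (N : nat) : 0 <= C -> 0 < c ->
  exists2 p0 : R, 0 < p0 & forall p, 0 < p < p0 -> C * p^-1 ^+ N <= expR (c / p).
Proof.
move=> C0 c0; exists (c ^+ N.+1 / (N.+1`!%:R * (C + 1))).
  by rewrite divr_gt0 ?exprn_gt0 ?mulr_gt0 ?ltr0n ?fact_gt0 //; lra.
move=> p /andP[p0]; have f0 : 0 < N.+1`!%:R :> R by rewrite ltr0n fact_gt0.
rewrite ltr_pdivlMr; last by rewrite mulr_gt0 //; lra.
move=> h; have cp : 0 <= c / p by rewrite divr_ge0 ?ltW.
have := expR_ge1Dxn N cp; apply: le_trans.
apply: (@le_trans _ _ ((c / p) ^+ N.+1 / N.+1`!%:R)); last by rewrite lerDr.
have -> : (c / p) ^+ N.+1 / N.+1`!%:R = c ^+ N.+1 / (N.+1`!%:R * p) * p^-1 ^+ N.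
  by rewrite exprMn [p^-1 ^+ N.+1]exprS invfM; ring.
apply: ler_wpM2r; first by rewrite exprn_ge0 // invr_ge0 ltW.
rewrite ler_pdivlMr ?mulr_gt0 //; apply/ltW; apply: le_lt_trans h.
rewrite mulrC -mulrA [p * _]mulrC -[X in _ <= X]mulrC -mulrA.
by apply: ler_wpM2l; [exact: ltW|rewrite ler_wpM2r ?ltW //; lra].
Qed.

End parameters.

Section upper_bound.
Variable R : realType.
Implicit Types (p eps B eta e : R).

(* The shift by [k0] keeps the cost of a step bounded near the origin without
   destroying convexity; the factor [1 - eta] absorbs the corner sites. *)
Definition step_cost p eta k0 (k : nat) : R := (1 - eta) * cost p (k + k0).

Lemma step_cost_ge0 p eta k0 k : 0 < p < 1 -> 0 < eta < 1 -> (0 < k0)%N ->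
  0 <= step_cost p eta k0 k.
Proof.
move=> p01 e01 k00; rewrite /step_cost mulr_ge0 ?cost_ge0 ?addn_gt0 ?k00 ?orbT //; lra.
Qed.

Lemma step_cost_le p eta k0 k k' : 0 < p < 1 -> 0 < eta < 1 -> (0 < k0)%N ->
  (k <= k')%N -> step_cost p eta k0 k' <= step_cost p eta k0 k.
Proof.
move=> p01 e01 k00 kk'; apply: ler_wpM2l; first by lra.
by apply: cost_le => //; rewrite leq_add2r kk' addn_gt0 k00 orbT.
Qed.

Lemma step_cost_convex p eta k0 k : 0 < p < 1 -> 0 < eta < 1 -> (0 < k0)%N ->
  step_cost p eta k0 k.+1 - step_cost p eta k0 k.+2 <=
  step_cost p eta k0 k - step_cost p eta k0 k.+1.
Proof.
move=> p01 e01 k00; rewrite /step_cost -!mulrBr; apply: ler_wpM2l; first by lra.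
by rewrite !addSn; apply: cost_convex; rewrite // addn_gt0 k00 orbT.
Qed.

(** The crossings contribute at most [expR (c * e * x)] with [x <= p / a0^2]. Since [e <= d], the
    assumption on [d * p] gives [e * x <= eta * c1], and [c1] bounds every occurring cost from
    below; so the share [eta] of the column costs pays for all crossings. *)
Lemma grow_le_expR p eta k0 M d (a0 c1 : R) m n c (e : nat) :
  0 < p < 1 -> 0 < eta < 1 -> (0 < k0)%N -> 0 < a0 -> a0 <= 1 - (1 - p) ^+ k0 ->
  c1 <= (1 - p) ^+ (M + k0) -> d%:R * p <= eta * c1 * a0 ^+ 2 ->
  (m <= M)%N -> (n <= M)%N -> (c <= d)%N -> (e <= d)%N ->
  (1 - (1 - p) ^+ (n + k0)) ^+ c * (1 - (1 - p) ^+ (m + k0)) ^+ e *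
  (1 + p / ((1 - (1 - p) ^+ (n + k0)) * (1 - (1 - p) ^+ (m + k0)))) ^+ (c * e) <=
  expR (- (c%:R * step_cost p eta k0 n + e%:R * step_cost p eta k0 m)).
Proof.
move=> p01 e01 k00 a00 a0k c1M dp mM nM cd ed.
set a := 1 - (1 - p) ^+ (n + k0); set b := 1 - (1 - p) ^+ (m + k0).
have p0 : 0 < p by lra.
have kpos j : (0 < j + k0)%N by rewrite addn_gt0 k00 orbT.
have age j : a0 <= 1 - (1 - p) ^+ (j + k0).
  apply: (le_trans a0k); rewrite lerD2l lerN2.
  by apply: ler_wiXn2l; [lra|lra|exact: leq_addl].
have an : a0 <= a by exact: age.
have bm : a0 <= b by exact: age.
have costlow j : (j <= M)%N -> c1 <= cost p (j + k0).
  move=> jM; apply: (le_trans c1M); apply: le_trans (cost_ge_pow p01 (kpos j)).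
  by apply: ler_wiXn2l; [lra|lra|rewrite leq_add2r].
have An := costlow n nM; have Bm := costlow m mM.
have aE : a = expR (- cost p (n + k0)) by rewrite expR_cost.
have bE : b = expR (- cost p (m + k0)) by rewrite expR_cost.
set x := p / (a * b).
have x0 : 0 <= x by rewrite divr_ge0 ?mulr_ge0 //; lra.
have xle : x <= p / a0 ^+ 2.
  rewrite /x ler_pM2l // lef_pV2 ?posrE ?mulr_gt0 ?exprn_gt0 //; try lra.
  by rewrite expr2; apply: ler_pM; lra.
have cex : (c * e)%:R * x <= c%:R * (eta * c1).
  rewrite natrM -mulrA ler_wpM2l ?ler0n //.
  apply: (@le_trans _ _ (d%:R * (p / a0 ^+ 2))).
    by apply: ler_pM; rewrite ?ler0n ?ler_nat.
  by rewrite mulrA ler_pdivrMr ?exprn_gt0.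
have pw : (1 + x) ^+ (c * e) <= expR ((c * e)%:R * x).
  rewrite expRM_natl; apply: lerXn2r; rewrite ?nnegrE ?expR_ge0 ?expR_ge1Dx //; lra.
rewrite {1}aE {1}bE -!expRM_natl -expRD.
apply: (le_trans (ler_wpM2l (expR_ge0 _) pw)); rewrite -expRD ler_expR /step_cost.
have c0 : 0 <= c%:R :> R by rewrite ler0n.
have e0 : 0 <= e%:R :> R by rewrite ler0n.
have Am0 : 0 <= cost p (m + k0) by apply: cost_ge0.
have h1 : c%:R * (eta * c1) <= c%:R * (eta * cost p (n + k0)).
  by rewrite ler_wpM2l // ler_wpM2l //; lra.
have h2 : 0 <= e%:R * (eta * cost p (m + k0)) by rewrite !mulr_ge0 //; lra.
move: h1 h2 cex; move: (cost p _) (cost p _) (c%:R : R) (e%:R : R) ((c * e)%:R : R).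
move=> v u c' e' ce' h1 h2 h3.
rewrite -subr_ge0.
have -> : - (c' * ((1 - eta) * u) + e' * ((1 - eta) * v)) - (c' * - u + e' * - v + ce' * x) =
  (c' * (eta * u) - c' * (eta * c1)) + (c' * (eta * c1) - ce' * x) + e' * (eta * v) by ring.
by apply: addr_ge0 => //; apply: addr_ge0; rewrite subr_ge0.
Qed.

(** The shorter side [n] is at most [d], so each of the [m] lines contributes at most [n p <= a0^2],
    while [a0 <= expR (- h0)]. The square matters because [2 m >= m + n]. *)
Lemma base_le_expR p eta k0 d (a0 : R) m n :
  0 < p < 1 -> 0 < eta < 1 -> (0 < k0)%N -> 0 < a0 -> a0 <= 1 - (1 - p) ^+ k0 ->
  d%:R * p <= a0 ^+ 2 -> (n <= m)%N -> (m + n <= 2 * d)%N ->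
  (1 - (1 - p) ^+ n) ^+ m <= expR (- ((m + n)%:R * step_cost p eta k0 0)).
Proof.
move=> p01 e01 k00 a00 a0k dp nm mn.
set h0 := step_cost p eta k0 0.
have h00 : 0 <= h0 by exact: step_cost_ge0.
have ch : a0 <= expR (- h0).
  apply: (le_trans a0k); rewrite -(expR_cost p01 k00) ler_expR lerN2 /h0 /step_cost add0n.
  by rewrite ler_piMl ?cost_ge0 //; lra.
rewrite -mulrN expRM_natl.
apply: (@le_trans _ _ ((a0 ^+ 2) ^+ m)).
  apply: lerXn2r; rewrite ?nnegrE ?exprn_ge0 //; first by rewrite subr_ge0 exprn_ile1; lra.
    by lra.
  apply: le_trans dp; apply: (@le_trans _ _ (n%:R * p)).
    by have := @pow_ge_linear _ n p; lra.
  by rewrite ler_pM2r ?ler_nat; [lia|lra].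
rewrite -exprM; apply: (@le_trans _ _ (expR (- h0) ^+ (2 * m))).
  by apply: lerXn2r => //; rewrite nnegrE ?expR_ge0 // ltW.
by apply: ler_wiXn2l; [exact: expR_ge0|rewrite expR_le1 oppr_le0|move: nm; clear; lia].
Qed.

Lemma ispan_le_path_cost eta e B : 0 < eta < 1 -> 0 < e -> 0 < B ->
  exists l, exists2 p0 : R, 0 < p0 & forall p s S, 0 < p < p0 ->
  uniq s -> {subset rsites S <= s} -> valid S -> (longside S)%:R <= B / p ->
  Ex p s (fun A => ind R (ispan S A)) <=
  ((Num.truncn (B / p)) ^ 8)%:R ^+ (2 ^ l - 1) *
  expR (- path_cost (step_cost p eta (Num.truncn (e / p)).+1) (len S.1) (len S.2)).
Proof.
move=> eta01 e0 B0.
pose a0 : R := 1 - expR (- e).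
have a00 : 0 < a0 by rewrite subr_gt0 expR_lt1; lra.
have a01 : a0 <= 1 by rewrite gerBl expR_ge0.
(* [a0] bounds [1 - (1 - p) ^+ k0] from below because [k0 p >= e], and [c1] bounds
   [(1 - p) ^+ (M + k0)] from below because [(M + k0) p <= B + e + p]. *)
pose c1 : R := expR (- (2 * (B + e + 1))).
have c10 : 0 < c1 by exact: expR_gt0.
have c11 : c1 <= 1 by rewrite expR_le1; lra.
pose delta := eta * c1 * a0 ^+ 2.
have a20 : 0 < a0 ^+ 2 by rewrite exprn_gt0.
have ec1 : eta * c1 <= 1 by apply: mulr_ile1; lra.
have del0 : 0 < delta by rewrite !mulr_gt0 //; lra.
have del1 : delta <= a0 ^+ 2 by rewrite /delta ler_piMl // ltW.
(* The semi-perimeter is at most [2 B / p], and [p < delta / 2] ensures that rounding leaves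
   [d >= delta / (2 p)]; the quotient [4 B / delta] of the two does not involve [p]. *)
exists (Num.truncn (4 * B / delta)), (Num.min (1 / 2) (delta / 2)).
  by rewrite lt_min !divr_gt0.
move=> p s S /andP[p0]; rewrite lt_min => /andP[pa pb] us Ss vS SB.
have p01 : 0 < p < 1 by lra.
set k0 := (Num.truncn (e / p)).+1; set M := Num.truncn (B / p).
set l := Num.truncn _.
pose d := Num.truncn (delta / p).
have k0e : e / p <= k0%:R by apply/ltW/truncnS_gt.
have k0e' : k0%:R <= e / p + 1.
  by rewrite /k0 -natr1 lerD2r truncn_le divr_ge0 ?ltW.
have MB : M%:R <= B / p by rewrite truncn_le divr_ge0 ?ltW.
have dd : d%:R <= delta / p by rewrite truncn_le divr_ge0 ?ltW.
have dd' : delta / (2 * p) <= d%:R.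
  have h : delta / p < d%:R + 1 by rewrite natr1; exact: truncnS_gt.
  have e2 : delta / (2 * p) = delta / p / 2 by field; lra.
  have h2 : 2 <= delta / p by rewrite ler_pdivlMr //; lra.
  lra.
have d0 : (0 < d)%N.
  by rewrite -(ltr0n R); apply: lt_le_trans dd'; apply: divr_gt0 => //; rewrite mulr_gt0.
have a0k : a0 <= 1 - (1 - p) ^+ k0.
  rewrite lerD2l lerN2; apply: (le_trans (pow_le_expR _ _)); first by lra.
  by rewrite ler_expR lerN2 -ler_pdivrMr.
have c1M : c1 <= (1 - p) ^+ (M + k0).
  apply: le_trans (pow_ge_expR _ _); last by lra.
  rewrite ler_expR lerN2 natrD.
  have hM : M%:R * p <= B by rewrite -ler_pdivlMr.
  have hk : k0%:R * p <= e + p.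
    rewrite -ler_pdivlMr //; apply: (le_trans k0e').
    by rewrite mulrDl divff ?gt_eqF.
  by nra.
have dp : d%:R * p <= delta by rewrite -ler_pdivlMr.
apply: (@Ex_ispan_le _ p (step_cost p eta k0) M d s l S) => //.
- by lra.
- by move=> k; apply: step_cost_ge0.
- by move=> k k' kk'; apply: step_cost_le.
- move=> m n m0 n0 mn; have [nm|mn'] := leqP n m.
    by left; apply: (base_le_expR (d := d) (a0 := a0)) => //; lra.
  right; rewrite addnC; apply: (base_le_expR (d := d) (a0 := a0)) => //; [lra|exact: ltnW|by rewrite addnC].
- move=> m n c f /andP[m0 mM] /andP[n0 nM] cd fd.
  have pk j : 0 < 1 - (1 - p) ^+ (j + k0) <= 1.
    have /andP[q1 q2] := @pow_itv _ p (j + k0) p01 ltac:(by rewrite addn_gt0 orbT).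
    by lra.
  exists (1 - (1 - p) ^+ (n + k0)), (1 - (1 - p) ^+ (m + k0)); split=> //.
  + rewrite lerD2l lerN2; apply: ler_wiXn2l; [lra|lra|exact: leq_addr].
  + rewrite lerD2l lerN2; apply: ler_wiXn2l; [lra|lra|exact: leq_addr].
  + by apply: (grow_le_expR (M := M) (d := d) (a0 := a0) (c1 := c1)).
- by rewrite truncn_ge_nat // divr_ge0 ?ltW.
- have : (semiper S <= 2 * longside S)%N by rewrite /semiper /longside; clear; lia.
  move/leq_trans; apply; rewrite -(ler_nat R) !natrM.
  apply: (@le_trans _ _ (2 * (B / p))); first by rewrite ler_pM2l.
  have lB : 4 * B / delta <= l.+2%:R.
    by apply: le_trans (ltW (truncnS_gt _)) _; rewrite ler_nat.
  have -> : 2 * (B / p) = 4 * B / delta * (delta / (2 * p)) by field; lra.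
  by apply: ler_pM => //; rewrite divr_ge0 ?mulr_ge0 ?ltW //; lra.
Qed.

End upper_bound.

(** * The exponential rate of spanning at scale [B / p] *)

Section upper_rate.
Variable R : realType.
Implicit Types (p eps B eta e : R).

Lemma lambda'_gt0 : 0 < lambda' R.
Proof. by rewrite /lambda' divr_gt0 // exprn_gt0 // pi_gt0. Qed.

(** Four losses of a factor [1 - tau] occur: from [eta], from the finite Basel sum, from the shift
    [k0] and from stopping at [K]. Bernoulli's inequality combines them. *)
Lemma sum_step_cost_ge p eta k0 J K tau : 0 < p < 1 -> 0 < tau < 1 ->
  eta = tau -> (1 - tau) * lambda' R <= basel R J ->
  J%:R * k0.+1%:R * p <= tau -> (1 - p) ^+ K <= tau ->
  (1 - 4 * tau) * lambda' R / p <= \sum_(0 <= k < K) step_cost p eta k0 k.+1.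
Proof.
move=> p01 t01 -> bJ Jk qK; rewrite /step_cost -big_distrr /=.
have p0 : 0 < p by lra.
have h := @sum_cost_ge _ p J K k0 p01 ltac:(lra).
have -> : \sum_(0 <= k < K) cost p (k.+1 + k0) = \sum_(0 <= k < K) cost p (k + k0).+1.
  by apply: eq_bigr => k _; rewrite addSn.
have t1 : 0 <= 1 - tau by lra.
apply: (@le_trans _ _ ((1 - tau) * (basel R J / p * (1 - tau) * (1 - tau)))); last first.
  apply: ler_wpM2l => //; apply: le_trans h; have b0 : 0 <= basel R J / p.
    by rewrite divr_ge0 ?(ltW p0) //; apply: le_trans bJ; rewrite mulr_ge0 ?(ltW lambda'_gt0).
  by apply: ler_pM; [exact: mulr_ge0|exact: t1|apply: ler_wpM2l => //; lra|lra].
rewrite [X in _ <= X](_ : _ = (1 - tau) ^+ 3 * basel R J / p); last by field; lra.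
rewrite ler_pM2r ?invr_gt0 //.
apply: (@le_trans _ _ ((1 - tau) ^+ 3 * ((1 - tau) * lambda' R))); last first.
  by apply: ler_wpM2l => //; rewrite exprn_ge0.
rewrite [X in _ <= X]mulrA ler_pM2r ?lambda'_gt0 // -exprSr.
by have := @bernoulli_ge _ 4 (- tau); rewrite mulrN => -> //; lra.
Qed.

Lemma path_cost_ge eps : 0 < eps -> exists eta e B0 p0 : R,
  [/\ 0 < eta < 1, 0 < e, 0 < B0, 0 < p0 & forall p m n, 0 < p < p0 ->
  B0 / p <= (maxn m n)%:R ->
  (2 * lambda' R - eps) / p <=
  path_cost (step_cost p eta (Num.truncn (e / p)).+1) m n].
Proof.
move=> eps0; have l0 := lambda'_gt0.
(* The relative loss [4 tau] on the total [2 lambda' / p] must stay below [eps / p]. *)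
pose tau := Num.min (1 / 2) (eps / (8 * lambda' R)).
have t0 : 0 < tau by rewrite lt_min !divr_gt0 // mulr_gt0.
have t12 : tau <= 1 / 2 by rewrite ge_min lexx.
have tl : tau * (8 * lambda' R) <= eps.
  have : tau <= eps / (8 * lambda' R) by rewrite ge_min lexx orbT.
  by rewrite ler_pdivlMr // mulr_gt0.
have [J bJ] := @basel_approx R (tau * lambda' R) ltac:(by rewrite mulr_gt0).
pose J1 : R := J.+1%:R; have J10 : 0 < J1 by rewrite ltr0n.
have JJ : J%:R <= J1 by rewrite ler_nat.
pose e := tau / (2 * J1); have e0 : 0 < e by rewrite divr_gt0 // mulr_gt0.
(* With [K p >= A0], one gets [(1 - p) ^+ K <= expR (- A0) <= 1 / A0 = tau]. *)
pose A0 := tau^-1; have A00 : 0 < A0 by rewrite invr_gt0.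
pose c0 : R := expR (- (2 * (A0 + e + 2))) / 2.
have c00 : 0 < c0 by rewrite divr_gt0 // expR_gt0.
exists tau, e, (A0 + 1 + 2 * lambda' R / c0), (Num.min (1 / 2) (tau / (4 * J1))); split.
- by lra.
- exact: e0.
- have : 0 < 2 * lambda' R / c0 by rewrite divr_gt0 // mulr_gt0.
  by lra.
- by rewrite lt_min !divr_gt0 // mulr_gt0.
move=> p m n /andP[p0]; rewrite lt_min => /andP[p12 pJ] Bmn.
have p01 : 0 < p < 1 by lra.
have t01 : 0 < tau < 1 by lra.
set k0 := (Num.truncn (e / p)).+1.
have k00 : (0 < k0)%N by [].
have k0e' : k0%:R <= e / p + 1.
  by rewrite /k0 -natr1 lerD2r truncn_le divr_ge0 ?ltW.
pose K := (Num.truncn (A0 / p)).+1.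
have KA : A0 / p <= K%:R by apply/ltW/truncnS_gt.
have KA' : K%:R <= A0 / p + 1.
  by rewrite /K -natr1 lerD2r truncn_le divr_ge0 ?ltW.
have k0p : k0%:R * p <= e + p.
  rewrite -ler_pdivlMr //; apply: (le_trans k0e').
  by rewrite mulrDl divff ?gt_eqF.
have Kp : K%:R * p <= A0 + p.
  rewrite -ler_pdivlMr //; apply: (le_trans KA').
  by rewrite mulrDl divff ?gt_eqF.
pose h := step_cost p tau k0; rewrite -/h.
have h0 k : 0 <= h k by exact: step_cost_ge0.
have hle k k' : (k <= k')%N -> h k' <= h k by exact: step_cost_le.
have hcv k : h k.+1 - h k.+2 <= h k - h k.+1 by exact: step_cost_convex.
apply: le_trans (diag_cost_le hcv m n).
set a := minn m n; set b := maxn m n in Bmn *.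
(* Either the diagonal part is long enough to pay alone, or the rectangle is thin: then its straight
   part has at least [2 lambda' / (c0 p)] steps, each costing at least [c0]. *)
have [Ka|aK] := leqP K a.
  have ge : (1 - 4 * tau) * lambda' R / p <= \sum_(0 <= k < K) h k.+1.
    apply: (sum_step_cost_ge (J := J)) => //.
    - by move: bJ; rewrite mulrBl mul1r.
    - rewrite -mulrA -natr1 mulrDl mul1r.
      have h1 : J1 * e = tau / 2 by rewrite /e; field; lra.
      have h2 : J1 * p <= tau / 4.
        by move: pJ; rewrite ltr_pdivlMr ?mulr_gt0 //; lra.
      apply: (@le_trans _ _ (J1 * (e + p + p))); last by lra.
      have kp0 : 0 <= k0%:R * p by rewrite mulr_ge0 // ltW.
      by apply: ler_pM; [exact: ler0n|lra|exact: JJ|lra].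
    - apply: (le_trans (pow_le_expR _ _)); first by lra.
      have A0K : A0 <= K%:R * p by rewrite -ler_pdivrMr.
      apply: (@le_trans _ _ (expR (- A0))); first by rewrite ler_expR lerN2.
      rewrite expRN -[X in _ <= X]invrK lef_pV2 ?posrE ?expR_gt0 //.
      by apply: le_trans (expR_ge1Dx _); rewrite lerDr.
  have -> : (2 * lambda' R - eps) / p = 2 * ((1 - 4 * tau) * lambda' R / p) -
      (eps - tau * (8 * lambda' R)) / p by field; lra.
  have : 0 <= (eps - tau * (8 * lambda' R)) / p by apply: divr_ge0; [rewrite subr_ge0|exact: ltW].
  have : \sum_(0 <= k < K) h k.+1 *+ 2 <= diag_cost h a b.
    rewrite /diag_cost [X in _ <= X + _](big_cat_nat (n := K)) //=.
    have r1 : 0 <= \sum_(K <= k < a) (h k + h k.+1) by rewrite sumr_ge0 // => *; rewrite addr_ge0.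
    have r2 : 0 <= (b - a)%:R * h a by rewrite mulr_ge0.
    have : \sum_(0 <= k < K) h k.+1 *+ 2 <= \sum_(0 <= k < K) (h k + h k.+1).
      by apply: ler_sum => k _; rewrite mulr2n lerD2r hle.
    lra.
  rewrite sumrMnl mulr2n; lra.
have pK : K%:R * p + k0%:R * p <= A0 + e + 1 by lra.
have hK : c0 <= h a.
  apply: (@le_trans _ _ (h K)); last exact/hle/ltnW.
  rewrite /h /step_cost /c0 mulrC; apply: ler_pM; rewrite ?expR_ge0 //; try lra.
  apply: le_trans (cost_ge_pow p01 _); last by rewrite addn_gt0 orbT.
  apply: le_trans (pow_ge_expR _ _); last by lra.
  by rewrite ler_expR lerN2 natrD; lra.
have aK' : a%:R <= K%:R :> R by rewrite ler_nat ltnW.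
have ba : 2 * lambda' R / c0 / p <= (b - a)%:R.
  have ab : (a <= b)%N by rewrite /a /b; clear; lia.
  rewrite natrB //.
  have e1 : (A0 + 1 + 2 * lambda' R / c0) / p = A0 / p + 1 / p + 2 * lambda' R / c0 / p.
    by rewrite -!mulrDl.
  have e2 : 1 <= 1 / p by rewrite ler_pdivlMr //; lra.
  by move: Bmn; rewrite e1; lra.
have s0 : 0 <= \sum_(0 <= k < a) (h k + h k.+1) by rewrite sumr_ge0 // => *; rewrite addr_ge0.
rewrite /diag_cost; apply: (@le_trans _ _ ((b - a)%:R * h a)); last by rewrite lerDr.
apply: (@le_trans _ _ (2 * lambda' R / c0 / p * c0)); last first.
  apply: ler_pM => //; last by lra.
  by apply: divr_ge0; [apply: divr_ge0; [lra|exact: ltW]|exact: ltW].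
have -> : 2 * lambda' R / c0 / p * c0 = 2 * lambda' R / p by field; lra.
by rewrite ler_pM2r ?invr_gt0 //; lra.
Qed.

(** Half of [eps] is lost in the path cost and half in the counting factor. The window down to
    [B / (4 p)] leaves room for rounding and for the factor 2 lost in extracting a rectangle of
    intermediate size. *)
Lemma ispan_upper eps : 0 < eps -> exists2 B0 : R, 0 < B0 & forall B, B0 <= B ->
  exists2 p0 : R, 0 < p0 & forall p s S, 0 < p < p0 ->
  uniq s -> {subset rsites S <= s} -> valid S ->
  B / (4 * p) <= (longside S)%:R <= B / p ->
  Ex p s (fun A => ind R (ispan S A)) <= expR (- ((2 * lambda' R - eps) / p)).
Proof.
move=> eps0.
have [eta [e [B1 [p1 [eta01 e0 B10 p10 pc]]]]] := @path_cost_ge (eps / 2) ltac:(lra).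
exists (4 * B1); first by lra.
move=> B BB.
have B0 : 0 < B by lra.
have [l [p2 p20 up]] := ispan_le_path_cost eta01 e0 B0.
pose N := (8 * (2 ^ l - 1))%N.
have [p3 p30 poly] := @poly_le_expR R (B ^+ N) (eps / 2) N ltac:(by rewrite exprn_ge0 ?ltW) ltac:(lra).
exists (Num.min p1 (Num.min p2 p3)); first by rewrite !lt_min p10 p20 p30.
move=> p s S /andP[p0]; rewrite !lt_min => /and3P[pp1 pp2 pp3] us Ss vS /andP[S1 S2].
apply: (le_trans (up p s S _ us Ss vS S2)); first by rewrite p0.
have h1 : ((Num.truncn (B / p)) ^ 8)%:R ^+ (2 ^ l - 1) <= expR (eps / 2 / p).
  apply: le_trans (poly p _); last by rewrite p0.
  rewrite natrX -exprM -/N -exprMn; apply: lerXn2r; rewrite ?nnegrE ?ler0n ?truncn_le ?divr_ge0 ?(ltW B0) ?(ltW p0) //.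
have h2 := pc p (len S.1) (len S.2).
apply: (@le_trans _ _ (expR (eps / 2 / p) * expR (- ((2 * lambda' R - eps / 2) / p)))).
  apply: ler_pM; [by rewrite exprn_ge0 // ler0n|exact: expR_ge0|exact: h1|].
  rewrite ler_expR lerN2; apply: h2; first by rewrite p0.
  apply: le_trans S1; rewrite ler_pdivlMr ?mulr_gt0 //.
  by rewrite (_ : B1 / p * (4 * p) = 4 * B1) //; field; lra.
rewrite -expRD ler_expR le_eqVlt; apply/orP; left; apply/eqP; field; lra.
Qed.

End upper_rate.

(** * Seeds *)

(* [(true, k)] indexes the column and [(false, k)] the row that extend the
   [k] x [k] square with corner [(a, c)]; index [0] is the corner site itself. *)
Definition seed_line (a c : int) (i : bool * nat) : seq site :=
  if i.2 == 0%N then [:: (a, c)]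
  else if i.1 then [seq (a + i.2%:Z, c + j%:Z) | j <- iota 0 i.2]
  else [seq (a + j%:Z, c + i.2%:Z) | j <- iota 0 i.2].

Definition seed_index (m : nat) : seq (bool * nat) :=
  (true, 0%N) :: ([seq (true, k) | k <- iota 1 m] ++ [seq (false, k) | k <- iota 1 m]).

Lemma mem_seed_line a c i x : (x \in seed_line a c i) =
  if i.2 == 0%N then (x.1 == a) && (x.2 == c)
  else if i.1 then (x.1 == a + i.2%:Z) && (c <= x.2 < c + i.2%:Z)
  else (x.2 == c + i.2%:Z) && (a <= x.1 < a + i.2%:Z).
Proof.
case: x i => [x y] [b k]; rewrite /seed_line /=; case: ifP => _.
  by rewrite inE xpair_eqE.
case: b; apply/mapP/idP.
- by case=> j; rewrite mem_iota => jk [-> ->]; lia.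
- by move=> h; exists (absz (y - c)); rewrite ?mem_iota; [lia|congr (_, _); lia].
- by case=> j; rewrite mem_iota => jk [-> ->]; lia.
- by move=> h; exists (absz (x - a)); rewrite ?mem_iota; [lia|congr (_, _); lia].
Qed.

Lemma mem_seed_index m i : (i \in seed_index m) =
  (i == (true, 0%N)) || (0 < i.2 <= m)%N.
Proof.
case: i => b k; rewrite inE mem_cat /=; congr (_ || _); case: b.
  rewrite mem_map; last by move=> ? ? [].
  rewrite mem_iota add1n ltnS; case: (X in _ || X) / mapP => [[? _ []]|_] //.
  by rewrite orbF.
rewrite [X in _ || X]mem_map; last by move=> ? ? [].
by rewrite mem_iota add1n ltnS; case: (X in X || _) / mapP => [[? _ []]|_].
Qed.

Lemma seed_index_uniq m : uniq (seed_index m).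
Proof.
rewrite /= mem_cat cat_uniq !map_inj_uniq ?iota_uniq /= ?andbT; try by move=> ? ? [].
apply/andP; split.
  rewrite negb_or; apply/andP; split; apply/mapP => -[k]; rewrite mem_iota => // h [kE].
  by rewrite -kE in h.
by apply/hasPn => i /mapP[k _ ->]; apply/mapP => -[? _ []].
Qed.

Lemma seedP (A : set site) m a c : (0 < m)%N ->
  seed A m a c <-> forall i, i \in seed_index m.-1 -> hit (seed_line a c i) A.
Proof.
move=> m0; split=> [[A0 h] [b k]|h].
  rewrite mem_seed_index => /orP[/eqP[-> ->]|/= k0].
    by exists (a, c); rewrite // mem_seed_line /= !eqxx.
  have kn : (k == 0%N) = false by lia.
  have [[y yk Ay] [x xk Ax]] := h k ltac:(lia).
  by case: b; [exists (a + k%:Z, y)|exists (x, c + k%:Z)] => //;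
    rewrite mem_seed_line /= kn eqxx.
split.
  have [|[x y]] := h (true, 0%N); first by rewrite mem_seed_index.
  by rewrite mem_seed_line /= => /andP[/eqP -> /eqP ->].
move=> k km; have kn : (k == 0%N) = false by lia.
split.
  have [|[x y]] := h (true, k); first by rewrite mem_seed_index /=; lia.
  rewrite mem_seed_line /= kn => xy Axy; exists y; first by lia.
  by have <- : x = a + k%:Z by lia.
have [|[x y]] := h (false, k); first by rewrite mem_seed_index /=; lia.
rewrite mem_seed_line /= kn => xy Axy; exists x; first by lia.
by have <- : y = c + k%:Z by lia.
Qed.

Lemma seed_line_sub m a c i x : (0 < m)%N -> i \in seed_index m.-1 ->
  x \in seed_line a c i -> rset (rsquare m a c) x.
Proof.
case: i x => [b k] [x y]; rewrite mem_seed_index mem_seed_line /= xpair_eqE.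
by case: (k =P 0%N) => [->|k0]; case: b; rewrite /rsquare /=; rect_lia.
Qed.

Section lower_bound.
Variable R : realType.
Implicit Types (p : R) (s : seq site).

Lemma blind_seed m a c x : (0 < m)%N -> ~ rset (rsquare m a c) x ->
  blind x (fun A => ind R (seed A m a c)).
Proof.
move=> m0 nx A; congr (ind R _); apply/propext; rewrite !seedP //.
split=> h i il; have := h i il; rewrite hit_setU1 //;
  by apply/negP => /(seed_line_sub m0 il).
Qed.

Definition seed_prob p : R := p * expR (- (2 * lambda' R / p)).

Lemma Ex_seed_ge p s m a c : 0 < p < 1 -> uniq s -> (0 < m)%N ->
  {subset rsites (rsquare m a c) <= s} ->
  seed_prob p <= Ex p s (fun A => ind R (seed A m a c)).
Proof.
move=> p01 us m0 ms.
rewrite (@Ex_eq _ p s _ (fun A => ind R (forall i, i \in seed_index m.-1 -> hit (seed_line a c i) A))); last first.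
  by move=> A _; congr (ind R _); apply/propext; exact: seedP.
rewrite Ex_hits ?seed_index_uniq //; first last.
- move=> [b k] [b' k'] [x y]; rewrite !mem_seed_index !mem_seed_line /= !xpair_eqE.
  by case: b; case: b'; case: (k =P 0%N) => [->|]; case: (k' =P 0%N) => [->|] /=; lia.
- move=> i ir; split; last first.
    by move=> x xi; apply: ms; rewrite mem_rsites; exact: seed_line_sub xi.
  rewrite /seed_line; case: ifP => // _; case: ifP => _; rewrite map_inj_uniq ?iota_uniq //.
    by move=> j k [] /addrI[].
  by move=> j k [] /addrI[].
rewrite big_cons /= expr1 big_cat !big_map /=.
have -> : 1 - (1 - p) = p by ring.
rewrite /seed_prob; apply: ler_wpM2l; first by lra.
have sz (b : bool) : \prod_(k <- iota 1 m.-1) (1 - (1 - p) ^+ size (seed_line a c (b, k))) =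
    expR (- \sum_(0 <= k < m.-1) cost p k.+1).
  rewrite -sumrN expR_sum /index_iota subn0 -(addn0 1%N) iotaDl big_map.
  rewrite big_seq [RHS]big_seq; apply: eq_bigr => k _.
  rewrite expR_cost // add1n /seed_line /=.
  by case: b; rewrite /= size_map size_iota.
rewrite !sz -expRD ler_expR -opprD lerN2.
have h := @sum_cost_le _ p m.-1 p01.
have -> : 2 * lambda' R / p = lambda' R / p + lambda' R / p by rewrite -mulrDl; congr (_ / _); ring.
exact: lerD.
Qed.

Lemma seed_prob_le1 p : 0 < p < 1 -> 0 <= seed_prob p <= 1.
Proof.
move=> p01; rewrite /seed_prob mulr_ge0 ?expR_ge0 //=; last by lra.
have := @expR_le1 R (- (2 * lambda' R / p)).
have -> : (- (2 * lambda' R / p) <= 0).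
  rewrite oppr_le0 divr_ge0 ?mulr_ge0 ?divr_ge0 ?exprn_ge0 ?pi_ge0 //; lra.
have := expR_ge0 (- (2 * lambda' R / p)); move=> h1 h2.
by apply: mulr_ile1 => //; lra.
Qed.

Definition tile m (a : int) (i : nat * nat) (A : set site) : Prop :=
  seed A m (a + (i.1 * m)%:Z) (a + (i.2 * m)%:Z).

Definition tiles w : seq (nat * nat) := [seq (i, j) | i <- iota 0 w, j <- iota 0 w].

Lemma mem_tiles w i : (i \in tiles w) = (i.1 < w)%N && (i.2 < w)%N.
Proof.
case: i => i j; apply/allpairsP/idP => [[[x y] /= [+ + [-> ->]]]|/= /andP[iw jw]].
  by rewrite !mem_iota /= !add0n => xw yw; rewrite xw yw.
by exists (i, j); rewrite !mem_iota.
Qed.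

Lemma tiles_uniq w : uniq (tiles w).
Proof. by apply: allpairs_uniq; rewrite ?iota_uniq // => -[? ?] []. Qed.

Lemma tile_subr m l w (a : int) i : (w * m <= l)%N -> i \in tiles w ->
  (0 < m)%N ->
  subr (rsquare m (a + (i.1 * m)%:Z) (a + (i.2 * m)%:Z)) (rsquare l a a).
Proof.
rewrite mem_tiles => wl /andP[i1 i2] m0.
have h1 : (i.1.+1 * m <= l)%N by apply: leq_trans wl; rewrite leq_mul2r i1 orbT.
have h2 : (i.2.+1 * m <= l)%N by apply: leq_trans wl; rewrite leq_mul2r i2 orbT.
move: h1 h2; rewrite !mulSn /rsquare; rect_lia.
Qed.

Lemma tile_disjoint m (a : int) (i j : nat * nat) x : (0 < m)%N ->
  rset (rsquare m (a + (i.1 * m)%:Z) (a + (i.2 * m)%:Z)) x ->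
  rset (rsquare m (a + (j.1 * m)%:Z) (a + (j.2 * m)%:Z)) x -> i = j.
Proof.
have aux (u v : nat) (z : int) : (0 < m)%N -> a + (u * m)%:Z <= z < a + (u * m)%:Z + m%:Z ->
    a + (v * m)%:Z <= z < a + (v * m)%:Z + m%:Z -> (u <= v)%N.
  move=> m0 h1 h2; rewrite leqNgt; apply/negP => vu.
  have : (v.+1 * m <= u * m)%N by rewrite leq_mul2r vu orbT.
  by rewrite mulSn; lia.
move=> m0 hi hj.
have hx : i.1 = j.1.
  apply/eqP; rewrite eqn_leq; apply/andP; split; apply: (aux _ _ x.1) => //;
    by move: hi hj; rewrite /rsquare; rect_lia.
have hy : i.2 = j.2.
  apply/eqP; rewrite eqn_leq; apply/andP; split; apply: (aux _ _ x.2) => //;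
    by move: hi hj; rewrite /rsquare; rect_lia.
by case: i j hx hy {hi hj} => [? ?] [? ?] /= -> ->.
Qed.

Lemma Ex_no_tile p s m l w (a : int) : 0 < p < 1 -> uniq s -> (0 < m)%N ->
  (w * m <= l)%N -> {subset rsites (rsquare l a a) <= s} ->
  Ex p s (fun A => ind R (forall i, i \in tiles w -> ~ tile m a i A)) <=
  (1 - seed_prob p) ^+ (w * w).
Proof.
move=> p01 us m0 wl ls.
rewrite (@Ex_eq _ p s _ (fun A => \prod_(i <- tiles w) (1 - ind R (tile m a i A)))); last first.
  by move=> A _; rewrite ind_forall; apply: eq_bigr => i _; rewrite ind_not.
rewrite Ex_prod ?tiles_uniq //; last first.
  move=> x i j _ _ _ ij.
  have [hx|hx] := pselect (rset (rsquare m (a + (i.1 * m)%:Z) (a + (i.2 * m)%:Z)) x);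
      [right|left] => A; congr (1 - _); apply: (blind_seed m0) => //.
  by move=> hx'; rewrite (tile_disjoint m0 hx hx') eqxx in ij.
have -> : (w * w = size (tiles w))%N by rewrite size_allpairs size_iota.
rewrite -[X in _ ^+ X]count_predT -[X in _ <= X]mulr1 -iter_mulr -big_const_seq.
rewrite big_seq [X in _ <= X]big_seq; apply: ler_prod => i iw.
have sub : {subset rsites (rsquare m (a + (i.1 * m)%:Z) (a + (i.2 * m)%:Z)) <= s}.
  move=> x; rewrite mem_rsites => /andP[x1 x2]; apply: ls; rewrite mem_rsites.
  by have /andP[s1 s2] := tile_subr a wl iw m0; rewrite (between_sub1 s1 x1) (between_sub1 s2 x2).
rewrite ExB Ex_cst; have h := Ex_seed_ge p01 us m0 sub.
have h1 : Ex p s (fun A => ind R (tile m a i A)) <= 1.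
  by apply: Ex_le1 => [|A]; [lra|exact: ind_le1].
by rewrite subr_ge0 h1 lerD2l lerN2.
Qed.

Lemma Ex_no_column_segments p s m l (a : int) : 0 < p < 1 -> uniq s -> (0 < m)%N ->
  {subset rsites (rsquare l a a) <= s} ->
  Ex p s (fun A => ind R (~ column_segments A (rsquare l a a) m)) <=
  (l * l)%:R * (1 - p) ^+ m.
Proof.
move=> p01 us m0 ls.
pose g (i : nat * nat) : seq site := [seq (a + i.1%:Z, a + (i.2 + j)%:Z) | j <- iota 0 m].
pose r := [seq i <- tiles l | (i.2 + m <= l)%N].
apply: (@le_trans _ _ (Ex p s (fun A => \sum_(i <- r) ind R (~ hit (g i) A)))).
  apply: Ex_le => [|A _]; first by lra.
  apply: le_trans (ind_ex _ _ _); apply: ind_le => nc; apply: contrapT => ne; apply: nc.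
  move=> x y xl yl yml; apply: contrapT => nh; apply: ne.
  exists (absz (x - a), absz (y - a)).
    by rewrite mem_filter mem_tiles; move: xl yl yml m0; rewrite /rsquare; rect_lia.
  case=> z /mapP[j]; rewrite mem_iota => jm ->; apply: contra_not nh => Az.
  exists (y + j%:Z); first by lia.
  by move: Az; congr A; congr (_, _); move: xl yl; rewrite /rsquare; rect_lia.
rewrite Ex_sum (@le_trans _ _ (\sum_(i <- r) (1 - p) ^+ m)) //.
  rewrite big_seq [X in _ <= X]big_seq; apply: ler_sum => i.
  rewrite mem_filter mem_tiles => ir; rewrite Ex_miss ?size_map ?size_iota //.
    rewrite map_inj_uniq ?iota_uniq // => j k [] /addrI[] /eqP.
    by rewrite eqn_add2l => /eqP.
  move=> z /mapP[j]; rewrite mem_iota => jm ->; apply: ls; rewrite mem_rsites.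
  by move: ir jm; rewrite /rsquare; rect_lia.
rewrite big_const_seq count_predT iter_addr addr0 -(mulr_natl ((1 - p) ^+ m)).
apply: ler_wpM2r; first by rewrite exprn_ge0; lra.
rewrite ler_nat (leq_trans (size_subseq (filter_subseq _ _))) //.
by rewrite size_allpairs size_iota.
Qed.

Lemma Ex_no_row_segments p s m l (a : int) : 0 < p < 1 -> uniq s -> (0 < m)%N ->
  {subset rsites (rsquare l a a) <= s} ->
  Ex p s (fun A => ind R (~ row_segments A (rsquare l a a) m)) <=
  (l * l)%:R * (1 - p) ^+ m.
Proof.
move=> p01 us m0 ls.
pose g (i : nat * nat) : seq site := [seq (a + (i.2 + j)%:Z, a + i.1%:Z) | j <- iota 0 m].
pose r := [seq i <- tiles l | (i.2 + m <= l)%N].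
apply: (@le_trans _ _ (Ex p s (fun A => \sum_(i <- r) ind R (~ hit (g i) A)))).
  apply: Ex_le => [|A _]; first by lra.
  apply: le_trans (ind_ex _ _ _); apply: ind_le => nc; apply: contrapT => ne; apply: nc.
  move=> x y yl xl xml; apply: contrapT => nh; apply: ne.
  exists (absz (y - a), absz (x - a)).
    by rewrite mem_filter mem_tiles; move: xl yl xml m0; rewrite /rsquare; rect_lia.
  case=> z /mapP[j]; rewrite mem_iota => jm ->; apply: contra_not nh => Az.
  exists (x + j%:Z); first by lia.
  by move: Az; congr A; congr (_, _); move: xl yl; rewrite /rsquare; rect_lia.
rewrite Ex_sum (@le_trans _ _ (\sum_(i <- r) (1 - p) ^+ m)) //.
  rewrite big_seq [X in _ <= X]big_seq; apply: ler_sum => i.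
  rewrite mem_filter mem_tiles => ir; rewrite Ex_miss ?size_map ?size_iota //.
    rewrite map_inj_uniq ?iota_uniq // => j k [] /addrI[] /eqP.
    by rewrite eqn_add2l => /eqP.
  move=> z /mapP[j]; rewrite mem_iota => jm ->; apply: ls; rewrite mem_rsites.
  by move: ir jm; rewrite /rsquare; rect_lia.
rewrite big_const_seq count_predT iter_addr addr0 -(mulr_natl ((1 - p) ^+ m)).
apply: ler_wpM2r; first by rewrite exprn_ge0; lra.
rewrite ler_nat (leq_trans (size_subseq (filter_subseq _ _))) //.
by rewrite size_allpairs size_iota.
Qed.

Lemma Ex_fill_ge p s m l w (a : int) : 0 < p < 1 -> uniq s -> (0 < m)%N ->
  (w * m <= l)%N -> {subset rsites (rsquare l a a) <= s} ->
  1 - (1 - seed_prob p) ^+ (w * w) - 2 * ((l * l)%:R * (1 - p) ^+ m) <=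
  Ex p s (fun A => ind R (rset (rsquare l a a) `<=`
     iter (m * m + semiper (rsquare l a a) * m) mod_step A)).
Proof.
move=> p01 us m0 wl ls.
have h1 := Ex_no_tile p01 us m0 wl ls.
have h2 := Ex_no_column_segments p01 us m0 ls.
have h3 := Ex_no_row_segments p01 us m0 ls.
set f1 := (fun A => _) in h1; set f2 := (fun A => _) in h2; set f3 := (fun A => _) in h3.
apply: (@le_trans _ _ (Ex p s (fun A => 1 - f1 A - f2 A - f3 A))).
  by rewrite !ExB Ex_cst; lra.
apply: Ex_le => [|A _]; first by lra.
rewrite /f1 /f2 /f3.
have := ind_ge0 R (forall i, i \in tiles w -> ~ tile m a i A).
have := ind_ge0 R (~ column_segments A (rsquare l a a) m).
have := ind_ge0 R (~ row_segments A (rsquare l a a) m).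
set F := rset _ `<=` _ => g3 g2 g1.
have [hF|hF] := pselect F; first by rewrite (ind_true R hF); lra.
rewrite (ind_false R hF).
have [c1|c1] := pselect (forall i, i \in tiles w -> ~ tile m a i A).
  by rewrite (ind_true R c1); lra.
have [c2|c2] := pselect (~ column_segments A (rsquare l a a) m).
  by rewrite (ind_true R c2); lra.
have [c3|c3] := pselect (~ row_segments A (rsquare l a a) m).
  by rewrite (ind_true R c3); lra.
case: c1 => i iw ti; apply: hF.
by apply: (seed_segments_fill m0 (tile_subr a wl iw m0) ti); apply: contrapT.
Qed.

End lower_bound.

(** * The events of the theorem *)

Lemma rset_closed r : mod_step (rset r) `<=` rset r.
Proof.
by move=> x /mod_stepP[//|[h v]]; move: h v; rect_lia.
Qed.

Lemma squareE L : square L = rset (rsquare L 1 1).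
Proof.
by apply/seteqP; split=> x; rewrite /square /rsquare /=; rect_lia.
Qed.

Definition cube (x : site) (t : nat) : rect :=
  ((x.1 - t%:Z, x.1 + t%:Z), (x.2 - t%:Z, x.2 + t%:Z)).

Lemma cubeS x y t : `|x.1 - y.1| <= 1 -> `|x.2 - y.2| <= 1 ->
  rset (cube y t) `<=` rset (cube x t.+1).
Proof. by move=> h1 h2 z; move: h1 h2; rewrite /cube; rect_lia. Qed.

(** Influence travels at sup-norm speed at most 1; this makes the event in [J'] depend on finitely
    many sites. *)
Lemma iter_mod_step_local t (X : set site) x : iter t mod_step X x ->
  iter t mod_step (X `&` rset (cube x t)) x.
Proof.
elim: t x => [|t IH] x; first by move=> Xx; split=> //; rewrite /cube; rect_lia.
move=> /= /mod_stepP h; apply/mod_stepP.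
have sub y : `|x.1 - y.1| <= 1 -> `|x.2 - y.2| <= 1 -> iter t mod_step X y ->
    iter t mod_step (X `&` rset (cube x t.+1)) y.
  move=> h1 h2 /IH; apply: iter_mod_stepS => z [Xz zy]; split=> //.
  exact: cubeS zy.
case: h => [h|[hh hv]]; first by left; apply: sub => //; rewrite subrr normr0.
right; split.
  by case: hh => h; [left|right]; apply: sub => //=; lia.
by case: hv => h; [left|right]; apply: sub => //=; lia.
Qed.

Lemma iter_mod_closure t (X : set site) : iter t mod_step X `<=` mod_closure X.
Proof. by move=> x h; exists t. Qed.

Lemma iter_set0 t : iter t mod_step set0 = set0.
Proof.
elim: t => //= t ->; apply/seteqP; split=> // x /mod_stepP[//|[]].
by case.
Qed.

Lemma spans_neq0 K r : spans K r -> exists x, x \in K.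
Proof.
elim=> [x|K1 K2 r1 r2 _ [x xK] _ _ _ _]; first by exists x; rewrite mem_head.
by exists x; rewrite mem_cat xK.
Qed.

Lemma semiper_rsquare l (a c : int) : (0 < l)%N -> semiper (rsquare l a c) = (2 * l)%N.
Proof. by rewrite /rsquare; rect_lia. Qed.

Lemma longside_rsquare l (a c : int) : (0 < l)%N -> longside (rsquare l a c) = l.
Proof. by rewrite /rsquare; rect_lia. Qed.

Lemma valid_rsquare l (a c : int) : (0 < l)%N -> valid (rsquare l a c).
Proof. by rewrite /rsquare; rect_lia. Qed.

Section probability.
Variables (R : realType) (P : R -> probability config R).
Hypothesis hP : forall p : R, 0 <= p <= 1 -> is_product_measure p (P p).
Implicit Types (p eps tau : R) (L t : nat).

Lemma Ex_p0 (s : seq site) (f : set site -> R) : Ex 0 s f = f set0.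
Proof. by elim: s f => //= x s IH f; rewrite subr0 mul1r mul0r addr0. Qed.

Lemma I'E L p : 0 <= p <= 1 -> I' P L p =
  Ex p (rsites (rsquare L 1 1)) (fun A => ind R (mod_closure (A `&` square L) = square L)).
Proof.
move=> p01; apply: (prob_determined (hP p01)); first exact: rsites_uniq.
move=> X /=; rewrite rsitesE -squareE.
have -> : (X `&` square L) `&` square L = X `&` square L by rewrite -setIA setIid.
by [].
Qed.

Lemma J'E t p : 0 <= p <= 1 -> J' P t p =
  Ex p (rsites (cube (0, 0) t)) (fun A => ind R (iter t mod_step A (0, 0))).
Proof.
move=> p01; apply: (prob_determined (hP p01)); first exact: rsites_uniq.
move=> X /=; rewrite rsitesE; split; first exact: iter_mod_step_local.
by apply: iter_mod_stepS => z [].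
Qed.

(** A seed at the corner of the square fills all of it. The bound does not depend on [L], which
    allows the supremum over all sizes in (B). *)
Lemma I'_ge_seed_prob L p : 0 < p < 1 -> (0 < L)%N -> seed_prob p <= I' P L p.
Proof.
move=> p01 L0; rewrite I'E; last by lra.
have sub : {subset rsites (rsquare L 1 1) <= rsites (rsquare L 1 1)} by [].
apply: (le_trans (Ex_seed_ge p01 (rsites_uniq _) L0 sub)).
apply: Ex_le => [|A]; first by lra.
rewrite rsitesE -squareE => As; apply: ind_le => sA.
rewrite setIidl //; apply/seteqP; split.
  by apply: mod_closure_sub => //; rewrite squareE; exact: rset_closed.
rewrite squareE => x /(seed_fill sA (k := L)) h.
by apply: iter_mod_closure; apply: h; rewrite L0 leqnn.
Qed.

Lemma I'_le_ispan L p : 0 <= p <= 1 -> (0 < L)%N ->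
  I' P L p <= Ex p (rsites (rsquare L 1 1)) (fun A => ind R (ispan (rsquare L 1 1) A)).
Proof.
move=> p01 L0; rewrite I'E //; apply: Ex_le => // A.
move=> As; apply: ind_le => cA.
have As' : A `&` square L = A by rewrite setIidl // squareE -rsitesE.
rewrite As' squareE in cA.
have [|||||K sK KA] := @spans_mod_closure A (rsites (rsquare L 1 1)) (rsquare L 1 1).
- exact: rsites_uniq.
- by [].
- exact: valid_rsquare.
- by rewrite -rsitesE.
- by rewrite cA.
by exists K.
Qed.

Lemma I'_fill_ge L p m : 0 < p < 1 -> (0 < m)%N ->
  1 - (1 - seed_prob p) ^+ (L %/ m * (L %/ m)) - 2 * ((L * L)%:R * (1 - p) ^+ m) <= I' P L p.
Proof.
move=> p01 m0; rewrite I'E; last by lra.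
have sub : {subset rsites (rsquare L 1 1) <= rsites (rsquare L 1 1)} by [].
apply: (le_trans (Ex_fill_ge p01 (rsites_uniq _) m0 (leq_trunc_div L m) sub)).
apply: Ex_le => [|A]; first by lra.
rewrite rsitesE -squareE => As; apply: ind_le => fA.
rewrite setIidl //; apply/seteqP; split.
  by apply: mod_closure_sub => //; rewrite squareE; exact: rset_closed.
by move=> x /fA; exact: iter_mod_closure.
Qed.

Lemma J'_fill_ge t l p m : 0 < p < 1 -> (0 < m)%N -> (0 < l)%N ->
  (m * m + 2 * l * m <= t)%N ->
  1 - (1 - seed_prob p) ^+ (l %/ m * (l %/ m)) - 2 * ((l * l)%:R * (1 - p) ^+ m) <= J' P t p.
Proof.
move=> p01 m0 l0 lt; rewrite J'E; last by lra.
have lt' : (l <= t)%N by nia.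
have sub : {subset rsites (rsquare l 0 0) <= rsites (cube (0, 0) t)}.
  by move=> x; rewrite !mem_rsites; move: lt'; rewrite /rsquare /cube; clear; rect_lia.
apply: (le_trans (Ex_fill_ge p01 (rsites_uniq _) m0 (leq_trunc_div l m) sub)).
apply: Ex_le => [|A _]; first by lra.
apply: ind_le; rewrite semiper_rsquare // => fA.
apply: (iter_mod_step_le lt); apply: fA.
by move: l0; rewrite /rsquare; clear; rect_lia.
Qed.

Lemma lambda'_ge1 : 1 <= lambda' R.
Proof.
by apply: le_trans (basel_le_lambda' R 1); rewrite /basel big_nat1 expr1n invr1.
Qed.

Lemma expR_ge_pow (n : nat) : exists2 F : R, 0 < F &
  forall x, 0 <= x -> x ^+ n.+1 <= F * expR x.
Proof.
exists n.+1`!%:R; first by rewrite ltr0n fact_gt0.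
move=> x x0; rewrite mulrC -ler_pdivrMr ?ltr0n ?fact_gt0 //.
by apply: le_trans (expR_ge1Dxn n x0); rewrite lerDr.
Qed.

(** The assumption bounds [1 / p] by [u / (lambda' + eps)] in the exponent; the prefactor [p] is at
    least [1 / u] because [lambda' >= 1]. *)
Lemma seed_prob_low p eps (u : R) : 0 < p -> 0 < eps -> 0 < u ->
  lambda' R + eps <= p * u ->
  expR (- (2 * lambda' R * u / (lambda' R + eps))) / u <= seed_prob p.
Proof.
move=> p0 eps0 u0; rewrite /seed_prob; have := lambda'_ge1.
move: (lambda' R) => lam l1 pl.
rewrite [p * _]mulrC; apply: ler_pM; [exact: expR_ge0|by rewrite invr_ge0 ltW| |].
  rewrite ler_expR lerN2 ler_pdivrMr // mulrAC ler_pdivlMr; last by lra.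
  by rewrite -[X in _ <= X]mulrA ler_pM2l 1?mulrC //; lra.
by rewrite -[u^-1]mul1r ler_pdivrMr //; lra.
Qed.

(* With [sl = ln t] and [1/p <= sl] one has [m <= 4 sl ^ 2], hence at least
   [(t / (256 sl ^ 4)) ^ 2] tiles, each of which is a seed with probability at
   least [expR (- 2 lambda' sl / (lambda' + eps)) / sl]. *)
Lemma fill_failure_small eps tau : 0 < eps -> 0 < tau ->
  exists2 p0 : R, 0 < p0 < 1 & forall p t l, 0 < p < p0 ->
  lambda' R + eps <= p * ln t%:R ->
  let m := (Num.truncn (3 * ln t%:R / p)).+1 in
  (16 * (m * m) <= t)%N /\ ((l <= t)%N -> (t <= 8 * m * l)%N ->
  (1 - seed_prob p) ^+ (l %/ m * (l %/ m)) + 2 * ((l * l)%:R * (1 - p) ^+ m) <= tau).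
Proof.
move=> eps0 tau0; have l1 := lambda'_ge1.
pose lam := lambda' R; rewrite -/lam in l1 *.
(* The exponent that survives: about [expR (2 sl)] tiles against a seed probability of about
   [expR (- 2 lambda' sl / (lambda' + eps))]. *)
pose th := 2 * eps / (lam + eps).
have th0 : 0 < th by rewrite divr_gt0 ?mulr_gt0 //; lra.
have [Q Q0 QE] : exists2 Q : R, 0 < Q & Q = 16 * 16 by exists (16 * 16) => //; rewrite mulr_gt0.
have [F F0 hF] := expR_ge_pow 9; have [G G0 hG] := expR_ge_pow 4.
pose C : R := F * (Q ^+ 2) / th ^+ 10.
have C0 : 0 < C by rewrite divr_gt0 ?exprn_gt0 // mulr_gt0 // exprn_gt0.
have tau4 : 0 < 4 / tau by rewrite divr_gt0.
have tauC : 0 < 2 * C / tau by rewrite divr_gt0 // mulr_gt0.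
(* A lower bound for [sl]: the summand [Q * G] serves [Q * sl ^+ 4 <= t], [4 / tau] the empty
   segments, and [2 * C / tau] the missing seeds. *)
pose s0 := 1 + Q * G + 4 / tau + 2 * C / tau.
have s01 : 1 + Q * G < s0 by rewrite /s0; lra.
have G256 : 0 < Q * G by rewrite mulr_gt0.
exists s0^-1; first by rewrite invr_gt0 invf_lt1; lra.
move=> p t l /andP[p0 ps] pl m.
set sl := ln t%:R in pl m *.
have p01 : 0 < p < 1.
  by rewrite p0 (lt_trans ps) // invf_lt1; lra.
have s0p : s0 < p^-1 by rewrite -[s0]invrK ltf_pV2 ?posrE // invr_gt0; lra.
have slp : p^-1 <= sl.
  by rewrite -[p^-1]mul1r ler_pdivrMr // mulrC; apply: le_trans pl; lra.
have sls : s0 < sl by lra.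
have sl0 : 0 < sl by lra.
have splow := seed_prob_low p0 eps0 sl0 pl.
have t0 : 0 < t%:R :> R.
  by rewrite ltr0n lt0n; apply/eqP => t0; move: sl0; rewrite /sl t0 ln0 ?ltxx.
have tE : t%:R = expR sl :> R by rewrite /sl lnK.
have mle : m%:R <= 4 * sl ^+ 2.
  rewrite /m -natr1; apply: (@le_trans _ _ (3 * sl / p + 1)).
    by rewrite lerD2r truncn_le divr_ge0 ?mulr_ge0 ?ltW.
  have : 3 * sl / p <= 3 * sl * sl by apply: ler_wpM2l => //; lra.
  have : 1 <= sl * sl by apply: mulr_ege1; lra.
  rewrite expr2; lra.
have mge : 3 * sl / p <= m%:R by apply/ltW/truncnS_gt.
have m0 : 0 < m%:R :> R by rewrite ltr0n.
have tlow : Q * sl ^+ 4 <= t%:R.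
  rewrite tE -(ler_pM2l G0); apply: le_trans (hG _ (ltW sl0)).
  rewrite (exprS sl 4) mulrA; apply: ler_wpM2r; first by rewrite exprn_ge0 // ltW.
  lra.
have m2 : m%:R * m%:R <= 16 * sl ^+ 4 :> R.
  have -> : 16 * sl ^+ 4 = (4 * sl ^+ 2) * (4 * sl ^+ 2) by ring.
  by apply: ler_pM => //; exact: ltW.
have tlow2 : 16 * (16 * sl ^+ 4) <= t%:R by move: tlow; rewrite QE mulrA.
have tm : (16 * (m * m) <= t)%N by rewrite -(ler_nat R) !natrM; lra.
split=> // lt tml.
have lt' : l%:R <= t%:R :> R by rewrite ler_nat.
set w := (l %/ m)%N.
have ml : (2 * m <= l)%N.
  by move: tm tml; rewrite -(leq_pmul2l (m := 8 * m)) ?muln_gt0 //; clear; nia.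
have w16 : t%:R <= 16 * m%:R ^+ 2 * w%:R :> R.
  have : (t <= 16 * (m * m) * w)%N.
    have lw : (l <= 2 * (w * m))%N.
      have := divn_eq l m; rewrite -/w; have := ltn_pmod l (ltn0Sn (Num.truncn (3 * sl / p))).
      rewrite -/m; move: ml; move: (l %% m)%N => r; clear; nia.
    apply: (leq_trans tml); move: lw; clear; nia.
  by rewrite -(ler_nat R) !natrM expr2.
clear lt tm tml ml; clearbody w m.
(* The constant 3 in [m] makes a segment empty with probability at most [t^-3], which beats the
   [l^2 <= t^2] possible positions. *)
have qm : (1 - p) ^+ m <= expR (- (3 * sl)).
  apply: (le_trans (pow_le_expR _ _)); first by lra.
  by rewrite ler_expR lerN2 -ler_pdivrMr.
have b1 : 2 * ((l * l)%:R * (1 - p) ^+ m) <= tau / 2.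
  apply: (@le_trans _ _ (2 * expR (- sl))).
    rewrite ler_pM2l // natrM.
    apply: (@le_trans _ _ (t%:R * t%:R * expR (- (3 * sl)))).
      apply: ler_pM; rewrite ?mulr_ge0 ?ler0n ?exprn_ge0 //; first by lra.
      by apply: ler_pM.
    by rewrite tE -!expRD ler_expR; lra.
  rewrite expRN -ler_pdivlMl // -[X in _ <= X]invrK lef_pV2 ?posrE ?expR_gt0 ?invr_gt0 //; last first.
    by rewrite mulr_gt0 // ?invr_gt0 // divr_gt0.
  apply: le_trans (ltW (lt_le_trans (expR_gt1Dx _) (lexx _))); last by rewrite gt_eqF.
  have -> : (2^-1 * (tau / 2))^-1 = 4 / tau by field; rewrite gt_eqF.
  by move: sls; rewrite /s0; lra.
have sp0 : 0 < seed_prob p by rewrite /seed_prob mulr_gt0 ?expR_gt0.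
have sp1 := seed_prob_le1 p01.
have wl0 : 0 < expR sl / (Q * sl ^+ 4) by rewrite divr_gt0 ?expR_gt0 // mulr_gt0 // exprn_gt0.
have wlow : expR sl / (Q * sl ^+ 4) <= w%:R.
  rewrite ler_pdivrMr ?mulr_gt0 ?exprn_gt0 // -tE; apply: (le_trans w16).
  rewrite mulrC; apply: ler_wpM2l; first exact: ler0n.
  by rewrite expr2 QE -mulrA ler_pM2l.
have bw : sl / C <= seed_prob p * (w * w)%:R.
  apply: (@le_trans _ _ ((expR (- (2 * lam * sl / (lam + eps))) / sl) *
      (expR sl / (Q * sl ^+ 4)) ^+ 2)); last first.
    apply: ler_pM; [by apply: divr_ge0; rewrite ?expR_ge0 ?(ltW sl0)| |exact: splow|].
      by apply: exprn_ge0; exact: ltW.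
    by rewrite natrM -expr2; apply: lerXn2r => //; rewrite nnegrE ?ler0n // ltW.
  rewrite expr_div_n -expRM_natl.
  have -> : expR (- (2 * lam * sl / (lam + eps))) / sl * (expR (2%:R * sl) / (Q * sl ^+ 4) ^+ 2)
     = expR (th * sl) / (Q ^+ 2 * sl ^+ 9).
    have -> : th * sl = - (2 * lam * sl / (lam + eps)) + 2 * sl.
      by rewrite /th; field; lra.
    by rewrite expRD; field; lra.
  rewrite ler_pdivlMr ?mulr_gt0 ?exprn_gt0 //.
  rewrite -(ler_pM2l F0); apply: le_trans (hF _ (ltW (mulr_gt0 th0 sl0))).
  rewrite /C le_eqVlt; apply/orP; left; apply/eqP.
  by clearbody th; field; rewrite !gt_eqF.
have b2 : (1 - seed_prob p) ^+ (w * w) <= tau / 2.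
  apply: (le_trans (pow_le_expR _ _)); first by lra.
  have bw0 : 0 < (w * w)%:R * seed_prob p.
    by rewrite mulrC; apply: lt_le_trans bw; rewrite divr_gt0.
  rewrite expRN -[X in _ <= X]invrK lef_pV2 ?posrE ?expR_gt0 ?invr_gt0 ?divr_gt0 //.
  apply: (@le_trans _ _ ((w * w)%:R * seed_prob p)); last by apply: le_trans (expR_ge1Dx _); lra.
  rewrite [X in _ <= X]mulrC; apply: le_trans bw; rewrite ler_pdivlMr //.
  have -> : (tau / 2)^-1 * C = 2 * C / tau by field; rewrite gt_eqF.
  by move: sls; rewrite /s0; lra.
lra.
Qed.

End probability.

(** * Both sides of the threshold *)

Section thresholds.
Variables (R : realType) (P : R -> probability config R).
Hypothesis hP : forall p : R, 0 <= p <= 1 -> is_product_measure p (P p).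
Implicit Types (p eps tau : R) (L t : nat).

Lemma I'_supercritical eps tau : 0 < eps -> 0 < tau ->
  exists2 p0 : R, 0 < p0 & forall p L, 0 <= p < p0 ->
  lambda' R + eps <= p * ln L%:R -> 1 - tau <= I' P L p.
Proof.
move=> eps0 tau0; have l1 := lambda'_ge1 R.
have [p0 p001 h] := fill_failure_small eps0 tau0.
exists p0; first by lra.
move=> p L pp pl.
have pn : p != 0 by apply: contraTneq pl => ->; rewrite mul0r -ltNge; lra.
have p0' : 0 < p < p0 by rewrite lt_neqAle eq_sym pn.
have p01 : 0 < p < 1 by lra.
have [_ h2] := h p L L p0' pl; move: h2.
set m := (Num.truncn _).+1; have m0 : (0 < m)%N by [].
clearbody m => h2; have {}h2 := h2 (leqnn L) ltac:(by rewrite leq_pmull // muln_gt0).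
apply: le_trans (I'_fill_ge hP L p01 m0).
by move: h2; clear; lra.
Qed.

Lemma J'_supercritical eps tau : 0 < eps -> 0 < tau ->
  exists2 p0 : R, 0 < p0 & forall p t, 0 <= p < p0 ->
  lambda' R + eps <= p * ln t%:R -> 1 - tau <= J' P t p.
Proof.
move=> eps0 tau0; have l1 := lambda'_ge1 R.
have [p0 p001 h] := fill_failure_small eps0 tau0.
exists p0; first by lra.
move=> p t pp pl.
have pn : p != 0 by apply: contraTneq pl => ->; rewrite mul0r -ltNge; lra.
have p0' : 0 < p < p0 by rewrite lt_neqAle eq_sym pn.
have p01 : 0 < p < 1 by lra.
have {}h l := h p t l p0' pl; move: h; rewrite /=.
set m := (Num.truncn _).+1; have m0 : (0 < m)%N by [].
(* Filling a box of side [l] takes at most [m^2 + 2 l m] steps; since [16 m^2 <= t], this choice of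
   [l] keeps that below [t]. Shrinking the box by a factor of order [m] is affordable because [m] is
   polynomial in [ln t]. *)
clearbody m => h; pose l := (t %/ (4 * m))%N; have [h1 h2] := h l.
have m4 : (0 < 4 * m)%N by rewrite muln_gt0.
have tE := divn_eq t (4 * m); have tm := ltn_pmod t m4; rewrite -/l in tE.
have l0 : (0 < l)%N.
  by rewrite divn_gt0 //; move: h1 m0; clear; nia.
have lt : (l <= t)%N by exact: leq_div.
have tml : (t <= 8 * m * l)%N by move: tE tm l0 m0; move: (t %% _)%N => r; clear; nia.
have time : (m * m + 2 * l * m <= t)%N.
  by move: tE h1; move: (t %% _)%N => r; clear; nia.
apply: le_trans (J'_fill_ge hP p01 m0 l0 time).
by have := h2 lt tml; clear; lra.
Qed.

Lemma Ex_ispan_p0 (s : seq site) S : Ex 0 s (fun A => ind R (ispan S A)) = 0.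
Proof.
rewrite Ex_p0 ind_false // => -[K /spans_neq0[x xK] K0].
exact: (K0 x xK).
Qed.

(** Indexing by a corner and two side lengths gives a union bound with the first power of the area
    of [S]. The square of the area, as in [subrects], would be too much: the area itself is already
    of order [expR (2 lambda' / p)] at the threshold. *)
Definition small_rects (S : rect) (n : nat) : seq rect :=
  [seq ((x.1, x.1 + w.1%:Z), (x.2, x.2 + w.2%:Z)) | x <- rsites S, w <- tiles n].

Lemma mem_small_rects S n r : valid r -> subr r S -> (longside r <= n)%N ->
  r \in small_rects S n.
Proof.
move=> v sb ln; apply/allpairsP.
exists ((r.1.1, r.2.1), (absz (r.1.2 - r.1.1), absz (r.2.2 - r.2.1))); split=> /=.
- by rewrite mem_rsites; move: v sb; rect_lia.
- by rewrite mem_tiles; move: v ln; rect_lia.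
- by move: v; case: (r) => [[a b] [c d]] v; congr (_, _, (_, _)); move: v; rect_lia.
Qed.

Lemma size_small_rects S n : size (small_rects S n) = (size (rsites S) * (n * n))%N.
Proof. by rewrite !size_allpairs !size_iota. Qed.

Lemma Ex_exists_ispan (p c : R) s S n (Q : rect -> Prop) : 0 <= p <= 1 ->
  (forall r, valid r -> subr r S -> Q r ->
     Ex p s (fun A => ind R (ispan r A)) <= c) -> 0 <= c ->
  (forall r, valid r -> Q r -> subr r S /\ (longside r <= n)%N) ->
  Ex p s (fun A => ind R (exists2 r, ispan r A & Q r)) <=
  (size (rsites S) * (n * n))%:R * c.
Proof.
move=> p01 bd c0 Qn.
apply: (@le_trans _ _ (Ex p s (fun A => \sum_(r <- small_rects S n)
   ind R (ispan r A /\ [/\ valid r, subr r S & Q r])))).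
  apply: Ex_le => // A _; apply: le_trans (ind_ex _ _ _).
  apply: ind_le => -[r [K sK KA] Qr].
  have v := spans_valid sK; have [sb ln] := Qn r v Qr.
  exists r; first exact: mem_small_rects.
  by split=> //; exists K.
rewrite Ex_sum -size_small_rects.
apply: (@le_trans _ _ (\sum_(r <- small_rects S n) c)).
  apply: ler_sum => r _; have [[v sb Qr]|nQ] := pselect [/\ valid r, subr r S & Q r].
    by apply: le_trans (bd r v sb Qr); apply: Ex_le => // A _; apply: ind_le => -[].
  rewrite (@le_trans _ _ 0) // -[X in _ <= X](Ex_cst p s).
  by apply: Ex_le => // A _; rewrite ind_false // => -[].
by rewrite big_const_seq count_predT iter_addr addr0 -(mulr_natl c).
Qed.

Lemma ispan_longside (K : seq site) r n : spans K r -> (1 < n)%N -> (n < longside r)%N ->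
  exists2 r', ispan r' [set` K] & (n./2 < longside r' <= n)%N.
Proof.
move=> sK n1 nr; have [|K' [r' [s' i' _ g1 g2]]] := spans_intermediate sK (n := n./2).
  by rewrite half_gt0 n1 /=; apply: leq_ltn_trans nr; rewrite -[X in (_ <= X)%N](odd_double_half n); clear; lia.
exists r'; first by exists K' => // x /= /i'.
by rewrite g1 (leq_trans g2) // -[X in (_ <= X)%N](odd_double_half n); clear; lia.
Qed.

(** Any longer spanned rectangle contains a spanned one with long side between half of [B / p] and
    [B / p], up to rounding. Its shape has only polynomially many choices, and its position at most
    as many as there are sites in [S]. *)
Lemma Ex_large_ispan eps : 0 < eps -> exists2 B : R, 1 <= B &
  exists2 p0 : R, 0 < p0 & forall p S, 0 < p < p0 -> valid S ->
  Ex p (rsites S) (fun A => ind R (exists2 r, ispan r A & (Num.truncn (B / p) < longside r)%N)) <=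
  (size (rsites S))%:R * expR (- ((2 * lambda' R - eps) / p)).
Proof.
move=> eps0.
have e20 : 0 < eps / 2 by lra.
have [B1 B10 hB] := @ispan_upper R (eps / 2) e20.
pose B := Num.max B1 1.
have BB : B1 <= B by rewrite le_max lexx.
have B1' : 1 <= B by rewrite le_max lexx orbT.
have B0 : 0 < B by lra.
exists B => //; have [p1 p10 up] := hB B BB.
have [p2 p20 poly] := @poly_le_expR R (B ^+ 2) (eps / 2) 2 ltac:(by rewrite exprn_ge0 ?ltW) e20.
exists (Num.min p1 (Num.min p2 (1 / 4))); first by rewrite !lt_min p10 p20 /=; lra.
move=> p S /andP[p0]; rewrite !lt_min => /and3P[pp1 pp2 p4] vS.
set n := Num.truncn (B / p).
have Bp0 : 0 <= B / p by rewrite divr_ge0 ?ltW.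
have nB : n%:R <= B / p by rewrite truncn_le.
have nB' : B / p < n%:R + 1 by rewrite natr1; exact: truncnS_gt.
have B4 : 4 <= B / p by rewrite ler_pdivlMr //; lra.
have n1 : (1 < n)%N by rewrite -(ltr_nat R); lra.
clearbody n.
pose Q r := subr r S /\ (n./2 < longside r <= n)%N.
apply: (@le_trans _ _ (Ex p (rsites S) (fun A => ind R (exists2 r, ispan r A & Q r)))).
  apply: Ex_le => [|A]; first by lra.
  rewrite rsitesE => AS; apply: ind_le => -[r [K sK KA] nr].
  have [r' [K' sK' KK'] Qr'] := ispan_longside sK n1 nr.
  exists r'; first by exists K' => //; exact: subset_trans KA.
  by split=> //; apply: spans_subr sK' _ => x /KK' /KA; exact: AS.
apply: (@le_trans _ _ ((size (rsites S) * (n * n))%:R * expR (- ((2 * lambda' R - eps / 2) / p)))).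
  apply: Ex_exists_ispan; [by lra| |exact: expR_ge0|by move=> r _ [? /andP[]]].
  move=> r v sb [_ /andP[Q1 Q2]]; apply: (up p (rsites S) r) => //.
  - by rewrite p0.
  - exact: rsites_uniq.
  - by apply: (subset_rsites sb).
  - apply/andP; split; last by apply: le_trans nB; rewrite ler_nat.
    have : (n.+1 <= longside r * 2)%N.
      by have := odd_double_half n; move: Q1; move: (n./2) => k; clear; lia.
    rewrite -(ler_nat R) natrM -natr1 => h.
    have -> : B / (4 * p) = B / p / 4 by field; lra.
    lra.
rewrite natrM -mulrA ler_wpM2l ?ler0n //.
have h := poly p ltac:(by rewrite p0).
apply: (@le_trans _ _ (expR (eps / 2 / p) * expR (- ((2 * lambda' R - eps / 2) / p)))).
  apply: ler_wpM2r; first exact: expR_ge0.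
  apply: le_trans h; rewrite natrM -exprMn expr2.
  by apply: ler_pM.
rewrite -expRD ler_expR le_eqVlt; apply/orP; left; apply/eqP; field; lra.
Qed.

Lemma size_rsites r : valid r -> size (rsites r) = (len r.1 * len r.2)%N.
Proof. by case/andP=> v1 v2; rewrite size_allpairs !size_irange. Qed.

Lemma pow_le_inv (c : R) n : 0 < c <= 1 -> (0 < n)%N -> (1 - c) ^+ n <= (c * n%:R)^-1.
Proof.
move=> c01 n0; have n0' : 0 < n%:R :> R by rewrite ltr0n.
apply: (le_trans (pow_le_expR _ _)); first by lra.
rewrite expRN lef_pV2 ?posrE ?expR_gt0 ?mulr_gt0 //; try lra.
by apply: le_trans (expR_ge1Dx _); rewrite mulrC; lra.
Qed.

Lemma I'_subcritical eps tau : 0 < eps -> 0 < tau ->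
  exists2 p0 : R, 0 < p0 & exists L0, forall p L, 0 <= p < p0 -> (L0 <= L)%N ->
  p * ln L%:R <= lambda' R - eps -> I' P L p <= tau.
Proof.
move=> eps0 tau0.
have [B B1 [p1 p10 up]] := Ex_large_ispan eps0.
have B0 : 0 < B by lra.
have [p2 p20 poly] := @poly_le_expR R tau^-1 eps 0 ltac:(by rewrite invr_ge0 ltW) eps0.
exists (Num.min p1 (Num.min p2 (1 / 2))); first by rewrite !lt_min p10 p20 /=; lra.
pose c : R := expR (- (2 * B)).
have c0 : 0 < c by exact: expR_gt0.
have c1 : c <= 1 by rewrite expR_le1; lra.
(* Chosen so that [(1 - c) ^+ L <= 1 / (c * L) <= tau]. *)
exists (Num.truncn (c * tau)^-1).+1 => p L /andP[p0]; rewrite !lt_min => /and3P[pp1 pp2 pp3] L0 pl.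
have Lpos : (0 < L)%N by exact: leq_trans L0.
have p01 : 0 <= p <= 1 by lra.
apply: (le_trans (I'_le_ispan hP p01 Lpos)).
set S := rsquare L 1 1; have vS : valid S by exact: valid_rsquare.
have [->|pn] := eqVneq p 0; first by rewrite Ex_ispan_p0 ltW.
have pp : 0 < p by rewrite lt_neqAle eq_sym pn.
have LS : longside S = L by exact: longside_rsquare.
have SL1 : len S.1 = L by move: Lpos; rewrite /S /rsquare; clear; rect_lia.
have SL2 : len S.2 = L by exact: SL1.
have [LN|NL] := leqP L (Num.truncn (B / p)).
  have [h _] := Ex_ispan_crossing (p := p) ltac:(lra) (rsites_uniq S) (fun x h => h) vS.
  apply: (le_trans h).
  rewrite ?SL1 ?SL2.
  apply: (@le_trans _ _ ((1 - c) ^+ L)).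
    apply: lerXn2r; rewrite ?nnegrE ?subr_ge0 //.
      by apply: exprn_ile1; lra.
    rewrite lerD2l lerN2; apply: le_trans (pow_ge_expR _ _); last by lra.
    rewrite /c ler_expR lerN2 -mulrA ler_pM2l // -ler_pdivlMr //.
    apply: (@le_trans _ _ (Num.truncn (B / p))%:R); first by rewrite ler_nat.
    by rewrite truncn_le divr_ge0 ?ltW.
  apply: (le_trans (pow_le_inv _ Lpos)); first by rewrite c0.
  rewrite -[X in _ <= X]invrK lef_pV2 ?posrE ?invr_gt0 ?mulr_gt0 ?ltr0n //.
  have : (c * tau)^-1 <= L%:R by apply: le_trans (ltW (truncnS_gt _)) _; rewrite ler_nat.
  move=> h'; rewrite [X in _ <= X]mulrC -ler_pdivrMr // -invfM.
  by rewrite [X in X^-1]mulrC.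
have := up p S ltac:(by rewrite pp) vS.
move=> h; apply: le_trans (le_trans h _).
  apply: Ex_le => // A _; apply: ind_le => iA; exists S => //.
  by rewrite LS.
rewrite size_rsites //.
rewrite ?SL1 ?SL2.
have LE : L%:R = expR (ln L%:R) :> R by rewrite lnK // posrE ltr0n.
have h2 := poly p ltac:(by rewrite pp).
rewrite expr0 mulr1 in h2.
apply: (@le_trans _ _ (expR (- (eps / p)))).
  rewrite natrM LE -!expRD ler_expR.
  have : ln L%:R <= (lambda' R - eps) / p by rewrite ler_pdivlMr // mulrC.
  have -> : (2 * lambda' R - eps) / p = (lambda' R - eps) / p *+ 2 + eps / p by rewrite mulr2n; field.
  rewrite mulr2n; lra.
by rewrite expRN -[X in _ <= X]invrK lef_pV2 ?posrE ?expR_gt0 ?invr_gt0.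
Qed.

End thresholds.

(** * Infection of the origin below the threshold *)

Section origin.
Variables (R : realType) (P : R -> probability config R).
Hypothesis hP : forall p : R, 0 <= p <= 1 -> is_product_measure p (P p).
Implicit Types (p eps tau : R) (L t : nat).

Lemma subr_cube r n : valid r -> rset r (0, 0) -> (longside r <= n)%N ->
  subr r (cube (0, 0) n).
Proof. by rewrite /cube; rect_lia. Qed.

Lemma size_cube (x : site) n : size (rsites (cube x n)) = (n.*2.+1 * n.*2.+1)%N.
Proof.
rewrite size_rsites; last by rewrite /cube; rect_lia.
by congr (_ * _)%N; rewrite /cube; rect_lia.
Qed.

Lemma Ex_near_origin p (s : seq site) n : 0 <= p <= 1 -> uniq s ->
  Ex p s (fun A => ind R (exists2 x, x \in rsites (cube (0, 0) n) & A x)) <=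
  (n.*2.+1 * n.*2.+1)%:R * p.
Proof.
move=> p01 us; pose l := [seq x <- rsites (cube (0, 0) n) | x \in s].
apply: (@le_trans _ _ (Ex p s (fun A => \sum_(x <- l) ind R (A x)))).
  apply: Ex_le => // A As; apply: le_trans (ind_ex _ _ _).
  apply: ind_le => -[x xc Ax]; exists x => //.
  by rewrite mem_filter xc andbT; exact: As.
rewrite Ex_sum (@le_trans _ _ (\sum_(x <- l) p)) //.
  rewrite big_seq [X in _ <= X]big_seq; apply: ler_sum => x.
  rewrite mem_filter => /andP[xs _].
  rewrite (@Ex_eq _ p s _ (fun A => if `[< A x >] then 1 else 0)); last first.
    by move=> A _; rewrite /ind; case: asboolP.
  by rewrite Ex_site // mulr0 add0r mulr1.
rewrite big_const_seq count_predT iter_addr addr0 -(mulr_natl p) ler_wpM2r //; first by lra.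
by rewrite ler_nat -(size_cube (0, 0)) size_filter count_size.
Qed.

Lemma spans_near_origin (A : set site) K r n : spans K r -> [set` K] `<=` A ->
  rset r (0, 0) -> (longside r <= n)%N ->
  exists2 x, x \in rsites (cube (0, 0) n) & A x.
Proof.
move=> sK KA r0 ln; have [x xK] := spans_neq0 sK.
exists x; last exact: KA.
have /andP[s1 s2] := subr_cube (spans_valid sK) r0 ln.
have /andP[x1 x2] := spans_sub sK xK.
by rewrite mem_rsites (between_sub1 s1 x1) (between_sub1 s2 x2).
Qed.

Lemma Ex_ispan_long p (s : seq site) r k n (c : R) : 0 < p <= 1 / 2 -> uniq s ->
  {subset rsites r <= s} -> valid r -> (k < longside r <= n)%N ->
  0 <= c <= (1 - p) ^+ n ->
  Ex p s (fun A => ind R (ispan r A)) <= (1 - c) ^+ k.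
Proof.
move=> p12 us rs vr /andP[kl ln] /andP[c0 cn].
have [e1 e2] := Ex_ispan_crossing p12 us rs vr.
have q01 j : (j <= n)%N -> c <= (1 - p) ^+ j.
  by move=> jn; apply: (le_trans cn); apply: ler_wiXn2l => //; lra.
have q1 j : (1 - p) ^+ j <= 1 by apply: exprn_ile1; lra.
have c1 := le_trans (q01 0%N (leq0n n)) (q1 0%N).
have pw i j : (j <= n)%N -> (k < i)%N -> (1 - (1 - p) ^+ j) ^+ i <= (1 - c) ^+ k.
  move=> jn ki; apply: (@le_trans _ _ ((1 - c) ^+ i)).
    by apply: lerXn2r; rewrite ?nnegrE ?subr_ge0 // lerD2l lerN2 q01.
  by apply: ler_wiXn2l; [rewrite subr_ge0|rewrite gerBl|exact: ltnW].
have [h|h] : (k < len r.1)%N \/ (k < len r.2)%N.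
  by move: kl; rewrite /longside leq_max => /orP[]; [left|right].
- apply: (le_trans e1); apply: pw => //; apply: leq_trans ln; exact: leq_maxr.
- apply: (le_trans e2); apply: pw => //; apply: leq_trans ln; exact: leq_maxl.
Qed.

Lemma log_square_small (D tau : R) : 0 < D -> 0 < tau ->
  exists2 p0 : R, 0 < p0 & forall p, 0 < p < p0 -> 1 <= - ln p /\
  (D * - ln p) ^+ 2 * p <= tau.
Proof.
move=> D0 tau0; have [F F0 hF] := expR_ge_pow R 2.
exists (expR (- (1 + D ^+ 2 * F / tau))); first exact: expR_gt0.
move=> p /andP[p0 pp]; set u := - ln p.
have pE : p = expR (- u) by rewrite /u opprK lnK.
have D2 : 0 < D ^+ 2 by rewrite exprn_gt0.
have c0 : 0 < D ^+ 2 * F / tau by rewrite divr_gt0 // mulr_gt0.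
have uu : 1 + D ^+ 2 * F / tau < u by move: pp; rewrite {1}pE ltr_expR ltrN2.
split; first by lra.
have u0 : 0 < u by lra.
rewrite exprMn {1}pE expRN ler_pdivrMr ?expR_gt0 //.
have h := hF u (ltW u0).
rewrite -(ler_pM2r u0).
have -> : D ^+ 2 * u ^+ 2 * u = D ^+ 2 * u ^+ 3 by ring.
apply: (@le_trans _ _ (D ^+ 2 * (F * expR u))); first by rewrite ler_pM2l.
have -> : tau * expR u * u = tau * u * expR u by ring.
rewrite [X in X <= _]mulrA ler_pM2r ?expR_gt0 //.
by rewrite [tau * u]mulrC -ler_pdivrMr //; lra.
Qed.

(** The spanned rectangle containing the origin is classified by its long side. Above [B / p] the
    exponential bound applies. Between [k], of order [- ln p], and [B / p], each of at most
    [9 (B / p)^4] rectangles has probability at most [(1 - c) ^+ k <= p^5]. Up to [k], some site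
    within distance [k] of the origin is occupied. *)
Lemma J'_subcritical eps tau : 0 < eps -> 0 < tau ->
  exists2 p0 : R, 0 < p0 & forall p t, 0 <= p < p0 -> (0 < t)%N ->
  p * ln t%:R <= lambda' R - eps -> J' P t p <= tau.
Proof.
move=> eps0 tau0.
have tau3 : 0 < tau / 3 by lra.
have [B B1 [p1 p10 up]] := Ex_large_ispan eps0.
have B0 : 0 < B by lra.
have [p2 p20 poly] := @poly_le_expR R (9 / (tau / 3)) eps 0 ltac:(by rewrite divr_ge0 // ltW) eps0.
pose c : R := expR (- (2 * B)).
have c0 : 0 < c by exact: expR_gt0.
have c1 : c <= 1 by rewrite expR_le1; lra.
(* Since [k <= 5 / c * u + 1] and [u >= 1], this gives [2 k + 1 <= D * u]. The 5 in [k] is one more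
   than the four powers of [1 / p] from counting rectangles. *)
pose D : R := 10 / c + 3.
have c10 : 0 < 10 / c by rewrite divr_gt0.
have D0 : 0 < D by rewrite /D; lra.
have [p3 p30 logs] := log_square_small D0 tau3.
pose p4 := tau / 3 / (9 * B ^+ 4).
have B40 : 0 < B ^+ 4 by rewrite exprn_gt0.
have p40 : 0 < p4 by rewrite divr_gt0 // mulr_gt0.
exists (Num.min p1 (Num.min p2 (Num.min p3 (Num.min p4 (1 / 2))))).
  by rewrite !lt_min p10 p20 p30 p40 /=; lra.
move=> p t /andP[pp]; rewrite !lt_min => /and5P[pp1 pp2 pp3 pp4 pp5] t0 pl.
have p01 : 0 <= p <= 1 by lra.
rewrite (J'E hP) //; set S := cube (0, 0) t.
have [->|pn] := eqVneq p 0.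
  by rewrite Ex_p0 iter_set0 ind_false // ltW.
have p0 : 0 < p by rewrite lt_neqAle eq_sym pn.
have vS : valid S by rewrite /S /cube; clear; rect_lia.
pose n := Num.truncn (B / p).
have [u1 logp] := logs p ltac:(by rewrite p0).
set u := - ln p in u1 logp.
pose k := (Num.truncn (5 / c * u)).+1.
pose Q r := [/\ subr r S, rset r (0, 0) & (k < longside r <= n)%N].
pose f1 A := ind R (exists2 r, ispan r A & (n < longside r)%N).
pose f2 A := ind R (exists2 r, ispan r A & Q r).
pose f3 A := ind R (exists2 x, x \in rsites (cube (0, 0) k) & A x).
apply: (@le_trans _ _ (Ex p (rsites S) (fun A => f1 A + f2 A + f3 A))).
  apply: Ex_le => // A AS.
  have [h|h] := pselect (iter t mod_step A (0, 0)); last first.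
    by rewrite ind_false // !addr_ge0 ?ind_ge0.
  rewrite ind_true //.
  have [K [r [sK KA r0]]] := spans_mod_closure_point (rsites_uniq S) AS (iter_mod_closure h).
  have [nr|rn] := ltnP n (longside r).
    rewrite {1}/f1 ind_true; last by exists r => //; exists K.
    by rewrite -addrA lerDl addr_ge0 ?ind_ge0.
  have [kr|rk] := ltnP k (longside r).
    rewrite {1}/f2 ind_true; last first.
      exists r; first by exists K.
      split=> //; last by rewrite kr.
      by apply: spans_subr sK _ => x /KA /AS /=; rewrite mem_rsites.
    by rewrite addrAC lerDr addr_ge0 ?ind_ge0.
  rewrite {1}/f3 ind_true; last exact: (spans_near_origin sK KA r0 rk).
  by rewrite lerDr addr_ge0 ?ind_ge0.
rewrite !ExD.
have Bp0 : 0 <= B / p by rewrite divr_ge0 ?ltW.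
have nB : n%:R <= B / p by rewrite truncn_le.
have pu : expR (- u) = p by rewrite /u opprK lnK.
have kge : 5 / c * u <= k%:R by apply/ltW/truncnS_gt.
have kle : k%:R <= 5 / c * u + 1.
  by rewrite /k -natr1 lerD2r truncn_le !mulr_ge0 ?invr_ge0 ?(ltW c0) //; lra.
have n1 : (0 < n)%N.
  by rewrite /n truncn_gt0 ler_pdivlMr // mul1r; lra.
have b1 : Ex p (rsites S) f1 <= tau / 3.
  apply: (le_trans (up p S ltac:(by rewrite p0) vS)).
  rewrite size_cube.
  have tE : t%:R = expR (ln t%:R) :> R by rewrite lnK // posrE ltr0n.
  have h := poly p ltac:(by rewrite p0); rewrite expr0 mulr1 in h.
  apply: (@le_trans _ _ ((9 * (t%:R * t%:R)) * expR (- ((2 * lambda' R - eps) / p)))).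
    apply: ler_wpM2r; first exact: expR_ge0.
    by rewrite -natrM -(natrM R 9) ler_nat; move: t0; clear; nia.
  apply: (@le_trans _ _ (9 * expR (- (eps / p)))).
    rewrite -mulrA ler_pM2l // tE -!expRD ler_expR.
    have : ln t%:R <= (lambda' R - eps) / p by rewrite ler_pdivlMr // mulrC.
    have -> : (2 * lambda' R - eps) / p = (lambda' R - eps) / p *+ 2 + eps / p by rewrite mulr2n; field.
    rewrite mulr2n; clear; lra.
  rewrite expRN ler_pdivrMr ?expR_gt0 // -ler_pdivrMl //.
  by move: h; rewrite mulrC.
have b2 : Ex p (rsites S) f2 <= tau / 3.
  have cq : c <= (1 - p) ^+ n.
    apply: le_trans (pow_ge_expR _ _); last by lra.
    by rewrite /c ler_expR lerN2 -mulrA ler_pM2l // -ler_pdivlMr.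
  apply: (@le_trans _ _ ((size (rsites (cube (0, 0) n)) * (n * n))%:R * p ^+ 5)).
    apply: Ex_exists_ispan => //; last 2 first.
    - by rewrite exprn_ge0.
    - by move=> r v [sb r0 /andP[_ rn]]; split=> //; exact: subr_cube.
    move=> r v _ [sb r0 rk].
    apply: (@le_trans _ _ ((1 - c) ^+ k)).
      apply: (Ex_ispan_long _ (rsites_uniq S) _ v rk); first by lra.
      - exact: (subset_rsites sb).
      - by rewrite (ltW c0).
    apply: (le_trans (pow_le_expR _ _)); first by lra.
    rewrite -pu -expRM_natl ler_expR mulrN lerN2.
    have -> : 5 * u = (5 / c * u) * c by field; rewrite gt_eqF.
    by rewrite ler_pM2r.
  rewrite size_cube.
  apply: (@le_trans _ _ (9 * (B / p) ^+ 4 * p ^+ 5)).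
    apply: ler_wpM2r; first by rewrite exprn_ge0.
    apply: (@le_trans _ _ (9 * n%:R ^+ 4)).
      by rewrite -natrX -(natrM R 9) ler_nat; move: n1; clear; nia.
    by rewrite ler_pM2l //; apply: lerXn2r; rewrite ?nnegrE ?ler0n.
  have -> : 9 * (B / p) ^+ 4 * p ^+ 5 = p * (9 * B ^+ 4) by field.
  by move: pp4; rewrite /p4 ltr_pdivlMr ?mulr_gt0 // => /ltW.
have b3 : Ex p (rsites S) f3 <= tau / 3.
  apply: (le_trans (Ex_near_origin _ p01 (rsites_uniq S))).
  apply: le_trans logp; apply: ler_wpM2r => //.
  rewrite natrM -expr2; apply: lerXn2r; rewrite ?nnegrE ?ler0n //.
    by rewrite mulr_ge0; lra.
  rewrite -natr1 -mul2n natrM.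
  have -> : D * u = 2 * (5 / c * u) + 3 * u by rewrite /D; field; rewrite gt_eqF.
  by move: kle u1; clear; lra.
by move: b1 b2 b3; clear; lra.
Qed.

End origin.

(** * Limits *)

Section limits.
Variable R : realType.

(** A strict inequality for the lower limit leaves a gap that holds uniformly along the tail; the
    estimates are stated with such an [eps]. *)
Lemma lt_limn_einf (l : R) (u : nat -> R) :
  (l%:E < limn_einf (fun n => (u n)%:E))%E ->
  exists2 eps : R, 0 < eps & \forall n \near \oo, l + eps <= u n.
Proof.
rewrite /limn_einf /limn_esup /limf_esup -ereal_supN => /ereal_sup_gt[_ [_ [V Vn <-] <-]].
rewrite lteNr => lV.
have [eps eps0 h] : exists2 eps : R, 0 < eps &
    (ereal_sup ((fun n => - (u n)%:E)%E @` V) <= (- (l + eps))%:E)%E.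
  move: lV; set y := ereal_sup _; case: y => [y| |] //=.
    rewrite lte_fin => yl; exists (- l - y); first lra.
    by rewrite lee_fin; lra.
  by move=> _; exists 1; rewrite ?leNye.
exists eps => //; apply: filterS Vn => n Vn.
have := le_trans (ereal_sup_ubound (ex_intro2 _ _ n Vn erefl)) h.
by rewrite lee_fin lerN2.
Qed.

Lemma limn_esup_lt (l : R) (u : nat -> R) :
  (limn_esup (fun n => (u n)%:E) < l%:E)%E ->
  exists2 eps : R, 0 < eps & \forall n \near \oo, u n <= l - eps.
Proof.
rewrite /limn_esup /limf_esup => /ereal_inf_lt[_ [V Vn <-] lV].
have [eps eps0 h] : exists2 eps : R, 0 < eps &
    (ereal_sup ((fun n => (u n)%:E) @` V) <= (l - eps)%:E)%E.
  move: lV; set y := ereal_sup _; case: y => [y| |] //=.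
    rewrite lte_fin => yl; exists (l - y); first lra.
    by rewrite lee_fin; lra.
  by move=> _; exists 1; rewrite ?leNye.
exists eps => //; apply: filterS Vn => n Vn.
have := le_trans (ereal_sup_ubound (ex_intro2 _ _ n Vn erefl)) h.
by rewrite lee_fin.
Qed.

Lemma limf_esup_le (f : R -> \bar R) (F : set_system R) (V : set R) (c : \bar R) :
  F V -> (forall x, V x -> (f x <= c)%E) -> (limf_esup f F <= c)%E.
Proof.
move=> FV fc; apply: (@le_trans _ _ (ereal_sup (f @` V))).
  by apply: ereal_inf_lbound; exists V.
by apply: ge_ereal_sup => _ [x Vx <-]; exact: fc.
Qed.

Lemma limf_einf_ge (f : R -> \bar R) (F : set_system R) (V : set R) (c : \bar R) :
  F V -> (forall x, V x -> (c <= f x)%E) -> (c <= limf_einf f F)%E.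
Proof.
move=> FV fc; rewrite /limf_einf leeNr; apply: (limf_esup_le FV) => x Vx.
by rewrite leeN2 fc.
Qed.

Lemma nbhs_right0 (p0 : R) : 0 < p0 -> (0 : R)^'+ [set p | 0 < p < p0].
Proof.
move=> p00; near=> p; rewrite /=; apply/andP; split; near: p.
  exact: nbhs_right_gt.
exact: nbhs_right_lt.
Unshelve. all: by end_near. Qed.

Lemma cvg_to_one (u : nat -> R) : (forall n, 0 <= u n <= 1) ->
  (forall tau, 0 < tau -> \forall n \near \oo, 1 - tau <= u n) ->
  u n @[n --> \oo] --> (1 : R).
Proof.
move=> u01 h; apply/cvgrPdist_le => tau tau0; apply: filterS (h tau tau0) => n hn.
by have /andP[u0 u1] := u01 n; rewrite ger0_norm ?subr_ge0 //; lra.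
Qed.

Lemma cvg_to_zero (u : nat -> R) : (forall n, 0 <= u n) ->
  (forall tau, 0 < tau -> \forall n \near \oo, u n <= tau) ->
  u n @[n --> \oo] --> (0 : R).
Proof.
move=> u0 h; apply/cvgrPdist_le => tau tau0; apply: filterS (h tau tau0) => n hn.
by rewrite sub0r normrN ger0_norm.
Qed.

Lemma near_small (p : nat -> R) (p0 : R) : (forall n, 0 <= p n <= 1) ->
  p n @[n --> \oo] --> (0 : R) -> 0 < p0 -> \forall n \near \oo, 0 <= p n < p0.
Proof.
move=> p01 /cvgrPdist_lt h p00; apply: filterS (h p0 p00) => n.
by have := p01 n; rewrite sub0r normrN => /andP[pn _]; rewrite ger0_norm // pn.
Qed.

End limits.

Theorem theorem4 (R : realType) (P : R -> probability config R)
    (hP : forall p : R, 0 <= p <= 1 -> is_product_measure p (P p)) :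
  (* (A) *)
  (forall (L : nat -> nat) (p : nat -> R),
     (forall n, (0 < L n)%N) -> (forall n, 0 <= p n <= 1) ->
     L n @[n --> \oo] --> \oo -> p n @[n --> \oo] --> (0 : R) ->
     (((lambda' R)%:E < limn_einf (fun n => (p n * ln (L n)%:R)%:E))%E ->
        I' P (L n) (p n) @[n --> \oo] --> (1 : R)) /\
     ((limn_esup (fun n => (p n * ln (L n)%:R)%:E) < (lambda' R)%:E)%E ->
        I' P (L n) (p n) @[n --> \oo] --> (0 : R))) /\
  (* (B) *)
  ((limf_esup
      (fun p : R =>
         ereal_sup [set (- p * ln (I' P m p))%:E | m in [set m | (0 < m)%N]])
      (0 : R)^'+ <= (2 * lambda' R)%:E)%E /\
   ((2 * lambda' R)%:E <=
      limf_einf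
        (fun B : R =>
           limf_einf
             (fun p : R => (- p * ln (I' P (Num.truncn (B / p)) p))%:E)
             (0 : R)^'+)
        (pinfty_nbhs R))%E) /\
  (* (C) *)
  (forall (t : nat -> nat) (p : nat -> R),
     (forall n, (0 < t n)%N) -> (forall n, 0 <= p n <= 1) ->
     t n @[n --> \oo] --> \oo -> p n @[n --> \oo] --> (0 : R) ->
     (((lambda' R)%:E < limn_einf (fun n => (p n * ln (t n)%:R)%:E))%E ->
        J' P (t n) (p n) @[n --> \oo] --> (1 : R)) /\
     ((limn_esup (fun n => (p n * ln (t n)%:R)%:E) < (lambda' R)%:E)%E ->
        J' P (t n) (p n) @[n --> \oo] --> (0 : R))).
Proof.
have I01 L p : 0 <= p <= 1 -> 0 <= I' P L p <= 1.
  move=> p01; rewrite (I'E hP) //; apply/andP; split.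
    by apply: Ex_ge0 => // A; exact: ind_ge0.
  by apply: Ex_le1 => // A; exact: ind_le1.
have J01 t p : 0 <= p <= 1 -> 0 <= J' P t p <= 1.
  move=> p01; rewrite (J'E hP) //; apply/andP; split.
    by apply: Ex_ge0 => // A; exact: ind_ge0.
  by apply: Ex_le1 => // A; exact: ind_le1.
split; [|split; [split|]].
- move=> L p L0 p01 Loo p0; split=> [/lt_limn_einf|/limn_esup_lt] [eps eps0 hl].
    apply: cvg_to_one => [n|tau tau0]; first exact: I01.
    have [q q0 hI] := I'_supercritical hP eps0 tau0.
    by apply: filterS2 (near_small p01 p0 q0) hl => n; exact: hI.
  apply: cvg_to_zero => [n|tau tau0]; first by have /andP[] := I01 (L n) (p n) (p01 n).
  have [q q0 [L1 hI]] := I'_subcritical hP eps0 tau0.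
  have hL : \forall n \near \oo, (L1 <= L n)%N by move/cvgnyPge : Loo; exact.
  by apply: filterS3 (near_small p01 p0 q0) hL hl => n; exact: hI.
- apply/lee_addgt0Pr => eps eps0.
  have [q q0 hq] := @poly_le_expR R 1 eps 1 ler01 eps0.
  have q10 : 0 < Num.min q 1 by rewrite lt_min q0 ltr01.
  apply: (limf_esup_le (nbhs_right0 q10)) => p /= /andP[p0].
  rewrite lt_min => /andP[pq p1].
  apply: ge_ereal_sup => _ [m m0 <-]; rewrite -EFinD lee_fin.
  have p01 : 0 < p < 1 by rewrite p0.
  have h := I'_ge_seed_prob hP p01 m0.
  have s0 : 0 < seed_prob p by rewrite /seed_prob mulr_gt0 ?expR_gt0.
  have h2 : ln (seed_prob p) <= ln (I' P m p).
    by rewrite ler_ln ?posrE //; exact: lt_le_trans h.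
  have h3 : ln (seed_prob p) = ln p - 2 * lambda' R / p.
    by rewrite /seed_prob lnM ?posrE ?expR_gt0 // expRK.
  (* Here [eps] pays for the prefactor [p] of [seed_prob]. *)
  have h4 : - ln p <= eps / p.
    have := hq p; rewrite p0 pq mul1r expr1 => /(_ isT) h5.
    by rewrite -lnV ?posrE // -[X in _ <= X]expRK ler_ln ?posrE ?expR_gt0 ?invr_gt0.
  rewrite (mulNr p) -(mulrN p).
  apply: (@le_trans _ _ (p * (2 * lambda' R / p + eps / p))).
    by rewrite ler_pM2l //; lra.
  by rewrite mulrDr !(mulrC p) !divfK ?gt_eqF.
- apply/lee_subgt0Pr => eps eps0.
  have [B0 B00 hB] := @ispan_upper R eps eps0.
  have near_B : pinfty_nbhs R [set B | Num.max B0 1 <= B].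
    exists (Num.max B0 1); split; first exact: num_real.
    by move=> B /ltW.
  apply: (limf_einf_ge near_B) => B /=; rewrite ge_max => /andP[BB B1].
  have [q q0 hq] := hB B BB.
  have q20 : 0 < Num.min q (1 / 2) by rewrite lt_min q0 divr_gt0.
  apply: (limf_einf_ge (nbhs_right0 q20)) => p /= /andP[p0].
  rewrite lt_min => /andP[pq p12].
  (* Thus rounding keeps [m] positive and at least [B / (2 p)], well inside the window of
     [ispan_upper]. *)
  have Bp : 2 <= B / p by rewrite ler_pdivlMr //; lra.
  set m := Num.truncn (B / p).
  have m0 : (0 < m)%N by rewrite truncn_gt0; lra.
  have mB : m%:R <= B / p by rewrite truncn_le; lra.
  have mB' : B / p < m%:R + 1 by rewrite natr1; exact: truncnS_gt.
  have p01 : 0 < p < 1 by lra.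
  have p01' : 0 <= p <= 1 by lra.
  (* As [ln] takes the value 0 at 0, a vanishing probability would falsify the bound; the seed
     estimate excludes it. *)
  have Ipos : 0 < I' P m p.
    apply: lt_le_trans (I'_ge_seed_prob hP p01 m0).
    by rewrite /seed_prob mulr_gt0 ?expR_gt0.
  have Ile : I' P m p <= expR (- ((2 * lambda' R - eps) / p)).
    apply: (le_trans (I'_le_ispan hP p01' m0)); apply: hq => //.
    - by rewrite p0.
    - exact: rsites_uniq.
    - exact: valid_rsquare.
    - rewrite longside_rsquare // mB andbT.
      have -> : B / (4 * p) = B / p / 4 by field; rewrite gt_eqF.
      lra.
  rewrite -EFinB lee_fin.
  have h : ln (I' P m p) <= - ((2 * lambda' R - eps) / p).
    by rewrite -[X in _ <= X]expRK ler_ln ?posrE ?expR_gt0.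
  rewrite (mulNr p) -(mulrN p).
  apply: (@le_trans _ _ (p * ((2 * lambda' R - eps) / p))); first by rewrite (mulrC p) divfK // gt_eqF.
  by rewrite ler_pM2l // lerNr.
- move=> t p t0 p01 too p0; split=> [/lt_limn_einf|/limn_esup_lt] [eps eps0 hl].
    apply: cvg_to_one => [n|tau tau0]; first exact: J01.
    have [q q0 hJ] := J'_supercritical hP eps0 tau0.
    by apply: filterS2 (near_small p01 p0 q0) hl => n; exact: hJ.
  apply: cvg_to_zero => [n|tau tau0]; first by have /andP[] := J01 (t n) (p n) (p01 n).
  have [q q0 hJ] := J'_subcritical hP eps0 tau0.
  by apply: filterS2 (near_small p01 p0 q0) hl => n pn; exact: hJ.
Qed.
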